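(* There is a separable infinite-dimensional real Banach space $X$ which is linearly isomorphic (i.e. linearly homeomorphic) to a Hilbert space but not linearly isometric to a Hilbert space, and such that both $X$ and its dual $X^*$ (with the dual norm) embed linearly isometrically into the real space $L_1([0,1])$.
   Context: All Banach and Hilbert spaces are real. $L_1([0,1])$ is taken with respect to Lebesgue measure. A linear isometric embedding is a linear map preserving norms (not necessarily onto). *)

(* Defs.v *)
From HB Require Import structures.
From mathcomp Require Import all_boot all_order all_algebra.
From mathcomp Require Import all_classical all_reals all_analysis.
From mathcomp Require Import measurable_realfun.

Set Implicit Arguments.
Unset Strict Implicit.
Unset Printing Implicit Defensive.

Import Order.TTheory GRing.Theory Num.Theory.
Import numFieldNormedType.Exports.

Local Open Scope classical_set_scope.
Local Open Scope ring_scope.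

Definition separable (X : topologicalType) : Prop :=
  exists2 D : set X, countable D & dense D.

Definition finite_dimensional (K : fieldType) (V : lmodType K) : Prop :=
  exists (n : nat) (v : 'I_n -> V),
    forall x : V, exists a : 'I_n -> K, x = \sum_(i < n) a i *: v i.

Definition hilbert (R : realType) (H : completeNormedModType R) : Prop :=
  exists dot : {dot H for idfun}, forall x : H, `|x| ^+ 2 = dot x x.

Section maps.
Context {R : realType}.
Implicit Types V W : normedModType R.

Definition isometric_embedding V W : Prop :=
  exists f : {linear V -> W}, forall x : V, `|f x| = `|x|.

Definition linearly_isometric V W : Prop :=
  exists f : {linear V -> W}, (forall x : V, `|f x| = `|x|) /\ bijective f.

Definition linearly_homeomorphic V W : Prop :=
  exists (f : {linear V -> W}) (g : {linear W -> V}),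
    [/\ cancel f g, cancel g f, continuous f & continuous g].

End maps.

Section dual.
Context {R : realType} (X : normedModType R).

Definition continuous_functional : {pred (X -> R^o)} :=
  mem [set f : X -> R^o | linear f /\ continuous f].

Record dual := Dual {
  dual_fun :> X -> R^o ;
  _ : dual_fun \in continuous_functional }.

HB.instance Definition _ := [isSub for dual_fun].
HB.instance Definition _ := [Choice of dual by <:].

Lemma continuous_functional_submod_closed :
  submod_closed continuous_functional.
Proof.
split.
  rewrite inE; split=> [a x y|x]; first by rewrite /= scaler0 addr0.
  exact: cvg_cst.
move=> a f g; rewrite !inE => -[lf cf] [lg cg]; split=> [b x y|x].
  rewrite !fctE lf lg !scalerDr !scalerA [b * a]mulrC.
  by rewrite -!addrA; congr (_ + _); rewrite !addrA [_ + b *: _]addrC.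
by apply: cvgD; [apply: cvgZl_tmp; exact: cf|exact: cg].
Qed.

HB.instance Definition _ := GRing.isSubmodClosed.Build R (X -> R^o)
  continuous_functional continuous_functional_submod_closed.

HB.instance Definition _ := [SubChoice_isSubLmodule of dual by <:].

Implicit Types f g : dual.

Definition dual_norm f : R :=
  sup [set `|f x| | x in [set x : X | `|x| <= 1]].

Lemma dual_linear f : linear f.
Proof. by case: f => f /=; rewrite inE => -[]. Qed.

Lemma dual_continuous f : continuous f.
Proof. by case: f => f /=; rewrite inE => -[]. Qed.

HB.instance Definition _ f :=
  GRing.isLinear.Build R X R^o *:%R f (dual_linear f).

Lemma dual_has_sup f :
  has_sup [set `|f x| | x in [set x : X | `|x| <= 1]].
Proof.
split; first by exists `|f 0|, 0 => //=; rewrite normr0.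
have /linear_bounded_continuous/linear_boundedP := @dual_continuous f.
move=> /pinfty_ex_gt0[M M0 fM]; exists M => _ [x /= x1 <-].
by rewrite (le_trans (fM x))// ler_piMr// ltW.
Qed.

Lemma dual_norm_ub f x : `|x| <= 1 -> `|f x| <= dual_norm f.
Proof.
by move=> x1; apply: (sup_upper_bound (dual_has_sup f)); exists x.
Qed.

Lemma dual_norm_le f c :
  (forall x, `|x| <= 1 -> `|f x| <= c) -> dual_norm f <= c.
Proof.
move=> fc; apply: ge_sup; first by case: (dual_has_sup f).
by move=> _ [x /= x1 <-]; exact: fc.
Qed.

Lemma dual_normD f g : dual_norm (f + g) <= dual_norm f + dual_norm g.
Proof.
apply: dual_norm_le => x x1.
by rewrite (le_trans (ler_normD _ _))// lerD// dual_norm_ub.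
Qed.

Let dual_normZ_le a f : dual_norm (a *: f) <= `|a| * dual_norm f.
Proof.
apply: dual_norm_le => x x1.
by rewrite normrZ ler_wpM2l// dual_norm_ub.
Qed.

Lemma dual_norm_ge0 f : 0 <= dual_norm f.
Proof. by apply: le_trans (@dual_norm_ub f 0 _); rewrite ?normr0. Qed.

Lemma dual_normZ a f : dual_norm (a *: f) = `|a| * dual_norm f.
Proof.
apply/eqP; rewrite eq_le dual_normZ_le/=.
have [->|a0] := eqVneq a 0; first by rewrite normr0 mul0r dual_norm_ge0.
rewrite -ler_pdivlMl ?normr_gt0// -normfV.
by rewrite -[in leLHS](scalerK a0 f) dual_normZ_le.
Qed.

Lemma dual_norm_eq0 f : dual_norm f = 0 -> f = 0.
Proof.
move=> f0; apply/val_inj/funext => x /=.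
have [->|x0] := eqVneq x 0; first exact: raddf0.
have : `|f (`|x|^-1 *: x)| <= 0.
  by rewrite -f0 dual_norm_ub// normrZ normfV normr_id mulVf// normr_eq0.
rewrite normr_le0 linearZ/= scaler_eq0 invr_eq0 normr_eq0 (negbTE x0)/=.
by move/eqP.
Qed.

HB.instance Definition _ := @Lmodule_isNormed.Build R dual dual_norm
  dual_normD dual_normZ dual_norm_eq0.

End dual.

(* LspaceType1 mu is the library's type of classes of integrable functions
   modulo a.e. equality; it comes without vector space or norm. The cast mfunR_of
   bridges the two measurable structures on R (same sigma-algebra) that LfunType
   and LspaceType1 use. *)
Section L1.
Context d (T : measurableType d) (R : realType).
Variable mu : {measure set T -> \bar R}.
Local Open Scope quotient_scope.

Definition L1 : Type := LspaceType1 mu.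

Local Notation L1fun := (LfunType mu (@lexx _ _ 1%E)).
Local Notation mfunR := {mfun T >-> measurableTypeR R}.
Local Notation mfun_ae := {mfun_ mu, T >-> measurableTypeR R}.

Implicit Types (f g : L1fun) (u v w : L1).

Let mfunR_of f : mfunR := HB.pack_for mfunR (f : T -> measurableTypeR R)
  (isMeasurableFun.Build _ _ T (measurableTypeR R) f
     (@measurable_funPT _ _ T R f)).

Let repr_pi_ae (f : mfunR) : repr (\pi_mfun_ae f) = f %[ae mu].
Proof.
have : repr (\pi_mfun_ae f) = f %[mod mfun_ae] by rewrite reprK.
by move=> /eqP; rewrite eqmodE => /asboolP.
Qed.

Let ae_eq_Lnorm1 (f g : T -> R) : measurable_fun setT f ->
  measurable_fun setT g -> f = g %[ae mu] ->
  'N[mu]_1[EFin \o f]%E = 'N[mu]_1[EFin \o g]%E.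
Proof.
move=> mf mg fg; rewrite !Lnorm1; apply: ge0_ae_eq_integral => //.
- by apply: measurableT_comp => //; apply/measurable_EFinP.
- by apply: measurableT_comp => //; apply/measurable_EFinP.
- by apply: filterS fg => x /= fgx _; rewrite fgx.
Qed.

Lemma pi_finite_norm f :
  finite_norm mu 1 (\pi_mfun_ae (mfunR_of f) : mfun_ae).
Proof.
rewrite /finite_norm (@ae_eq_Lnorm1 _ f _ _ (repr_pi_ae (mfunR_of f))) //.
- exact: Lfunction_finite.
- exact: (@measurable_funPT _ _ T (measurableTypeR R)).
Qed.

Definition L1_class f : L1 := HB.pack_for (LspaceType1 mu)
  (\pi_mfun_ae (mfunR_of f))
  (isFinLebesgue.Build _ _ _ mu 1%E (lexx 1%E) _ (pi_finite_norm f)).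

Lemma L1_Lfun u : (u : T -> R) \in Lfun mu 1.
Proof.
apply/andP; split; rewrite inE /=; last exact: (@Lebesgue_finite _ _ _ _ _ _ u).
exact: (@measurable_funPT _ _ T (measurableTypeR R)).
Qed.

Definition L1_repr u : L1fun := Lfun_Sub (lexx 1%E) (L1_Lfun u).

Lemma L1_class_repr f : L1_repr (L1_class f) = f %[ae mu].
Proof. exact: repr_pi_ae. Qed.

Lemma eq_L1 u v : u = v %[ae mu] -> u = v.
Proof.
move=> uv; have : LebesgueSpace.sort u = LebesgueSpace.sort v.
  rewrite -[LHS]reprK -[RHS]reprK; apply/eqP; rewrite eqmodE.
  exact/asboolP.
case: u v {uv} => [u [[pu]]] [v [[pv]]] /= uv.
by subst v; rewrite (Prop_irrelevance pu pv).
Qed.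

Lemma L1_classP f g : L1_class f = L1_class g <-> f = g %[ae mu].
Proof.
split=> [fg|fg].
  apply: ae_eq_trans (L1_class_repr g).
  by rewrite -fg; apply/ae_eq_sym/L1_class_repr.
apply: eq_L1; apply: ae_eq_trans (L1_class_repr f) _.
exact: ae_eq_trans fg (ae_eq_sym (L1_class_repr g)).
Qed.

Lemma L1_reprK u : L1_class (L1_repr u) = u.
Proof. exact/eq_L1/L1_class_repr. Qed.

HB.instance Definition _ := gen_eqMixin L1.
HB.instance Definition _ := gen_choiceMixin L1.

Definition L1_zero := L1_class 0.
Definition L1_opp u := L1_class (- L1_repr u).
Definition L1_add u v := L1_class (L1_repr u + L1_repr v).
Definition L1_scale (a : R) u := L1_class (a *: L1_repr u).
Definition L1_norm u : R := fine 'N[mu]_1[EFin \o (u : T -> R)]%E.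

Let L1_oppE f : L1_opp (L1_class f) = L1_class (- f).
Proof.
apply/L1_classP; apply: filterS (L1_class_repr f) => x fx xT.
exact: (congr1 -%R (fx xT)).
Qed.

Let L1_addE f g : L1_add (L1_class f) (L1_class g) = L1_class (f + g).
Proof.
apply/L1_classP; apply: filterS2 (L1_class_repr f) (L1_class_repr g).
by move=> x fx gx xT; exact: (congr2 +%R (fx xT) (gx xT)).
Qed.

Let L1_scaleE a f : L1_scale a (L1_class f) = L1_class (a *: f).
Proof.
apply/L1_classP; apply: filterS (L1_class_repr f) => x fx xT.
exact: (congr1 ( *%R a) (fx xT)).
Qed.

Let L1_normE f : L1_norm (L1_class f) = fine 'N[mu]_1[EFin \o f]%E.
Proof.
rewrite /L1_norm (@ae_eq_Lnorm1 _ f _ _ (L1_class_repr f))//.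
Qed.

Let L1_ind (P : L1 -> Prop) : (forall f, P (L1_class f)) -> forall u, P u.
Proof. by move=> Pf u; rewrite -(L1_reprK u). Qed.

Let L1_addA : associative L1_add.
Proof.
elim/L1_ind=> f; elim/L1_ind=> g; elim/L1_ind=> h.
by rewrite !L1_addE addrA.
Qed.

Let L1_addC : commutative L1_add.
Proof. by move=> u v; rewrite /L1_add addrC. Qed.

Let L1_add0 : left_id L1_zero L1_add.
Proof. by elim/L1_ind=> f; rewrite L1_addE add0r. Qed.

Let L1_addN : left_inverse L1_zero L1_opp L1_add.
Proof. by elim/L1_ind=> f; rewrite L1_oppE L1_addE addNr. Qed.

HB.instance Definition _ :=
  GRing.isZmodule.Build L1 L1_addA L1_addC L1_add0 L1_addN.

Let L1_scaleA a b u : L1_scale a (L1_scale b u) = L1_scale (a * b) u.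
Proof. by elim/L1_ind: u => f; rewrite !L1_scaleE scalerA. Qed.

Let L1_scale1 : left_id 1 L1_scale.
Proof. by elim/L1_ind=> f; rewrite L1_scaleE scale1r. Qed.

Let L1_scaleDr : right_distributive L1_scale +%R.
Proof.
move=> a; elim/L1_ind=> f; elim/L1_ind=> g.
by rewrite [_ + _]L1_addE !L1_scaleE [RHS]L1_addE scalerDr.
Qed.

Let L1_scaleDl u : {morph L1_scale^~ u : a b / a + b}.
Proof.
by elim/L1_ind: u => f a b; rewrite !L1_scaleE [RHS]L1_addE scalerDl.
Qed.

HB.instance Definition _ := GRing.Zmodule_isLmodule.Build R L1
  L1_scaleA L1_scale1 L1_scaleDr L1_scaleDl.

Lemma L1_normD u v : L1_norm (u + v) <= L1_norm u + L1_norm v.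
Proof.
elim/L1_ind: u => f; elim/L1_ind: v => g.
by rewrite [_ + _]L1_addE !L1_normE ler_LnormD.
Qed.

Lemma L1_normZ a u : L1_norm (a *: u) = `|a| * L1_norm u.
Proof.
elim/L1_ind: u => f; rewrite [_ *: _]L1_scaleE !L1_normE.
by apply/EFin_inj; rewrite EFinM !finite_norm_fine; exact: LnormZ.
Qed.

Lemma L1_norm_eq0 u : L1_norm u = 0 -> u = 0.
Proof.
elim/L1_ind: u => f; rewrite L1_normE => /fine_Lnormr_eq0 f0.
exact/L1_classP.
Qed.

HB.instance Definition _ := @Lmodule_isNormed.Build R L1 L1_norm
  L1_normD L1_normZ L1_norm_eq0.

Lemma L1_classD f g : L1_class (f + g) = L1_class f + L1_class g.
Proof. exact/esym/L1_addE. Qed.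

Lemma L1_classZ a f : L1_class (a *: f) = a *: L1_class f.
Proof. exact/esym/L1_scaleE. Qed.

Lemma normr_L1_class f : (`|L1_class f|%:E = \int[mu]_x `|(f x)%:E|)%E.
Proof.
by rewrite -Lnorm1 -(finite_norm_fine f) -L1_normE.
Qed.

End L1.

(* [0, 1] enters through the measure: an element is a class of functions on R
   modulo equality Lebesgue-a.e. on [0, 1]. *)
Definition L1_unit_interval (R : realType) : normedModType R :=
  L1 (mrestr (@lebesgue_measure R) (measurable_itv `[0, 1])).

(* Main.v *)
(* Give the sequences v = (x, v') of l2, with t = |v'|, the norm
   f(x, t) = (3 x^2 + 2 t^2) / sqrt(x^2 + t^2). It is equivalent to the l2 norm
   and violates the parallelogram law at e_0, e_1.

   If xi is a real random variable, y_0, y_1, ... are independent standard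
   Gaussians independent of xi, and M >= 0, then
   (x, v') |-> M (x xi + sum v'_i y_i) embeds l2 linearly in L1, with norm
   N(x, t) = M E|x xi + t y|, because sum v'_i y_i is distributed as t y.
   Averaging over the sign of y gives N(1, t) = M E max(|xi|, t |y|), a convex
   function of t with subgradient c M E exp(- xi^2 / (2 t^2)), where
   c = E|y| = sqrt(2 / pi). So a planar norm is of the form N once its
   t-derivative at (1, t) is c M times the Laplace transform of the law of
   xi^2 / 2, taken at 1 / t^2, the constant of integration being fixed by the
   behaviour as t tends to infinity. For the densities C xi^(2k) exp(- B xi^2 / 2) this
   transform is s |-> (B / (B + s))^(k + 1/2), so every expansion in these
   functions with nonnegative coefficients is allowed.

   For f the derivative is (1 + s)^(-1/2) + (1 + s)^(-3/2), s = 1 / t^2. The dual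
   of X carries the planar norm f* dual to f. Since f is the maximum of
   x s (3 + c^2) + t c (1 + c^2) over s^2 + c^2 = 1, the unit sphere of f* is
   parametrised by (s (3 + c^2), c (1 + c^2)), and the derivative of f* there is
   c / (3 - c^2). Its expansion in 1 / (64 + s), now with s the squared slope
   p^2 / q^2, has nonnegative coefficients because in the variable
   X = c^2 / (1 + c^2) it belongs to a class of nonnegative functions closed
   under d / d(1 / (64 + s)). *)
Require Import Defs.
From HB Require Import structures.
From mathcomp Require Import all_boot all_order all_algebra.
From mathcomp Require Import all_classical all_reals all_analysis.
From mathcomp Require Import measurable_realfun.
From mathcomp Require Import ring lra.

Set Implicit Arguments.
Unset Strict Implicit.
Unset Printing Implicit Defensive.

Import Order.TTheory GRing.Theory Num.Theory.
Import numFieldNormedType.Exports.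

Local Open Scope classical_set_scope.
Local Open Scope ring_scope.

(** * Expansions with nonnegative coefficients *)

(** The law of xi is explicit only for f, where two terms suffice. For f* nothing but the signs of
    the coefficients is accessible, so convergence of the expansion must follow from positivity of
    all derivatives. The number 64 is forced by algebra: u^-2 is a cubic in X divided by X, and
    adding 64 gives the cubic a double root, so that the half-integer powers of 1 / (64 + s)
    introduce only square roots of X and of one linear factor.

    Fixing the constant of integration is the second delicate point. A planar norm and the
    corresponding average are compared as convex functions with a common subgradient q, without
    differentiating either; both have an intercept, value minus u q(u), of order 1/u. On the
    probabilistic side this takes a second moment of xi, which is read off from convergence of the
    same expansion at a negative s.

    All the variables have to live on [0, 1], so independence is produced from binary digits. The
    triangle inequality of X is inherited from L1, and functionals on X are represented through the
    inner product of l2, which reduces the dual norm to a planar one. *)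

Section absolutely_monotone.
Variable R : realType.

Lemma is_deriveM_fun (f g : R -> R) (x df dg : R) :
  is_derive x 1 f df -> is_derive x 1 g dg ->
  is_derive x 1 (fun y => f y * g y) (df * g x + f x * dg).
Proof.
move=> fx gx; apply: (@is_derive_eq _ _ _ _ _ _ _ _ (is_deriveM fx gx)).
by rewrite /GRing.scale /= addrC [df * _]mulrC.
Qed.

Lemma is_deriveX_fun (f : R -> R) n (x df : R) :
  is_derive x 1 f df ->
  is_derive x 1 (fun y => f y ^+ n) (n%:R * f x ^+ n.-1 * df).
Proof.
move=> fx; have -> : (fun y => f y ^+ n) = f ^+ n.
  by apply/funext => y; rewrite exprfctE.
exact: (@is_derive_eq _ _ _ _ _ _ _ _ (is_deriveX n fx)).
Qed.

Lemma is_deriveV_fun (f : R -> R) (x df : R) : f x != 0 ->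
  is_derive x 1 f df -> is_derive x 1 (fun y => (f y)^-1) (- df / f x ^+ 2).
Proof.
move=> f0 fx; apply: (@is_derive_eq _ _ _ _ _ _ _ _ (is_deriveV f0 fx)).
by rewrite /GRing.scale /= mulNr mulrC mulNr.
Qed.

Lemma is_deriveD_fun (f g : R -> R) (x df dg : R) :
  is_derive x 1 f df -> is_derive x 1 g dg ->
  is_derive x 1 (fun y => f y + g y) (df + dg).
Proof. by move=> fx gx; exact: is_deriveD. Qed.

Lemma is_deriveB_fun (f g : R -> R) (x df dg : R) :
  is_derive x 1 f df -> is_derive x 1 g dg ->
  is_derive x 1 (fun y => f y - g y) (df - dg).
Proof. by move=> fx gx; exact: is_deriveB. Qed.

Lemma is_deriveZ_fun (f : R -> R) (a x df : R) :
  is_derive x 1 f df -> is_derive x 1 (fun y => a * f y) (a * df).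
Proof. by move=> fx; exact: (@is_deriveZ _ _ _ f a). Qed.

Lemma ge0_is_derive_le (f df : R -> R) (a b : R) : a <= b ->
  (forall x, a <= x <= b -> is_derive x 1 f (df x)) ->
  (forall x, a <= x <= b -> 0 <= df x) -> f a <= f b.
Proof.
move=> ab fdf df0; have [||c] := @MVT_segment R f df a b ab.
- by move=> x; rewrite in_itv/= => /andP[/ltW ax /ltW xb]; apply/fdf/andP.
- apply: derivable_within_continuous => x; rewrite in_itv/= => xab.
  by have [] := fdf _ xab.
rewrite in_itv/= => cab fab; rewrite -subr_ge0 fab mulr_ge0 ?df0//.
by rewrite subr_ge0.
Qed.

(* A class S of nonnegative functions closed under d/dz consists of functions
   that are absolutely monotone in z, hence equal to their Taylor series in z
   (Bernstein): the ratio of the remainder to z^n is nondecreasing. *)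
Variables (r : R) (z dz : R -> R) (S : (R -> R) -> Prop).
Hypothesis z0 : z 0 = 0.
Hypothesis zdz : forall x : R, 0 <= x < r -> is_derive x 1 z (dz x).
Hypothesis dz_gt0 : forall x : R, 0 <= x < r -> 0 < dz x.
Hypothesis S_ge0 : forall f, S f -> forall x : R, 0 <= x < r -> 0 <= f x.
Hypothesis S_derive : forall f, S f ->
  exists2 g, S g & forall x : R, 0 <= x < r -> is_derive x 1 f (dz x * g x).

(** Fixing one z-derivative for each member of the class makes differentiation iterable: [coef f k]
    is then the Taylor coefficient of order k at z = 0, and [rem n f] the remainder after n
    terms. *)
Let D (f : {f | S f}) : {f | S f} :=
  let P := cid2 (S_derive (svalP f)) in exist S (s2val P) (s2valP P).

Let DP f x : 0 <= x < r -> is_derive x 1 (sval f) (dz x * sval (D f) x).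
Proof. by move=> xr; rewrite /D /=; case: cid2 => g Sg /= +; exact. Qed.

Let T_ge0 (f : {f | S f}) x : 0 <= x < r -> 0 <= sval f x.
Proof. exact: S_ge0 (svalP f) x. Qed.

Let coef (f : {f | S f}) k : R := sval (iter k D f) 0 / k`!%:R.

Let rem n f x : R := sval f x - \sum_(k < n) coef f k * z x ^+ k.

Let coefS f k : coef f k.+1 * k.+1%:R = coef (D f) k.
Proof.
by rewrite /coef iterSr factS natrM invfM mulrCA mulrC mulVKf// pnatr_eq0.
Qed.

Let remS_derive n f (x : R) : 0 <= x < r ->
  is_derive x 1 (rem n.+1 f) (dz x * rem n (D f) x).
Proof.
move=> xr; have df := DP f xr; have ddz := zdz xr.
have dmon k : is_derive x 1 (fun y => coef f k * z y ^+ k)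
    (coef f k * (k%:R * z x ^+ k.-1 * dz x)).
  exact/is_deriveZ_fun/is_deriveX_fun.
have dsum m : is_derive x 1 (fun y => \sum_(k < m) coef f k * z y ^+ k)
    (\sum_(k < m) coef f k * (k%:R * z x ^+ k.-1 * dz x)).
  elim: m => [|m IH].
    under eq_fun do rewrite big_ord0; rewrite big_ord0; exact: is_derive_cst.
  under eq_fun do rewrite big_ord_recr /=; rewrite big_ord_recr /=.
  exact: is_deriveD_fun.
apply: (@is_derive_eq _ _ _ _ _ _ _ _ (is_deriveB_fun df (dsum n.+1))).
rewrite /rem mulrBr; congr (_ - _).
rewrite big_ord_recl /= !mul0r mulr0 add0r mulr_sumr; apply: eq_bigr => k _.
by rewrite -coefS /bump /= add1n; ring.
Qed.

Let rem0 n f : rem n.+1 f 0 = 0.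
Proof.
rewrite /rem big_ord_recl /= big1 ?addr0; last first.
  by move=> k _; rewrite z0 expr0n /= mulr0.
by rewrite expr0 mulr1 /coef /= fact0 divr1 subrr.
Qed.

Let rem_ge0 n f (x : R) : 0 <= x < r -> 0 <= rem n f x.
Proof.
elim: n f x => [|n IH] f x xr; first by rewrite /rem big_ord0 subr0 T_ge0.
have /andP[x0 xr'] := xr; rewrite -(rem0 n f).
have sub y : 0 <= y <= x -> 0 <= y < r.
  by case/andP=> -> yx; exact: le_lt_trans xr'.
apply: (@ge0_is_derive_le _ (fun y => dz y * rem n (D f) y)) => // y /sub yr.
- exact: remS_derive.
- by rewrite mulr_ge0 ?IH// ltW// dz_gt0.
Qed.

Let z_gt0 (x : R) : 0 < x < r -> 0 < z x.
Proof.
case/andP=> x0 xr; have sub y : 0 <= y <= x -> 0 <= y < r.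
  by case/andP=> -> yx; exact: le_lt_trans xr.
have [||c] := @MVT_segment R z dz 0 x (ltW x0).
- by move=> y; rewrite in_itv/= => /andP[/ltW y0 /ltW yx]; apply/zdz/sub/andP.
- apply: derivable_within_continuous => y; rewrite in_itv/= => yx.
  by have [] := zdz (sub _ yx).
rewrite in_itv/= z0 !subr0 => /sub cr ->.
by rewrite mulr_gt0// dz_gt0.
Qed.

(** The z-derivative of [rem n f]. Differentiation lowers the number of subtracted terms by one,
    except that [rem 0 f] is f itself. *)
Let drem n f x := if n is m.+1 then rem m (D f) x else sval (D f) x.

Let rem_derive n f (x : R) : 0 <= x < r ->
  is_derive x 1 (rem n f) (dz x * drem n f x).
Proof.
move=> xr; case: n => [|n]; last exact: remS_derive.
have -> : rem 0 f = sval f by apply/funext => y; rewrite /rem big_ord0 subr0.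
exact: DP.
Qed.

(** Induction on n: the z-derivative of [z * rem n (D f) - n.+1 * rem n.+1 f] is
    [z * drem n (D f) - n * rem n (D f)], and the difference vanishes at 0. *)
Let growth n f (x : R) : 0 <= x < r -> n%:R * rem n f x <= z x * drem n f x.
Proof.
elim: n f x => [|n IH] f x xr; have /andP[x0 xr'] := xr.
  rewrite mul0r mulr_ge0 ?T_ge0//; move: x0; rewrite le_eqVlt => /predU1P[<-|x0].
    by rewrite z0.
  by rewrite ltW// z_gt0// x0.
rewrite -subr_ge0 /=.
have sub y : 0 <= y <= x -> 0 <= y < r.
  by case/andP=> -> yx; exact: le_lt_trans xr'.
set g := fun y => z y * rem n (D f) y - n.+1%:R * rem n.+1 f y.
have <- : g 0 = 0 by rewrite /g z0 rem0 mulr0 mul0r subr0.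
apply: (@ge0_is_derive_le g (fun y => dz y * (z y * drem n (D f) y -
   n%:R * rem n (D f) y))) => // y /sub yr; last first.
  by rewrite mulr_ge0 ?subr_ge0 ?IH// ltW// dz_gt0.
apply: (@is_derive_eq _ _ _ _ _ _ _ _ (is_deriveB_fun
   (is_deriveM_fun (zdz yr) (rem_derive n (D f) yr))
   (is_deriveZ_fun n.+1%:R (remS_derive n f yr)))).
rewrite -[n.+1]addn1 natrD; ring.
Qed.

Let rem_ratio n f (x y : R) : 0 < x -> x <= y -> y < r ->
  rem n f x <= (z x / z y) ^+ n * rem n f y.
Proof.
move=> x0 xy yr; have y0 : 0 < y := lt_le_trans x0 xy.
have sub t : x <= t <= y -> 0 <= t < r.
  case/andP=> xt ty; rewrite (le_trans (ltW x0) xt)/=; exact: le_lt_trans yr.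
have sub' t : x <= t <= y -> 0 < t < r.
  case/andP=> xt ty; rewrite (lt_le_trans x0 xt)/=; exact: le_lt_trans yr.
have zx0 : 0 < z x ^+ n by rewrite exprn_gt0// z_gt0// x0 (le_lt_trans xy yr).
rewrite exprMn exprVn -mulrA -ler_pdivrMl// ![_ ^- n * _]mulrC.
apply: (@ge0_is_derive_le (fun t => rem n f t / z t ^+ n : R)
  (fun t => dz t * (z t * drem n f t - n%:R * rem n f t) / z t ^+ n.+1)) => //.
- move=> t txy; have zt := z_gt0 (sub' _ txy); have tr := sub _ txy.
  have zn0 : z t ^+ n != 0 by rewrite expf_neq0 ?gt_eqF.
  have dzn := is_deriveX_fun n (zdz tr).
  have dV := @is_deriveV_fun (fun y => z y ^+ n) t _ zn0 dzn.
  apply: (@is_derive_eq _ _ _ _ _ _ _ _ (is_deriveM_fun (rem_derive n f tr) dV)).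
  case: n {zx0 zn0 dzn dV} => [|n] /=.
    by rewrite !expr0; field; rewrite gt_eqF.
  by rewrite !exprS; field; rewrite expf_neq0 ?gt_eqF.
- move=> t txy; have zt := z_gt0 (sub' _ txy); have tr := sub _ txy.
  rewrite divr_ge0 ?exprn_ge0 ?(ltW zt)// mulr_ge0 ?subr_ge0 ?growth//.
  by rewrite ltW// dz_gt0.
Qed.

Theorem absolutely_monotone_expansion f : 0 < r -> S f ->
  exists d : nat -> R, (forall k, 0 <= d k) /\
    forall x, 0 <= x < r ->
      (fun n => \sum_(k < n) d k * z x ^+ k) @ \oo --> f x.
Proof.
move=> r0 Sf; pose F : {f | S f} := exist S f Sf.
exists (coef F); split => [k|x xr].
  by rewrite /coef divr_ge0// T_ge0// lexx r0.
have /andP[x0 xr'] := xr.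
suff remc : (fun n => rem n F x) @ \oo --> (0 : R).
  have -> : (fun n => \sum_(k < n) coef F k * z x ^+ k) = 
      (fun n => f x - rem n F x).
    by apply/funext => n; rewrite /rem opprB addrCA subrr addr0.
  by rewrite -[X in _ --> X]subr0; apply: cvgB => //; exact: cvg_cst.
move: x0; rewrite le_eqVlt => /predU1P[x0|x0].
  apply: cvg_near_cst; exists 1%N => // -[//|n] _; by rewrite -x0 rem0.
(* At a point y between x and r the remainders stay below f y, and z x / z y < 1 is the geometric
   rate of convergence at x. *)
set y := (x + r) / 2; have xy : x < y by rewrite /y; lra.
have yr : y < r by rewrite /y; lra.
have y0 : 0 < y by rewrite (lt_trans x0 xy).
have zy : 0 < z y by rewrite z_gt0// y0.
have zx : 0 < z x by rewrite z_gt0// x0.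
have zxy : z x < z y.
  have [||c] := @MVT R z dz x y xy.
  - move=> t; rewrite in_itv/= => /andP[xt ty]; apply: zdz.
    by rewrite (ltW (lt_trans x0 xt)) (lt_trans ty).
  - apply: derivable_within_continuous => t; rewrite in_itv/= => /andP[xt ty].
    have [] // := @zdz t.
    by rewrite (le_trans (ltW x0) xt) (le_lt_trans ty).
  rewrite in_itv/= => /andP[xc cy] e; rewrite -subr_gt0 e mulr_gt0 ?subr_gt0//.
  by rewrite dz_gt0// (ltW (lt_trans x0 xc)) (lt_trans cy).
apply: (@squeeze_cvgr _ _ _ _ (cst 0) (fun n => (z x / z y) ^+ n * f y)).
- near=> n; rewrite rem_ge0//= (le_trans (rem_ratio n F x0 (ltW xy) yr))//.
  rewrite ler_wpM2l ?exprn_ge0 ?divr_ge0 ?(ltW zx) ?(ltW zy)//.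
  rewrite /rem /= gerBl sumr_ge0// => k _; rewrite mulr_ge0//.
    by rewrite /coef divr_ge0// T_ge0// lexx r0.
  by rewrite exprn_ge0// ltW.
- exact: cvg_cst.
- rewrite -[X in _ --> X](mul0r (f y)); apply: cvgMl.
  apply: cvg_expr; rewrite ger0_norm ?divr_ge0 ?(ltW zx) ?(ltW zy)//.
  by rewrite ltr_pdivrMr// mul1r.
Unshelve. all: by end_near. Qed.

End absolutely_monotone.

(** * The power series attached to the dual planar norm *)

Section dual_expansion.
Variable R : realType.

(* With zeta below, d/dzeta = A d/dx where
   A = (1 + 2x)^3 (3 + 10x/(3 - 4x)) (3 + 4x/(3 - 2x)), so this class is closed
   under d/dzeta. *)
Inductive nneg_gen : (R -> R) -> Prop :=
| nneg_cst c : 0 <= c -> nneg_gen (fun=> c)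
| nneg_id : nneg_gen id
| nneg_inv34 : nneg_gen (fun x => (3 - 4 * x)^-1)
| nneg_inv32 : nneg_gen (fun x => (3 - 2 * x)^-1)
| nneg_inv11 : nneg_gen (fun x => (1 - x)^-1)
| nneg_inv92 : nneg_gen (fun x => (9 - 2 * x)^-1)
| nneg_root : nneg_gen (fun x =>
    Num.sqrt ((9 - 2 * x) * (1 - x)) / (3 - 4 * x))
| nneg_add f g : nneg_gen f -> nneg_gen g -> nneg_gen (fun x => f x + g x)
| nneg_mul f g : nneg_gen f -> nneg_gen g -> nneg_gen (fun x => f x * g x).

Ltac nneg_tac := solve [repeat first
  [ done | apply: nneg_cst | apply: nneg_id | apply: nneg_inv34
  | apply: nneg_inv32 | apply: nneg_inv11 | apply: nneg_inv92
  | apply: nneg_root | apply: nneg_add | apply: nneg_mul ]].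

Lemma nneg_gen_ge0 f : nneg_gen f -> forall x : R, 0 <= x < 3/4 -> 0 <= f x.
Proof.
elim=> {f} [c c0|||||||f g _ IHf _ IHg|f g _ IHf _ IHg] x /[dup] xr /andP[x0 x1].
- by [].
- by [].
- by rewrite invr_ge0; lra.
- by rewrite invr_ge0; lra.
- by rewrite invr_ge0; lra.
- by rewrite invr_ge0; lra.
- by rewrite divr_ge0 ?sqrtr_ge0//; lra.
- by rewrite addr_ge0 ?IHf ?IHg.
- by rewrite mulr_ge0 ?IHf ?IHg.
Qed.

Let is_derive_aff (a b x : R) : is_derive x 1 (fun y : R => a - b * y) (- b).
Proof.
have := @is_deriveB_fun R _ _ x _ _ (is_derive_cst a x 1)
  (is_deriveZ_fun b (is_derive_id x 1)).
by rewrite sub0r mulr1.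
Qed.

Let derive_inv (a b x : R) : 0 < a - b * x ->
  is_derive x 1 (fun y => (a - b * y)^-1) (b * ((a - b * x)^-1 * (a - b * x)^-1)).
Proof.
move=> ab; apply: (@is_derive_eq _ _ _ _ _ _ _ _
  (@is_deriveV_fun R _ x _ (lt0r_neq0 ab) (is_derive_aff a b x))).
by rewrite opprK -exprVn expr2.
Qed.

Lemma nneg_gen_derive f : nneg_gen f ->
  exists2 g, nneg_gen g &
    forall x : R, 0 <= x < 3/4 -> is_derive x 1 f (g x).
Proof.
have n0 : 0 <= 2 :> R by [].
have n1 : 0 <= 4 :> R by [].
have n2 : 0 <= 15 :> R by [].
have n3 : 0 <= 2^-1 :> R by rewrite invr_ge0.
elim=> {f} [c c0|||||||f g Sf [df Sdf dfE] Sg [dg Sdg dgE]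
  |f g Sf [df Sdf dfE] Sg [dg Sdg dgE]].
- exists (fun=> 0); first exact: nneg_cst.
  by move=> x _; exact: is_derive_cst.
- exists (fun=> 1); first exact: nneg_cst.
  by move=> x _; exact: is_derive_id.
- exists (fun x => 4 * ((3 - 4 * x)^-1 * (3 - 4 * x)^-1)).
    by nneg_tac.
  by move=> x /andP[x0 x1]; apply: derive_inv; lra.
- exists (fun x => 2 * ((3 - 2 * x)^-1 * (3 - 2 * x)^-1)).
    by nneg_tac.
  by move=> x /andP[x0 x1]; apply: derive_inv; lra.
- exists (fun x => (1 - x)^-1 * (1 - x)^-1).
    by nneg_tac.
  move=> x /andP[x0 x1]; have := @derive_inv 1 1 x.
  rewrite !mul1r; under eq_fun do rewrite mul1r.
  by apply; lra.
- exists (fun x => 2 * ((9 - 2 * x)^-1 * (9 - 2 * x)^-1)).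
    by nneg_tac.
  by move=> x /andP[x0 x1]; apply: derive_inv; lra.
(* The logarithmic derivative is 4/(3 - 4x) - 1/(2(1 - x)) - 1/(9 - 2x). Each half of the first term
   absorbs one negative term: 2/(3 - 4x) - 1/(2(1 - x)) = 1/(2(3 - 4x)(1 - x)) and 2/(3 - 4x) - 1/(9
   - 2x) = 15/((3 - 4x)(9 - 2x)). *)
- exists (fun x => Num.sqrt ((9 - 2 * x) * (1 - x)) / (3 - 4 * x) *
     (2^-1 * ((3 - 4 * x)^-1 * (1 - x)^-1) +
      15 * ((3 - 4 * x)^-1 * (9 - 2 * x)^-1))).
    by nneg_tac.
  move=> x /andP[x0 x1].
  have p0 : 0 < (9 - 2 * x) * (1 - x) by apply: mulr_gt0; lra.
  have d1 := is_derive_aff 9 2 x; have d2 := is_derive_aff 1 1 x.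
  have d2' : is_derive x 1 (fun y : R => 1 - y) (- 1).
    by move: d2; under eq_fun do rewrite mul1r.
  have d3 := is_deriveM_fun d1 d2'.
  have d4 := @is_derive1_comp _ Num.sqrt _ x _ _ (is_derive1_sqrt p0) d3.
  have q0 : 0 < 3 - 4 * x by lra.
  apply: (@is_derive_eq _ _ _ _ _ _ _ _ (is_deriveM_fun d4 (derive_inv q0))).
  rewrite /=; set s := Num.sqrt _.
  have s0 : 0 < s by rewrite sqrtr_gt0.
  have ss : s ^+ 2 = (9 - 2 * x) * (1 - x) by rewrite sqr_sqrtr// ltW.
  have -> : (2 * s)^-1 = s / (2 * ((9 - 2 * x) * (1 - x))).
    by rewrite -ss; field; rewrite gt_eqF.
  field; rewrite !gt_eqF//=; lra.
- exists (fun x => df x + dg x); first exact: nneg_add.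
  by move=> x xr; apply: is_deriveD_fun; [exact: dfE|exact: dgE].
- exists (fun x => df x * g x + f x * dg x).
    by apply: nneg_add; exact: nneg_mul.
  by move=> x xr; apply: is_deriveM_fun; [exact: dfE|exact: dgE].
Qed.

(** Here 64 x + (1 - 2x)(3 - 2x)^2 = (1 + 2x)^2 (9 - 2x): the constant 64 creates the double root at
    -1/2, which makes the factor 1 + 2x leave the square root of zeta. *)
Definition zeta (x : R) := x / ((1 + 2 * x) ^+ 2 * (9 - 2 * x)).

(** With c^2 = x / (1 - x), the limit is c / (3 - c^2) divided by sqrt(zeta x). The interval ends at
    3/4, where c^2 = 3 and the derivative of zeta vanishes. *)
Lemma dual_expansion : exists d : nat -> R, (forall k, 0 <= d k) /\
  forall x, 0 <= x < 3/4 ->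
    (fun n => \sum_(k < n) d k * zeta x ^+ k) @ \oo -->
    (1 + 2 * x) * (Num.sqrt ((9 - 2 * x) * (1 - x)) / (3 - 4 * x)).
Proof.
pose dz (x : R) := (3 - 4 * x) * (3 - 2 * x) / ((1 + 2 * x) ^+ 3 * (9 - 2 * x) ^+ 2).
have lin : nneg_gen (fun x => 1 + 2 * x).
  by nneg_tac.
apply: (@absolutely_monotone_expansion R (3/4) zeta dz nneg_gen) => //.
- by rewrite /zeta mul0r.
- move=> x /andP[x0 x1].
  have d1 : is_derive x 1 (fun y : R => 1 + 2 * y) 2.
    have := @is_deriveD_fun R _ _ x _ _ (is_derive_cst (1 : R) x 1)
      (is_deriveZ_fun 2 (is_derive_id x 1)).
    by rewrite add0r mulr1.
  have d2 := is_deriveM_fun (is_deriveX_fun 2 d1) (is_derive_aff 9 2 x).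
  have n0 : (1 + 2 * x) ^+ 2 * (9 - 2 * x) != 0.
    by rewrite mulf_neq0// ?expf_neq0//; lra.
  have d3 := @is_deriveV_fun R _ x _ n0 d2.
  apply: (@is_derive_eq _ _ _ _ _ _ _ _ (is_deriveM_fun (is_derive_id x 1) d3)).
  rewrite /dz /=; field; apply/andP; split; lra.
- move=> x /andP[x0 x1]; rewrite /dz divr_gt0// mulr_gt0 ?exprn_gt0//; lra.
- exact: nneg_gen_ge0.
- move=> f /nneg_gen_derive[g Sg fg].
  (* The factor 9 - 2x decreases, so it is outside the class, but (9 - 2x)/(3 - 4x) = 3 + 10x/(3 -
     4x) and (9 - 2x)/(3 - 2x) = 3 + 4x/(3 - 2x) belong to it. *)
  exists (fun x => ((1 + 2 * x) * ((1 + 2 * x) * (1 + 2 * x))) *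
     ((3 + 10 * (x * (3 - 4 * x)^-1)) * (3 + 4 * (x * (3 - 2 * x)^-1))) * g x).
    by nneg_tac.
  move=> x xr; apply: (@is_derive_eq _ _ _ _ _ _ _ _ (fg x xr)).
  rewrite /dz; move/andP: xr => [x0 x1]; field.
  by do ?(apply/andP; split); lra.
- apply: nneg_mul => //; exact: nneg_root.
Qed.

End dual_expansion.

(** * Convex functions with a common subgradient *)

Section subgradient.
Variable R : realType.

Definition subgradient (q k : R -> R) :=
  forall u v, 0 < u -> 0 < v -> k u + q u * (v - u) <= k v.

(** Both increments k1 v - k1 u and k2 v - k2 u lie between q u (v - u) and q v (v - u). *)
Lemma subgradient_diff (q k1 k2 : R -> R) (u v : R) :
  subgradient q k1 -> subgradient q k2 -> 0 < u -> u <= v ->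
  `|(k1 v - k2 v) - (k1 u - k2 u)| <= (q v - q u) * (v - u).
Proof.
move=> s1 s2 u0 uv; have v0 := lt_le_trans u0 uv.
have a1 := s1 u v u0 v0; have a2 := s1 v u v0 u0.
have b1 := s2 u v u0 v0; have b2 := s2 v u v0 u0.
by rewrite ler_norml; apply/andP; split; nra.
Qed.

(* Subdividing [u, v] into n pieces divides the bound by n. *)
Lemma subgradient_diff_div (q k1 k2 : R -> R) (u v : R) n :
  subgradient q k1 -> subgradient q k2 -> 0 < u -> u <= v ->
  `|(k1 v - k2 v) - (k1 u - k2 u)| <= (q v - q u) * (v - u) / n.+1%:R.
Proof.
move=> s1 s2 u0 uv; pose h := (v - u) / n.+1%:R.
have h0 : 0 <= h by rewrite divr_ge0// subr_ge0.
suff H m : `|(k1 (u + m%:R * h) - k2 (u + m%:R * h)) - (k1 u - k2 u)| <=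
    (q (u + m%:R * h) - q u) * h.
  have := H n.+1; rewrite (_ : u + n.+1%:R * h = v).
    by rewrite /h mulrA.
  by rewrite /h mulrC divfK ?pnatr_eq0// addrC subrK.
elim: m => [|m IH]; first by rewrite mul0r addr0 !subrr normr0 mul0r.
have e : u + m.+1%:R * h = u + m%:R * h + h.
  by rewrite -[m.+1]addn1 natrD mulrDl mul1r addrA.
have mh : 0 <= m%:R * h by rewrite mulr_ge0.
have p0 : 0 < u + m%:R * h by lra.
rewrite e; set w := u + m%:R * h in IH p0 *.
have ww : w <= w + h by rewrite lerDl.
have S := subgradient_diff s1 s2 p0 ww.
have := ler_normD (k1 (w + h) - k2 (w + h) - (k1 w - k2 w))
  (k1 w - k2 w - (k1 u - k2 u)).
rewrite addrA subrK; move=> /le_trans; apply.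
rewrite (le_trans (lerD S IH))// [w + h]addrC addrK; lra.
Qed.

(** Ever finer subdivisions show that k1 - k2 is constant. The constant is zero because at some
    points both functions are arbitrarily close to u q(u). *)
Lemma subgradient_unique (q k1 k2 : R -> R) :
  subgradient q k1 -> subgradient q k2 ->
  (forall e, 0 < e -> exists2 u, 0 < u &
     `|k1 u - u * q u| <= e /\ `|k2 u - u * q u| <= e) ->
  forall u, 0 < u -> k1 u = k2 u.
Proof.
move=> s1 s2 lim u u0.
have cst v : u <= v -> k1 v - k2 v = k1 u - k2 u.
  move=> uv; apply/eqP; rewrite -subr_eq0 -normr_le0.
  apply/ler_addgt0Pr => e e0; rewrite add0r.
  pose c := (q v - q u) * (v - u).
  have c0 : 0 <= c by apply: le_trans (subgradient_diff s1 s2 u0 uv).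
  apply: le_trans (subgradient_diff_div (Num.trunc (c / e)) s1 s2 u0 uv) _.
  rewrite -/c ler_pdivrMr// mulrC -ler_pdivrMr//.
  by rewrite ltW// truncnS_gt.
have cst' v : 0 < v -> v <= u -> k1 v - k2 v = k1 u - k2 u.
  move=> v0 vu; apply/esym/eqP; rewrite -subr_eq0 -normr_le0.
  apply/ler_addgt0Pr => e e0; rewrite add0r.
  pose c := (q u - q v) * (u - v).
  have c0 : 0 <= c by apply: le_trans (subgradient_diff s1 s2 v0 vu).
  apply: le_trans (subgradient_diff_div (Num.trunc (c / e)) s1 s2 v0 vu) _.
  rewrite -/c ler_pdivrMr// mulrC -ler_pdivrMr//.
  by rewrite ltW// truncnS_gt.
apply/eqP; rewrite -subr_eq0 -normr_le0; apply/ler_addgt0Pr => e e0.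
rewrite add0r; have [v v0 [h1 h2]] := lim (e / 2) (divr_gt0 e0 (ltr0Sn _ 1)).
have -> : k1 u - k2 u = (k1 v - v * q v) - (k2 v - v * q v).
  have [uv|/ltW vu] := leP u v; [rewrite -(cst v uv)|rewrite -(cst' v v0 vu)]; lra.
by rewrite (le_trans (ler_normB _ _))//; lra.
Qed.

End subgradient.

(** * Two independent uniform variables on [0, 1] *)

Section rays.
Variable R : realType.
Local Notation mR := (measurableTypeR R).
Local Open Scope ereal_scope.

Lemma measure_eq_rays (m1 m2 : {measure set mR -> \bar R}) :
  (forall a : R, m1 `]-oo, a[%classic = m2 `]-oo, a[%classic) ->
  (m1 setT < +oo) -> forall A : set mR, measurable A -> m1 A = m2 A.
Proof.
move=> m12 fin1 A mA.
refine (measure_unique (@RGenInftyO.G R : set (set mR))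
  (fun k => `]-oo, k%:R[%classic) _ _ _ _ m1 m2 _ _ A mA).
- exact: RGenInftyO.measurableE.
- move=> _ _ [x ->] [y ->]; exists (Num.min x y); apply/seteqP; split => z /=.
    by rewrite !in_itv/= lt_min => -[-> ->].
  by rewrite !in_itv/= lt_min => /andP[].
- by move=> i; exists i%:R.
- apply/seteqP; split => // x _; exists (Num.trunc x).+1 => //=.
  by rewrite in_itv/= truncnS_gt.
- by move=> _ [x ->].
- move=> k; apply: le_lt_trans fin1; apply: le_measure; rewrite ?inE//.
Qed.

End rays.

Section bits.
Variable R : realType.
Local Notation mR := (measurableTypeR R).
Local Open Scope ereal_scope.

Definition unif : probability mR R := @uniform_prob R 0 1 ltr01.

Lemma unifE (A : set mR) : measurable A ->
  unif A = lebesgue_measure (A `&` `[0%R, 1%R]).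
Proof.
move=> mA; rewrite /unif/= /uniform_prob integral_uniform_pdf.
rewrite (eq_integral (fun=> 1%:E)); last first.
  by move=> x; rewrite inE/= in_itv/= /uniform_pdf => -[_ ->]; rewrite subr0 invr1.
by rewrite integral_cst ?mul1e//; exact: measurableI.
Qed.

(** The distribution function of the uniform law on [0, 1]. *)
Definition clamp (x : R) : R := Num.min 1%R (Num.max 0%R x).

Lemma clamp_le0 x : (x <= 0)%R -> clamp x = 0%R.
Proof. by move=> x0; rewrite /clamp max_l// min_r. Qed.

Lemma clamp_ge1 x : (1 <= x)%R -> clamp x = 1%R.
Proof. by move=> x1; rewrite /clamp min_l// le_max x1 orbT. Qed.

Lemma clamp_id x : (0 <= x <= 1)%R -> clamp x = x.
Proof. by move=> /andP[x0 x1]; rewrite /clamp max_r// min_r. Qed.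

Lemma unif_itv (a b : R) : (0 <= a)%R -> (a <= b)%R ->
  unif `[a, b[%classic = (clamp b - clamp a)%:E.
Proof.
move=> a0 ab; rewrite unifE//.
have [b1|b1] := leP b 1%R.
  rewrite (_ : _ `&` _ = `[a, b[%classic); last first.
    apply/seteqP; split => x /=; rewrite !in_itv/=; first by case.
    by move=> /andP[ax xb]; split; lra.
  rewrite !clamp_id; [|by lra..].
  rewrite lebesgue_measure_itv/= lte_fin; case: ltP => [ab'|ba].
    by rewrite -EFinB.
  have -> : b = a by lra.
  by rewrite subrr.
rewrite (clamp_ge1 (ltW b1)).
have [a1|a1] := leP a 1%R; last first.
  rewrite clamp_ge1 ?(ltW a1)// subrr (_ : _ `&` _ = set0) ?measure0//.
  apply/seteqP; split => x //=; rewrite !in_itv/= => -[/andP[? ?] /andP[? ?]]; lra.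
rewrite (_ : _ `&` _ = `[a, 1%R]%classic); last first.
  apply/seteqP; split => x /=; rewrite !in_itv/=.
    by move=> -[/andP[? ?] /andP[? ?]]; apply/andP; split; lra.
  by move=> /andP[? ?]; split; apply/andP; split; lra.
rewrite clamp_id ?a0//.
rewrite lebesgue_measure_itv/= lte_fin; case: ltP => [ab'|ba].
  by rewrite EFinB.
have -> : a = 1%R by lra.
by rewrite subrr.
Qed.

Lemma unif_ray (b : R) : unif `]-oo, b[%classic = (clamp b)%:E.
Proof.
have [b0|b0] := leP b 0%R.
  rewrite unifE// (_ : _ `&` _ = set0); last first.
    by apply/seteqP; split => x //=; rewrite !in_itv/= => -[? /andP[? ?]]; lra.
  by rewrite measure0 clamp_le0.
rewrite unifE// (_ : _ `&` _ = `[0%R, b[%classic `&` `[0%R, 1%R]).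
  by rewrite -unifE// unif_itv ?(ltW b0)// (clamp_le0 (lexx 0%R)) subr0.
apply/seteqP; split => x /=; rewrite !in_itv/=.
  by move=> [-> /andP[-> ->]].
by move=> [/andP[_ ->]].
Qed.

Definition bit (u : R) : R := (2^-1 <= u)%R%:R.
Definition dbl (u : R) : R := (2 * u - bit u)%R.

Lemma measurable_bit : measurable_fun [set: mR] bit.
Proof.
rewrite (_ : bit = \1_(`[2^-1%R, +oo[)); first exact: measurable_indic.
by apply/funext => x; rewrite /bit indicE mem_setE in_itv/= andbT.
Qed.

Lemma measurable_dbl : measurable_fun [set: mR] (dbl : mR -> mR).
Proof.
apply: measurable_funB; last exact: measurable_bit.
exact: measurable_funM.
Qed.

(** The first binary digit is a fair coin, independent of the number [dbl u] formed by the remaining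
    digits, which is again uniform. It suffices to test B on rays. *)
Lemma unif_bit_dbl (i : bool) (B : set mR) : measurable B ->
  unif ([set u | bit u = i%:R%R] `&` dbl @^-1` B) = 2^-1%:E * unif B.
Proof.
move=> mB; pose E := [set u | bit u = i%:R%R].
have mE : measurable E.
  have -> : E = bit @^-1` [set i%:R%R] by [].
  by rewrite -[X in measurable X]setTI; apply: measurable_bit.
pose m1 := measure_function_pushforward__canonical__measure_function_Measure (mrestr unif mE) measurable_dbl.
have h0 : (0 <= 2^-1 :> R)%R by rewrite invr_ge0.
pose m2 : {measure set mR -> \bar R} := mscale (NngNum h0) unif.
have -> : unif (E `&` dbl @^-1` B) = m1 B.
  by rewrite /m1/= /pushforward /mrestr /= setIC.
rewrite -[RHS]/(m2 B).
apply: measure_eq_rays mB => [a|]; last first.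
  rewrite /m1/= /pushforward/= /mrestr/=.
  by rewrite preimage_setT setTI -/(unif E) (@le_lt_trans _ _ 1)// ?ltry//; exact: probability_le1.
rewrite /m1 /m2/= /pushforward/= /mrestr/= /mscale/= unif_ray -EFinM.
rewrite /E; case: i {E mE m1 m2} => /=.
  have [a0|a0] := leP 0%R a.
    rewrite (_ : _ `&` _ = `[2^-1%R, ((a + 1) / 2)%R[%classic).
      rewrite unif_itv//; [|by lra]; rewrite (@clamp_id 2^-1%R); [|by lra].
      have [a1|/ltW a1] := leP a 1%R.
        by rewrite !clamp_id; [congr _%:E; lra|lra..].
      by rewrite !clamp_ge1; [congr _%:E; lra|lra..].
    apply/seteqP; split => x /=; rewrite !in_itv/= /dbl /bit; case: (leP 2^-1%R x) => /= h.
    - by move=> [? _]; lra.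
    - by move=> [? ?]; lra.
    - by move=> ?; split => //; lra.
    - by [].
  rewrite (_ : _ `&` _ = set0) ?measure0 ?clamp_le0 ?mulr0 ?(ltW a0)//.
  apply/seteqP; split => x //=; rewrite !in_itv/= /dbl /bit; case: (leP 2^-1%R x) => /= h.
  - by move=> [? _]; lra.
  - by move=> [? ?]; lra.
rewrite (_ : _ `&` _ = `]-oo, Num.min 2^-1%R (a / 2)%R[%classic).
  rewrite unif_ray; have [a0|/ltW a0] := leP a 0%R.
    by rewrite min_r ?clamp_le0 ?mulr0//; lra.
  have [a1|/ltW a1] := leP a 1%R.
    by rewrite min_r ?clamp_id; [congr _%:E; lra|lra..].
  by rewrite min_l; [rewrite (@clamp_id 2^-1%R); [rewrite clamp_ge1 ?mulr1|lra]|lra].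
apply/seteqP; split => x /=; rewrite !in_itv/= /dbl /bit lt_min; case: (leP 2^-1%R x) => /= h.
- by move=> [? ?]; lra.
- by move=> [? _]; lra.
- by [].
- by move=> ?; split => //; lra.
Qed.

(* Among the binary digits of u, phi u keeps those of odd rank and psi u those of
   even rank. *)
Fixpoint phin n (u : R) : R :=
  if n is m.+1 then ((bit u + phin m (dbl (dbl u))) / 2)%R else 0%R.

Lemma phin_itv n u : (0 <= phin n u <= 1)%R.
Proof.
elim: n u => [|n IH] u /=; first by rewrite lexx ler01.
have /andP[] := IH (dbl (dbl u)); rewrite /bit.
case: (leP 2^-1%R u) => _ /= h0 h1; apply/andP; split; lra.
Qed.

Lemma phin_nd u : nondecreasing_seq (phin^~ u).
Proof.
apply/nondecreasing_seqP => n; elim: n u => [|n IH] u.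
  by have /andP[] := phin_itv 1 u.
by rewrite /= ler_pM2r ?invr_gt0// lerD2l; exact: IH.
Qed.

Definition phi (u : R) : R := limn (phin^~ u).

Lemma cvg_phin u : (phin^~ u) @ \oo --> phi u.
Proof.
apply: (@nondecreasing_is_cvgn R (phin^~ u)); first exact: phin_nd.
by exists 1%R => _ [n _ <-]; have /andP[] := phin_itv n u.
Qed.

Lemma phi_itv u : (0 <= phi u <= 1)%R.
Proof.
apply/andP; split.
  apply: limr_ge; first by apply: cvgP; exact: cvg_phin.
  by near=> n; have /andP[] := phin_itv n u.
apply: limr_le; first by apply: cvgP; exact: cvg_phin.
by near=> n; have /andP[] := phin_itv n u.
Unshelve. all: by end_near. Qed.

Lemma phiE u : phi u = ((bit u + phi (dbl (dbl u))) / 2)%R.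
Proof.
apply: (@cvg_unique _ _ ((phin^~ u \o S) @ \oo)) => //=.
  by rewrite cvg_shiftS; exact: cvg_phin.
rewrite /comp /=; apply: cvgMl; apply: cvgD; first exact: cvg_cst.
exact: cvg_phin.
Qed.

Lemma measurable_phin n : measurable_fun [set: mR] (phin n : mR -> R).
Proof.
elim: n => [|n IH] /=; first exact: measurable_cst.
apply: measurable_funM => //; apply: measurable_funD; first exact: measurable_bit.
apply: measurableT_comp => //; apply: measurableT_comp; exact: measurable_dbl.
Qed.

Lemma measurable_phi : measurable_fun [set: mR] (phi : mR -> mR).
Proof.
apply: (measurable_fun_cvg (h := phin)); first exact: measurable_phin.
by move=> x _; exact: cvg_phin.
Qed.

Definition psi (u : R) : R := phi (dbl u).

Lemma measurable_psi : measurable_fun [set: mR] (psi : mR -> mR).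
Proof. by apply: measurableT_comp; [exact: measurable_phi|exact: measurable_dbl]. Qed.

Lemma unif_split (A : set mR) : measurable A ->
  unif A = unif ([set u | bit u = true%:R%R] `&` A) +
           unif ([set u | bit u = false%:R%R] `&` A).
Proof.
move=> mA.
have mE i : measurable (bit @^-1` [set i] : set mR).
  by rewrite -[X in measurable X]setTI; apply: measurable_bit.
rewrite -measureU.
- rewrite -setIUl (_ : _ `|` _ = setT) ?setTI//; apply/seteqP; split => // x _ /=.
  by rewrite /bit; case: leP => _; [left|right].
- exact: measurableI (mE _) mA.
- exact: measurableI (mE _) mA.
- by apply/seteqP; split => x //= [[h1 _] [h2 _]]; lra.
Qed.

Definition joint (a c : R) : set mR :=
  phi @^-1` `]-oo, a[%classic `&` psi @^-1` `]-oo, c[%classic.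

Lemma measurable_joint a c : measurable (joint a c).
Proof.
apply: measurableI; rewrite -[X in measurable X]setTI.
  by apply: measurable_phi.
by apply: measurable_psi.
Qed.

(** Removing one digit exchanges the two subsequences: phi u = (bit u + psi (dbl u)) / 2 and psi u =
    phi (dbl u). The twin statement below undoes the exchange. *)
Lemma joint_half (i : bool) a c :
  [set u | bit u = i%:R%R] `&` joint a c =
  [set u | bit u = i%:R%R] `&` dbl @^-1` (psi @^-1` `]-oo, (2 * a - i%:R)%R[%classic
     `&` phi @^-1` `]-oo, c[%classic).
Proof.
case: i; apply/seteqP; split => u /=;
  rewrite /joint /= !in_itv/= /psi (phiE u) => -[-> /= [h1 h2]];
  by split => //; split => //; lra.
Qed.

Lemma joint_half' (i : bool) a c :
  [set u | bit u = i%:R%R] `&` (psi @^-1` `]-oo, a[%classic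
     `&` phi @^-1` `]-oo, c[%classic) =
  [set u | bit u = i%:R%R] `&` dbl @^-1` joint a (2 * c - i%:R).
Proof.
case: i; apply/seteqP; split => u /=;
  rewrite /joint /= !in_itv/= /psi (phiE u) => -[-> /= [h1 h2]];
  by split => //; split => //; lra.
Qed.

Let Jr a c : R := fine (unif (joint a c)).

Let JrE a c : unif (joint a c) = (Jr a c)%:E.
Proof.
by rewrite /Jr fineK// fin_num_measure//; exact: measurable_joint.
Qed.

(** Removing two digits brings (phi, psi) back to itself, each of the four digit pairs having
    probability 1/4. By [clamp_rec] the product of two uniform distribution functions obeys the same
    recursion. *)
Let J_rec a c : Jr a c = ((Jr (2 * a) (2 * c) + Jr (2 * a) (2 * c - 1) +
  Jr (2 * a - 1) (2 * c) + Jr (2 * a - 1) (2 * c - 1)) / 4)%R.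
Proof.
apply: EFin_inj; rewrite -JrE.
have mT x y : measurable (psi @^-1` `]-oo, x[%classic `&` phi @^-1` `]-oo, y[%classic : set mR).
  apply: measurableI; rewrite -[X in measurable X]setTI.
    by apply: measurable_psi.
  by apply: measurable_phi.
have split_T x y : unif (psi @^-1` `]-oo, x[%classic `&` phi @^-1` `]-oo, y[%classic) =
    (2^-1 * Jr x (2 * y - 1) + 2^-1 * Jr x (2 * y))%:E.
  rewrite unif_split// !joint_half' EFinD !EFinM -!JrE; congr (_ + _).
    exact: (unif_bit_dbl true (measurable_joint _ _)).
  rewrite (unif_bit_dbl false (measurable_joint _ _)).
  by rewrite subr0.
rewrite unif_split; last exact: measurable_joint.
rewrite !joint_half.
transitivity (2^-1%:E * (2^-1 * Jr (2 * a - 1) (2 * c - 1) + 2^-1 * Jr (2 * a - 1) (2 * c))%:E +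
  2^-1%:E * (2^-1 * Jr (2 * a) (2 * c - 1) + 2^-1 * Jr (2 * a) (2 * c))%:E).
  congr (_ + _).
    by rewrite -split_T; exact: (unif_bit_dbl true).
  by rewrite -split_T (unif_bit_dbl false)// subr0.
by rewrite -!EFinM -EFinD; congr _%:E; lra.
Qed.

Let clamp_rec x : (clamp (2 * x) + clamp (2 * x - 1) = 2 * clamp x)%R.
Proof.
have [x0|x0] := leP x 0%R; first by rewrite !clamp_le0; lra.
have [x2|x2] := leP x (2^-1)%R.
  by rewrite (@clamp_id (2 * x)%R) ?(@clamp_le0 (2 * x - 1)%R) ?(@clamp_id x); lra.
have [x1|x1] := leP x 1%R.
  by rewrite (@clamp_ge1 (2 * x)%R) ?(@clamp_id (2 * x - 1)%R) ?(@clamp_id x); lra.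
by rewrite !clamp_ge1; lra.
Qed.

Let clamp01 x : (0 <= clamp x <= 1)%R.
Proof.
have [x0|x0] := leP x 0%R; first by rewrite clamp_le0// lexx ler01.
have [x1|x1] := leP x 1%R; first by rewrite clamp_id x1 ?ltW.
by rewrite clamp_ge1 ?lexx ?ler01// ltW.
Qed.

Let Jr01 a c : (0 <= Jr a c <= 1)%R.
Proof.
rewrite -!lee_fin -JrE measure_ge0/=.
by apply: probability_le1; exact: measurable_joint.
Qed.

Let J0l a c : (a <= 0)%R -> Jr a c = 0%R.
Proof.
move=> a0; rewrite /Jr (_ : joint a c = set0) ?measure0//.
apply/seteqP; split => x //=; rewrite /joint /= !in_itv/= => -[h _].
by have /andP[h0 _] := phi_itv x; lra.
Qed.

Let J0r a c : (c <= 0)%R -> Jr a c = 0%R.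
Proof.
move=> a0; rewrite /Jr (_ : joint a c = set0) ?measure0//.
apply/seteqP; split => x //=; rewrite /joint /= !in_itv/= => -[_ h].
by have /andP[h0 _] := phi_itv (dbl x); move: h; rewrite /psi => h; lra.
Qed.

Let J1 a c : (1 < a)%R -> (1 < c)%R -> Jr a c = 1%R.
Proof.
move=> a1 c1; rewrite /Jr (_ : joint a c = setT).
  by rewrite probability_setT.
apply/seteqP; split => x //= _; rewrite /joint /= !in_itv/= /psi.
have /andP[_ h0] := phi_itv x; have /andP[_ h1] := phi_itv (dbl x).
by split; lra.
Qed.

(* Among the four terms of the recursion at least one has no defect, so the
   defect of the joint law shrinks by a factor 3/4 at each step. *)
Let J_defect n a c : (`|Jr a c - clamp a * clamp c| <= (3 / 4) ^+ n)%R.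
Proof.
elim: n a c => [|n IH] a c.
  rewrite expr0 ler_norml; have := clamp01 a; have := clamp01 c.
  have := Jr01 a c; move=> /andP[? ?] /andP[? ?] /andP[? ?].
  by apply/andP; split; nra.
pose e x y := (Jr x y - clamp x * clamp y)%R.
have e0l x y : (x <= 0)%R -> e x y = 0%R.
  by move=> x0; rewrite /e J0l// clamp_le0// mul0r subr0.
have e0r x y : (y <= 0)%R -> e x y = 0%R.
  by move=> x0; rewrite /e J0r// (@clamp_le0 y)// mulr0 subr0.
have e1 x y : (1 < x)%R -> (1 < y)%R -> e x y = 0%R.
  by move=> x1 y1; rewrite /e J1// !clamp_ge1 ?mulr1 ?subrr// ltW.
have -> : (Jr a c - clamp a * clamp c = (e (2 * a) (2 * c) + e (2 * a) (2 * c - 1) +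
  e (2 * a - 1) (2 * c) + e (2 * a - 1) (2 * c - 1)) / 4)%R.
  rewrite J_rec /e; have := clamp_rec a; have := clamp_rec c.
  set x := clamp a; set y := clamp c; set x1 := clamp (2 * a)%R; set y1 := clamp (2 * c)%R.
  set x2 := clamp (2 * a - 1)%R; set y2 := clamp (2 * c - 1)%R => h1 h2.
  have -> : x = ((x1 + x2) / 2)%R by lra.
  have -> : y = ((y1 + y2) / 2)%R by lra.
  by field.
rewrite exprS; have q0 : (0 <= (3 / 4 : R) ^+ n)%R by rewrite exprn_ge0//; lra.
have := IH (2 * a)%R (2 * c)%R; have := IH (2 * a)%R (2 * c - 1)%R.
have := IH (2 * a - 1)%R (2 * c)%R; have := IH (2 * a - 1)%R (2 * c - 1)%R.
rewrite -!/(e _ _) !ler_norml.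
move=> /andP[? ?] /andP[? ?] /andP[? ?] /andP[? ?].
have [ha|ha] := leP a (2^-1)%R.
  have z1 : e (2 * a - 1)%R (2 * c - 1)%R = 0%R by apply: e0l; lra.
  by apply/andP; split; lra.
have [hc|hc] := leP c (2^-1)%R.
  have z1 : e (2 * a - 1)%R (2 * c - 1)%R = 0%R by apply: e0r; lra.
  by apply/andP; split; lra.
have z1 : e (2 * a)%R (2 * c)%R = 0%R by apply: e1; lra.
by apply/andP; split; lra.
Qed.

Lemma unif_joint a c : unif (joint a c) = (clamp a * clamp c)%:E.
Proof.
rewrite JrE; congr _%:E; apply/eqP; rewrite -subr_eq0 -normr_le0.
have q : (fun n => (3 / 4 : R) ^+ n)%R @ \oo --> (0 : R)%R.
  by apply: cvg_expr; rewrite ger0_norm; lra.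
rewrite -(cvg_lim _ q)//; apply: limr_ge; first by apply: cvgP; exact: q.
by near=> n; exact: J_defect.
Unshelve. all: by end_near. Qed.


(** Independence passes from rays to Borel sets one coordinate at a time: B is a ray while A varies,
    then A is fixed and B varies. *)
Lemma unif_pair (A B : set mR) : measurable A -> measurable B ->
  unif (phi @^-1` A `&` psi @^-1` B) = unif A * unif B.
Proof.
have mphi (E : set mR) : measurable E -> measurable (phi @^-1` E : set mR).
  by move=> mE; rewrite -[X in measurable X]setTI; apply: measurable_phi.
have mpsi (E : set mR) : measurable E -> measurable (psi @^-1` E : set mR).
  by move=> mE; rewrite -[X in measurable X]setTI; apply: measurable_psi.
have fin_restr (E : set mR) (mE : measurable E) (f : mR -> mR) :
    pushforward (mrestr unif mE) f setT < +oo.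
  rewrite /pushforward /mrestr preimage_setT setTI.
  by rewrite (@le_lt_trans _ _ 1)// ?ltry//; exact: probability_le1.
have ray (c : R) (E : set mR) : measurable E ->
    unif (phi @^-1` E `&` psi @^-1` `]-oo, c[%classic) = unif E * (clamp c)%:E.
  move=> mE.
  have mr : measurable (psi @^-1` `]-oo, c[%classic : set mR) by exact: mpsi.
  have /andP[c0 _] := clamp01 c.
  pose m1 := measure_function_pushforward__canonical__measure_function_Measure
    (mrestr unif mr) measurable_phi.
  pose m2 : {measure set mR -> \bar R} := mscale (NngNum c0) unif.
  have : m1 E = m2 E.
    apply: measure_eq_rays mE => [a|]; last exact: fin_restr.
    rewrite /m1 /m2/= /pushforward/= /mrestr/= /mscale/= unif_ray.
    by rewrite (unif_joint a c) mulrC.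
  by rewrite /m1 /m2/= /pushforward/= /mrestr/= /mscale/= muleC.
move=> mA mB; have mr := mphi _ mA.
have Afin : unif A \is a fin_num by exact: fin_num_measure.
have A0 : (0 <= fine (unif A))%R by exact: fine_ge0.
pose m1 := measure_function_pushforward__canonical__measure_function_Measure
  (mrestr unif mr) measurable_psi.
pose m2 : {measure set mR -> \bar R} := mscale (NngNum A0) unif.
have : m1 B = m2 B.
  apply: measure_eq_rays mB => [c|]; last exact: fin_restr.
  rewrite /m1 /m2/= /pushforward/= /mrestr/= /mscale/= unif_ray fineK// setIC.
  exact: ray.
by rewrite /m1 /m2/= /pushforward/= /mrestr/= /mscale/= fineK// setIC.
Qed.

Lemma ge0_integral_unif_pair (h : mR * mR -> \bar R) :
  measurable_fun setT h -> (forall z, 0 <= h z) ->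
  \int[unif]_u h (phi u, psi u) = \int[unif]_x \int[unif]_y h (x, y).
Proof.
move=> mh h0; pose pr (u : mR) : mR * mR := (phi u, psi u).
have mpr : measurable_fun setT pr.
  by apply/measurable_fun_pairP; split; [exact: measurable_phi|exact: measurable_psi].
have := @ge0_integral_pushforward _ _ _ _ R pr mpr unif setT h measurableT mh.
rewrite preimage_setT => <-; last by move=> z _; exact: h0.
rewrite (eq_measure_integral (unif \x unif)); last first.
  move=> E mE _; apply/esym.
  apply: (@product_measure_unique _ _ _ _ R unif unif
    (measure_function_pushforward__canonical__measure_function_Measure unif mpr)) mE.
  move=> A B mA mB; rewrite /=  /pushforward.
  exact: unif_pair.
by rewrite fubini_tonelli1.
Qed.

End bits.

(** * Gaussian sequences on [0, 1] *)

Section quantile.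
Variable R : realType.
Local Notation mR := (measurableTypeR R).
Local Open Scope ereal_scope.
Variable P : probability mR R.

Let F (x : R) : R := fine (P `]-oo, x[%classic).

Let FE x : P `]-oo, x[%classic = (F x)%:E.
Proof. by rewrite /F fineK// fin_num_measure. Qed.

Let F_nd : {homo F : x y / (x <= y)%R}.
Proof.
move=> x y xy; rewrite -lee_fin -!FE; apply: le_measure; rewrite ?inE//.
by move=> z /=; rewrite !in_itv/= => /lt_le_trans; exact.
Qed.

(** Left continuity of F, defined with open rays; it is what makes the equivalence [qP] hold with
    strict inequalities. *)
Let F_left x u : (u < F x)%R -> exists2 y, (y < x)%R & (u < F y)%R.
Proof.
move=> uF; pose E n : set mR := `]-oo, (x - n.+1%:R^-1)%R[%classic.
have EU : \bigcup_n E n = `]-oo, x[%classic.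
  apply/seteqP; split => z /=.
    move=> [n _]; rewrite /E/= !in_itv/= => zx.
    by apply: lt_trans zx _; rewrite ltrBlDr ltrDl invr_gt0.
  rewrite in_itv/= => zx; exists (Num.trunc (x - z)^-1) => //.
  rewrite /E/= in_itv/= ltrBrDr -ltrBrDl.
  by rewrite invf_plt ?posrE ?subr_gt0// truncnS_gt.
have cE : P (E n) @[n --> \oo] --> P `]-oo, x[%classic.
  rewrite -EU; apply: nondecreasing_cvg_mu; [by move=> n; exact: measurable_itv|
    by rewrite EU|].
  move=> n m nm; apply/subsetPset => z; rewrite /E/= !in_itv/= => /lt_le_trans; apply.
  by rewrite lerD2l lerN2 lef_pV2 ?posrE// ler_nat.
have cF : F (x - n.+1%:R^-1)%R @[n --> \oo] --> F x.
  by apply: fine_cvg; rewrite -FE.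
have [N _ hN] := cvgr_gt _ cF _ uF.
exists (x - N.+1%:R^-1)%R; last exact: hN (leqnn N).
by rewrite ltrBlDr ltrDl invr_gt0.
Qed.

Let F_top u : (u < 1)%R -> exists y, (u < F y)%R.
Proof.
move=> u1; pose E n : set mR := `]-oo, n%:R%R[%classic.
have EU : \bigcup_n E n = setT.
  apply/seteqP; split => // z _; exists (Num.trunc z).+1 => //.
  by rewrite /E/= in_itv/= truncnS_gt.
have cE : P (E n) @[n --> \oo] --> P setT.
  rewrite -EU; apply: nondecreasing_cvg_mu; [by move=> n; exact: measurable_itv|
    by rewrite EU|].
  move=> n m nm; apply/subsetPset => z; rewrite /E/= !in_itv/= => /lt_le_trans; apply.
  by rewrite ler_nat.
have cF : F n%:R @[n --> \oo] --> (1 : R)%R.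
  by apply: fine_cvg; rewrite probability_setT in cE.
have [N _ hN] := cvgr_gt _ cF _ u1.
by exists N%:R; exact: hN (leqnn N).
Qed.

Let F_bot u : (0 < u)%R -> exists y, (F y < u)%R.
Proof.
move=> u1; pose E n : set mR := `]-oo, (- n%:R)%R[%classic.
have EU : \bigcap_n E n = set0.
  apply/seteqP; split => // z /(_ (Num.trunc (- z)).+1 I).
  rewrite /E/= in_itv/= => h; have := truncnS_gt (- z)%R; lra.
have cE : P (E n) @[n --> \oo] --> P set0.
  rewrite -EU; apply: nonincreasing_cvg_mu.
  - by rewrite -ge0_fin_numE// fin_num_measure//; exact: measurable_itv.
  - by move=> n; exact: measurable_itv.
  - by rewrite EU.
  - move=> n m nm; apply/subsetPset => z; rewrite /E/= !in_itv/= => /lt_le_trans; apply.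
    by rewrite lerN2 ler_nat.
have cF : F (- n%:R) @[n --> \oo] --> (0 : R)%R.
  by apply: fine_cvg; rewrite measure0 in cE.
have [N _ hN] := cvgr_lt _ cF _ u1.
by exists (- N%:R)%R; exact: hN (leqnn N).
Qed.

(** The generalised inverse of F. Outside ]0, 1[, a null set for [unif], the set under the infimum
    may be empty or unbounded below, whence the default 0. *)
Let q (u : R) : R := if (0 < u < 1)%R then inf [set y | (u < F y)%R] else 0%R.

Let qP u x : (0 < u < 1)%R -> (q u < x)%R = (u < F x)%R.
Proof.
move=> u01; have /andP[u0 u1] := u01; rewrite /q u01.
have hi : has_inf [set y | (u < F y)%R].
  split; first by have [y] := F_top u1; exists y.
  have [y yu] := F_bot u0; exists y => z /= uz.
  by rewrite leNgt; apply/negP => /ltW/F_nd; lra.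
apply/idP/idP => [h|/F_left[y yx uy]].
  have h' : (0 < x - inf [set y | (u < F y)%R])%R by rewrite subr_gt0.
  have [y /= uy yx] := inf_adherent h' hi.
  apply: lt_le_trans uy _; apply: F_nd; lra.
apply: le_lt_trans yx; apply: ge_inf => //; exact: hi.2.
Qed.

Let measurable_q : measurable_fun [set: mR] (q : mR -> mR).
Proof.
have mF : measurable_fun [set: mR] (F : mR -> R).
  exact: nondecreasing_measurable.
move=> mD; apply: (measurability _ (@RGenInftyO.measurableE R)) => //.
move=> _ [_ [x ->] <-]; rewrite setTI.
(* The second set of the union comes from the default value of [q]. *)
rewrite (_ : _ @^-1` _ = (`]0%R, 1%R[%classic `&` `]-oo, F x[%classic) `|`
   (~` `]0%R, 1%R[%classic `&` (if (0 < x)%R then setT else set0))).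
  apply: measurableU; apply: measurableI => //; first exact: measurableC.
  by case: ifP.
apply/seteqP; split => u /=; rewrite !in_itv/=.
  have [u01|u01] := boolP (0 < u < 1)%R; first by rewrite qP//; left.
  by rewrite {1}/q (negbTE u01) => x0; right; rewrite x0.
move=> [[u01]|[/negP u01]]; first by rewrite qP.
by rewrite /q (negbTE u01); case: ifP.
Qed.

Let unif_open (A : set mR) : measurable A -> unif R A = unif R (A `&` `]0%R, 1%R[).
Proof.
move=> mA; have m01 : measurable (`]0%R, 1%R[%classic : set mR) by [].
have u1 : unif R `]0%R, 1%R[%classic = 1.
  rewrite unifE// (_ : _ `&` _ = `]0%R, 1%R[%classic).
    by rewrite lebesgue_measure_itv/= lte01 sube0.
  apply/seteqP; split => x /=; rewrite !in_itv/=; first by case.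
  by move=> /andP[? ?]; split; apply/andP; split; lra.
have u0 : unif R (~` `]0%R, 1%R[%classic) = 0 by rewrite probability_setC// u1 subee.
rewrite [LHS](measureDI _ mA m01); apply: (etrans _ (add0e _)); congr (_ + _).
apply: (@subset_measure0 _ _ _ (unif R) _ (~` `]0%R, 1%R[%classic)) u0.
- exact: measurableD.
- exact: measurableC.
- by move=> x [].
Qed.

Lemma quantile : exists2 q : mR -> mR, measurable_fun setT q &
  forall h : mR -> \bar R, measurable_fun setT h -> (forall x, 0 <= h x) ->
    \int[unif R]_u h (q u) = \int[P]_x h x.
Proof.
exists q => // h mh h0.
have := @ge0_integral_pushforward _ _ mR mR R q measurable_q (unif R) setT h measurableT mh.
rewrite preimage_setT => <-; last by move=> z _; exact: h0.
apply: eq_measure_integral => A mA _.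
apply: (@measure_eq_rays R
  (measure_function_pushforward__canonical__measure_function_Measure (unif R) measurable_q) P) mA => [a|].
  change (unif R (q @^-1` `]-oo, a[%classic) = P `]-oo, a[%classic); rewrite FE.
  have F01 : (0 <= F a <= 1)%R.
    by rewrite -!lee_fin -FE measure_ge0/= probability_le1.
  rewrite -[in RHS](clamp_id F01) -unif_ray unif_open; last first.
    have mr : measurable (`]-oo, a[%classic : set mR) by [].
    by have := measurable_q measurableT mr; rewrite setTI.
  rewrite [RHS]unif_open//; congr (unif R _); apply/seteqP; split => u /=.
    by rewrite !in_itv/= => -[h1 u01]; rewrite -qP.
  by rewrite !in_itv/= => -[h1 u01]; rewrite qP.
by rewrite /=/pushforward preimage_setT probability_setT ltry.
Qed.
End quantile.

(** * Laws with a density, and changes of variable on the line *)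

Section density.
Variable R : realType.
Local Notation mR := (measurableTypeR R).
Local Notation leb := (@lebesgue_measure R).
Local Open Scope ereal_scope.
Import HBNNSimple.

Lemma integral_density (m : {measure set mR -> \bar R}) (p : mR -> R) :
  measurable_fun setT p -> (forall x, 0 <= p x)%R ->
  (forall A, measurable A -> m A = \int[leb]_(x in A) (p x)%:E) ->
  forall h : mR -> \bar R, measurable_fun setT h -> (forall x, 0 <= h x) ->
    \int[m]_x h x = \int[leb]_x (h x * (p x)%:E).
Proof.
move=> mp p0 mE h mh h0.
have mpE : measurable_fun setT (EFin \o p) by exact/measurable_EFinP.
have indic (E : set mR) : measurable E ->
    \int[m]_x (\1_E x)%:E = \int[leb]_x ((\1_E x)%:E * (p x)%:E).
  move=> mE'; rewrite integral_indic// setIT mE// integral_mkcond.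
  apply: eq_integral => x _; rewrite patchE indicE; case: ifPn => _.
    by rewrite mul1e.
  by rewrite mul0e.
have nnsfun (f : {nnsfun mR >-> R}) :
    \int[m]_x (f x)%:E = \int[leb]_x ((f x)%:E * (p x)%:E).
  under [LHS]eq_integral do rewrite fimfunE -fsumEFin//.
  rewrite [LHS]ge0_integral_fsum//; last 2 first.
    - by move=> r; apply/measurable_EFinP; exact: measurableT_comp.
    - by move=> n x _; rewrite EFinM nnfun_muleindic_ge0.
  under [RHS]eq_integral.
    move=> x _; rewrite fimfunE -fsumEFin// ge0_mule_fsuml; last first.
      by move=> r; rewrite EFinM nnfun_muleindic_ge0.
    over.
  rewrite [RHS]ge0_integral_fsum//; last 2 first.
    - move=> r; apply: emeasurable_funM => //; apply/measurable_EFinP.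
      exact: measurableT_comp.
    - move=> n x _; rewrite mule_ge0//; last by rewrite lee_fin.
      by rewrite EFinM nnfun_muleindic_ge0.
  apply: eq_fsbigr => r _.
  have [r0|r0] := ltP r 0%R.
    rewrite preimage_nnfun0//.
    by rewrite !integral0_eq// => x _; rewrite indicE in_set0 mulr0 ?mul0e.
  under eq_integral do rewrite EFinM.
  under [RHS]eq_integral do rewrite EFinM -muleA.
  rewrite ge0_integralZl//; last by apply/measurable_EFinP; exact: measurable_indic.
  rewrite ge0_integralZl//; first by rewrite indic.
    by apply: emeasurable_funM => //; apply/measurable_EFinP; exact: measurable_indic.
  by move=> x _; rewrite mule_ge0// lee_fin.
pose f_ := nnsfun_approx measurableT mh.
transitivity (limn (fun n => \int[m]_x (f_ n x)%:E)).
  rewrite -monotone_convergence//=.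
  - apply: eq_integral => x _; apply/esym/cvg_lim => //=.
    by apply: cvg_nnsfun_approx => // *; exact: h0.
  - by move=> n; apply/measurable_EFinP.
  - by move=> n x _; rewrite lee_fin.
  - by move=> x _ a b ab; rewrite lee_fin//; exact/lefP/nd_nnsfun_approx.
transitivity (limn (fun n => \int[leb]_x ((f_ n x)%:E * (p x)%:E))).
  by apply: congr_lim; apply/funext => n; exact: nnsfun.
rewrite -monotone_convergence//=.
- apply: eq_integral => x _; apply/cvg_lim => //=.
  apply: cvgeZr => //.
  by apply: cvg_nnsfun_approx => // *; exact: h0.
- by move=> n; apply: emeasurable_funM => //; apply/measurable_EFinP.
- by move=> n x _; rewrite mule_ge0// lee_fin.
- move=> x _ a b ab; rewrite lee_wpmul2r ?lee_fin//; exact/lefP/nd_nnsfun_approx.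
Qed.

Section density_prob.
Variables (p : mR -> R) (mp : measurable_fun setT p).
Hypotheses (p0 : forall x, (0 <= p x)%R) (p1 : \int[leb]_x (p x)%:E = 1).

Let dm (A : set mR) := \int[leb]_(x in A) (p x)%:E.

Let dm0 : dm set0 = 0. Proof. exact: integral_set0. Qed.

Let dm_ge0 A : 0 <= dm A.
Proof. by apply: integral_ge0 => x _; rewrite lee_fin. Qed.

Let dm_sigma : semi_sigma_additive dm.
Proof.
move=> F mF tF mUF; rewrite /dm ge0_integral_bigcup//.
- by apply: is_cvg_ereal_nneg_natsum_cond => n _ _; exact: dm_ge0.
- exact/measurable_funTS/measurable_EFinP.
- by move=> x _; rewrite lee_fin.
Qed.

HB.instance Definition _ := isMeasure.Build _ _ _ dm dm0 dm_ge0 dm_sigma.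
HB.instance Definition _ := @Measure_isProbability.Build _ _ R dm p1.

Lemma density_prob : exists P : probability mR R,
  forall h : mR -> \bar R, measurable_fun setT h -> (forall x, 0 <= h x) ->
    \int[P]_x h x = \int[leb]_x (h x * (p x)%:E).
Proof. by exists dm => h mh h0; exact: integral_density. Qed.

End density_prob.

Lemma ge0_integral_opp (h : mR -> \bar R) :
  measurable_fun setT h -> (forall x, 0 <= h x) ->
  \int[leb]_x h (- x)%R = \int[leb]_x h x.
Proof.
move=> mh h0; have mN : measurable_fun setT (-%R : mR -> mR) by [].
have := @ge0_integral_pushforward _ _ mR mR R _ mN leb setT h measurableT mh.
rewrite preimage_setT => <-; last by move=> z _; exact: h0.
by apply: eq_measure_integral => A mA _; exact: lebesgue_measureN.
Qed.

Lemma ge0_integral_affine (a c : R) (h : mR -> \bar R) : (0 < a)%R ->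
  measurable_fun setT h -> (forall x, 0 <= h x) ->
  a%:E * \int[leb]_x h (a * x + c)%R = \int[leb]_x h x.
Proof.
move=> a0 mh h0; pose f (x : mR) : mR := (a * x + c)%R.
have mf : measurable_fun setT f.
  by apply: measurable_funD => //; exact: measurable_funM.
have := @ge0_integral_pushforward _ _ mR mR R f mf leb setT h measurableT mh.
rewrite preimage_setT => <-; last by move=> z _; exact: h0.
pose m1 : {measure set mR -> \bar R} := mscale (NngNum (ltW a0))
  (measure_function_pushforward__canonical__measure_function_Measure leb mf).
have := @ge0_integral_mscale _ _ R (measure_function_pushforward__canonical__measure_function_Measure leb mf) setT measurableT (NngNum (ltW a0)) h mh.
move=> <- //.
apply: eq_measure_integral => A mA _; apply/esym.
apply: (@lebesgue_measure_unique R m1) mA => _ [[x y]] _ <- /=.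
rewrite /m1/= /mscale/= /pushforward.
rewrite (_ : f @^-1` _ = `]((x - c) / a)%R, ((y - c) / a)%R]%classic).
  rewrite !lebesgue_measure_itv/= !lte_fin ltr_pM2r ?invr_gt0// ltrD2r.
  case: ifPn => xy; last by rewrite mule0.
  by rewrite -!EFinD -EFinM; congr _%:E; field; rewrite gt_eqF.
apply/seteqP; split => z /=; rewrite !in_itv/= /f.
  by rewrite ltr_pdivrMr// ler_pdivlMr// => /andP[? ?]; apply/andP; split; lra.
by rewrite ltr_pdivrMr// ler_pdivlMr// => /andP[? ?]; apply/andP; split; lra.
Qed.

End density.

(** * The standard Gaussian law and its rotation invariance *)

Section gauss.
Variable R : realType.
Local Notation mR := (measurableTypeR R).
Local Notation leb := (@lebesgue_measure R).
Local Open Scope ereal_scope.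

Definition gauss : probability mR R := normal_prob 0 1.

Local Notation g := (@normal_pdf R 0 1).

Let mg : measurable_fun [set: mR] (g : mR -> R).
Proof. exact: measurable_normal_pdf. Qed.

Let g0 x : (0 <= g x)%R. Proof. exact: normal_pdf_ge0. Qed.

Lemma normal_pdf01E (x : R) : g x = (normal_peak 1 * expR (- x ^+ 2 / 2))%R.
Proof.
rewrite normal_pdfE ?oner_neq0// /normal_fun subr0 expr1n.
by congr (_ * expR (_ / _))%R.
Qed.

Lemma integral_gauss (h : mR -> \bar R) :
  measurable_fun setT h -> (forall x, 0 <= h x) ->
  \int[gauss]_x h x = \int[leb]_x (h x * (g x)%:E).
Proof. by move=> mh h0; exact: integral_density. Qed.

Lemma gauss_opp (h : mR -> \bar R) :
  measurable_fun setT h -> (forall x, 0 <= h x) ->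
  \int[gauss]_x h (- x)%R = \int[gauss]_x h x.
Proof.
move=> mh h0; rewrite !integral_gauss//; last first.
  by apply: measurableT_comp.
rewrite -(@ge0_integral_opp _ (fun x : mR => h x * (g x)%:E)).
- by apply: eq_integral => x _; rewrite !normal_pdf01E sqrrN.
- by apply: emeasurable_funM => //; exact/measurable_EFinP.
- by move=> x; rewrite mule_ge0// lee_fin.
Qed.

Lemma gauss_norm (a : R) (h : mR -> \bar R) :
  measurable_fun setT h -> (forall x, 0 <= h x) ->
  \int[gauss]_x h (`|a| * x)%R = \int[gauss]_x h (a * x)%R.
Proof.
move=> mh h0; have [a0|a0] := leP 0%R a; first by rewrite ger0_norm.
rewrite ltr0_norm// -(gauss_opp (h := fun x => h (a * x)%R))//.
  by apply: eq_integral => x _; rewrite mulrN mulNr.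
by apply: measurableT_comp => //; exact: measurable_funM.
Qed.

Let m_affine (a c : R) : measurable_fun [set: mR] (fun x => (a * x + c)%R : mR).
Proof. by apply: measurable_funD => //; exact: measurable_funM. Qed.

(** Completion of the square in x after the substitution z = a x + b y. *)
Let g_rot (a b r x z : R) : (0 < b)%R -> (0 < r)%R -> (r ^+ 2 = a ^+ 2 + b ^+ 2)%R ->
  (g (b^-1 * z + - (a * x) / b) * g x =
   g (z / r) * g (r / b * x - a * z / (r * b)))%R.
Proof.
move=> b0 r0 rr; rewrite !normal_pdf01E.
rewrite mulrACA -[RHS]mulrACA -!expRD; congr (_ * expR _)%R.
have r2 : (r ^+ 2 != 0)%R by rewrite expf_neq0// gt_eqF.
apply: (mulfI (x := (2 * b ^+ 2 * r ^+ 2)%R)).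
  by rewrite !mulf_neq0 ?expf_neq0 ?pnatr_eq0// gt_eqF.
transitivity (- (r ^+ 2 * ((z - a * x) ^+ 2 + b ^+ 2 * x ^+ 2)))%R.
  by field; rewrite gt_eqF.
transitivity (- (b ^+ 2 * z ^+ 2 + (r ^+ 2 * x - a * z) ^+ 2))%R.
  by rewrite rr; ring.
by field; rewrite !gt_eqF.
Qed.

Let gauss_rot_pos (a b : R) (h : mR -> \bar R) : (0 < b)%R ->
  measurable_fun setT h -> (forall x, 0 <= h x) ->
  \int[gauss]_x \int[gauss]_y h (a * x + b * y)%R =
  \int[gauss]_x h (Num.sqrt (a ^+ 2 + b ^+ 2) * x)%R.
Proof.
move=> b0 mh h0; set r := Num.sqrt _.
have s0 : (0 < a ^+ 2 + b ^+ 2)%R.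
  by rewrite ltr_wpDl ?sqr_ge0// exprn_gt0.
have r0 : (0 < r)%R by rewrite sqrtr_gt0.
have rr : (r ^+ 2 = a ^+ 2 + b ^+ 2)%R by rewrite sqr_sqrtr// ltW.
(* The integrand in (x, z), where z = a x + b y, factored so that integrating out x leaves h z times
   the density g (z / r) / r. *)
pose k (p : mR * mR) : \bar R := (h p.2 * (g (p.2 / r))%:E *
  (b^-1 * g (r / b * p.1 - a * p.2 / (r * b)))%:E).
have mgc (f : mR * mR -> mR) : measurable_fun setT f ->
    measurable_fun setT (fun p => (g (f p))%:E).
  by move=> mf; apply/measurable_EFinP; exact: (measurableT_comp mg).
have mk : measurable_fun setT k.
  apply: emeasurable_funM; first apply: emeasurable_funM.
  - exact: measurableT_comp.
  - by apply: mgc; exact: measurable_funM.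
  - apply/measurable_EFinP; apply: measurable_funM => //.
    apply: (measurableT_comp mg); apply: measurable_funB.
      exact: measurable_funM.
    by apply: measurable_funM => //; exact: measurable_funM.
have k0 p : 0 <= k p.
  by rewrite /k !mule_ge0// lee_fin// mulr_ge0// invr_ge0 ltW.
transitivity (\int[leb]_x \int[leb]_z k (x, z)).
  have inner x : \int[gauss]_y h (a * x + b * y)%R * (g x)%:E = \int[leb]_z k (x, z).
    rewrite integral_gauss//; last first.
      by under eq_fun do rewrite addrC; apply: measurableT_comp => //; exact: m_affine.
    have bi : (0 < b^-1)%R by rewrite invr_gt0.
    rewrite -(@ge0_integral_affine _ b^-1 (- (a * x) / b)) //; last first.
    - by move=> y; rewrite mule_ge0// lee_fin.
    - apply: emeasurable_funM; last exact/measurable_EFinP.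
      by under eq_fun do rewrite addrC; apply: measurableT_comp => //; exact: m_affine.
    have mz : measurable_fun [set: mR] (fun z : mR => h (a * x + b * (b^-1 * z + - (a * x) / b))%R *
         (g (b^-1 * z + - (a * x) / b))%:E).
      apply: emeasurable_funM.
        apply: measurableT_comp => //; apply: measurable_funD => //.
        by apply: measurable_funM => //; exact: m_affine.
      by apply/measurable_EFinP; apply: (measurableT_comp mg); exact: m_affine.
    rewrite -ge0_integralZl//; last first.
    - by rewrite lee_fin ltW.
    - by move=> y _; rewrite mule_ge0// lee_fin.
    rewrite muleC -ge0_integralZl//; last first.
    - by rewrite lee_fin.
    - by move=> y _; rewrite !mule_ge0// lee_fin// ltW.
    - by apply: emeasurable_funM.
    apply: eq_integral => z _; rewrite /k /=.
    have -> : (a * x + b * (b^-1 * z + - (a * x) / b) = z)%R.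
      by field; rewrite gt_eqF.
    rewrite (muleCA (b^-1)%:E) (muleCA (g x)%:E) -!EFinM -muleA -EFinM; congr (_ * _%:E).
    have e := g_rot x z b0 r0 rr.
    by rewrite [RHS]mulrCA -e mulrCA [(g x * _)%R]mulrC.
  rewrite integral_gauss.
  - by apply: eq_integral => x _; exact: inner.
  - apply: (eq_measurable_fun (fun x => \int[gauss]_y h (a * x + b * y)%R)) => //.
    apply: (measurable_fun_fubini_tonelli_F (fun p : mR * mR => h (a * p.1 + b * p.2)%R)).
      apply: measurableT_comp => //; apply: measurable_funD; exact: measurable_funM.
    by move=> p.
  - by move=> x; exact: integral_ge0.
rewrite (@fubini_tonelli _ _ mR mR R leb leb k)//.
pose c := (b / r)%R.
transitivity (\int[leb]_z (h z * (g (z / r))%:E * (r^-1)%:E)).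
  apply: eq_integral => z _; rewrite /k /=.
  have mh1 : measurable_fun [set: mR] (fun x : mR => (g (r / b * x - a * z / (r * b)))%:E).
    by apply/measurable_EFinP; apply: (measurableT_comp mg); exact: m_affine.
  have br : (0 < r / b)%R by rewrite divr_gt0.
  under eq_integral do rewrite EFinM.
  rewrite ge0_integralZl//; last 3 first.
  - by apply: emeasurable_funM.
  - by move=> x _; rewrite mule_ge0// lee_fin// invr_ge0 ltW.
  - by rewrite mule_ge0// lee_fin.
  congr (_ * _); rewrite ge0_integralZl//; last by rewrite lee_fin invr_ge0 ltW.
    have aff : (r / b)%:E * \int[leb]_x (g (r / b * x - a * z / (r * b)))%:E = 1.
      rewrite (@ge0_integral_affine _ (r / b) (- (a * z / (r * b))) (fun x => (g x)%:E))//.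
      - exact: integral_normal_pdf.
      - exact/measurable_EFinP.
    transitivity (r^-1%:E * ((r / b)%:E * \int[leb]_x (g (r / b * x - a * z / (r * b)))%:E)).
      by rewrite muleA -EFinM; congr (_%:E * _); field; rewrite !gt_eqF.
    by rewrite aff mule1.
  by move=> x _; rewrite lee_fin.
rewrite [RHS]integral_gauss//; last by apply: measurableT_comp => //; exact: measurable_funM.
pose K (z : mR) : \bar R := h z * (g (z / r))%:E * (r^-1)%:E.
have mK : measurable_fun setT K.
  apply: emeasurable_funM => //; apply: emeasurable_funM => //.
  by apply/measurable_EFinP; apply: (measurableT_comp mg); exact: measurable_funM.
have K0 z : 0 <= K z by rewrite /K !mule_ge0// lee_fin// invr_ge0 ltW.
rewrite -(@ge0_integral_affine _ r 0 K)//.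
rewrite -ge0_integralZl//; last first.
- by rewrite lee_fin ltW.
- by under eq_fun do rewrite addr0; apply: (measurableT_comp mK); exact: measurable_funM.
apply: eq_integral => x _; rewrite /K addr0 (_ : (r * x / r)%R = x); last first.
  by field; rewrite gt_eqF.
rewrite muleC -muleA -EFinM mulVf ?gt_eqF// mule1.
by [].
Qed.

Lemma gauss_rot (a b : R) (h : mR -> \bar R) :
  measurable_fun setT h -> (forall x, 0 <= h x) ->
  \int[gauss]_x \int[gauss]_y h (a * x + b * y)%R =
  \int[gauss]_x h (Num.sqrt (a ^+ 2 + b ^+ 2) * x)%R.
Proof.
move=> mh h0.
transitivity (\int[gauss]_x \int[gauss]_y h (a * x + `|b| * y)%R).
  apply: eq_integral => x _.
  rewrite (@gauss_norm b (fun y => h (a * x + y)%R))//.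
  by apply: measurableT_comp => //; exact: measurable_funD.
(* The substitution divides by b; for b = 0 the inner integrand does not depend on y. *)
have [b0|b0] := eqVneq b 0%R; last by rewrite gauss_rot_pos ?normr_gt0// real_normK ?num_real.
rewrite b0 normr0 expr0n addr0 sqrtr_sqr gauss_norm//.
apply: eq_integral => x _; under eq_integral do rewrite mul0r addr0.
by rewrite integral_cst// [X in _ * X]probability_setT mule1.
Qed.

End gauss.

Section gaussian_sequence.
Variable R : realType.
Local Notation mR := (measurableTypeR R).
Local Open Scope ereal_scope.

(** G i is the Gaussian quantile applied to phi of the i-th iterate of psi. The pair (phi, psi)
    splits off one Gaussian independent of the others, which form the same sequence read at psi u.
    The induction merges each of them by rotation invariance; it needs h arbitrary, since h gets
    translated. *)
Lemma gaussian_sequence : exists2 G : nat -> mR -> R,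
  (forall i, measurable_fun setT (G i)) &
  forall n (v : nat -> R) (h : mR -> \bar R),
    measurable_fun setT h -> (forall x, 0 <= h x) ->
    \int[unif R]_u h (\sum_(i < n) v i * G i u)%R =
    \int[gauss R]_x h (Num.sqrt (\sum_(i < n) v i ^+ 2) * x)%R.
Proof.
have [g mg gE] := quantile (gauss R).
pose G i (u : mR) : R := g (phi (iter i (@psi R) u)).
have miter i : measurable_fun [set: mR] (iter i (@psi R) : mR -> mR).
  elim: i => [|i IH]; first exact: measurable_id.
  by apply: (measurableT_comp (@measurable_psi R)).
have mG i : measurable_fun setT (G i).
  apply: (measurableT_comp mg); apply: (measurableT_comp (@measurable_phi R)).
  exact: miter.
exists G; [exact: mG|move=> n]; elim: n => [|n IH] v h mh h0.
  under eq_integral do rewrite big_ord0.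
  under [RHS]eq_integral do rewrite big_ord0 sqrtr0 mul0r.
  rewrite !integral_cst//; congr (_ * _); transitivity (1 : \bar R).
    exact: (probability_setT (unif R)).
  exact/esym/(probability_setT (gauss R)).
have mS : measurable_fun [set: mR] (fun u => \sum_(i < n) v i.+1 * G i u)%R.
  by apply: measurable_sum => i; exact: measurable_funM.
pose k (p : mR * mR) : \bar R := h (v 0%N * g p.1 + \sum_(i < n) v i.+1 * G i p.2)%R.
transitivity (\int[unif R]_u k (phi u, psi u)).
  apply: eq_integral => u _; rewrite /k big_ord_recl /=; congr (h (_ + _)%R).
  by apply: eq_bigr => i _; rewrite /G /bump /= -iterSr.
rewrite ge0_integral_unif_pair; last 2 first.
- apply: (measurableT_comp mh); apply: measurable_funD.
    by apply: measurable_funM => //; exact: (measurableT_comp mg).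
  exact: (measurableT_comp mS).
- by move=> z; exact: h0.
set r := Num.sqrt (\sum_(i < n) v i.+1 ^+ 2).
transitivity (\int[unif R]_x \int[gauss R]_y h (v 0%N * g x + r * y)%R).
  apply: eq_integral => x _; rewrite /k /=.
  apply: (IH (fun i => v i.+1) (fun y => h (v 0%N * g x + y)%R)) => //.
  by apply: measurableT_comp => //; exact: measurable_funD.
have mF : measurable_fun [set: mR] (fun x : mR => \int[gauss R]_y h (v 0%N * x + r * y)%R).
  apply: (measurable_fun_fubini_tonelli_F (fun p : mR * mR => h (v 0%N * p.1 + r * p.2)%R)).
    by apply: measurableT_comp => //; apply: measurable_funD; exact: measurable_funM.
  by move=> p.
rewrite (gE _ mF); last by move=> x; exact: integral_ge0.
rewrite gauss_rot//; apply: eq_integral => x _; congr (h (Num.sqrt _ * _)%R).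
by rewrite big_ord_recl /= /r sqr_sqrtr// sumr_ge0// => i _; rewrite sqr_ge0.
Qed.

(** The digits in phi u feed xi and those in psi u feed the whole Gaussian sequence. *)
Lemma mixed_gaussian_sequence (P : probability mR R) :
  exists (Xi : mR -> R) (G : nat -> mR -> R),
  [/\ measurable_fun setT Xi, forall i, measurable_fun setT (G i) &
  forall x n (v : nat -> R) (h : mR -> \bar R),
    measurable_fun setT h -> (forall x, 0 <= h x) ->
    \int[unif R]_u h (x * Xi u + \sum_(i < n) v i * G i u)%R =
    \int[P]_xi \int[gauss R]_y
      h (x * xi + Num.sqrt (\sum_(i < n) v i ^+ 2) * y)%R].
Proof.
have [q mq qE] := quantile P.
have [G mG GE] := gaussian_sequence.
exists (fun u => q (phi u)), (fun i u => G i (psi u)); split => [|i|x n v h mh h0].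
- exact: (measurableT_comp mq (@measurable_phi R)).
- exact: (measurableT_comp (mG i) (@measurable_psi R)).
have mS : measurable_fun [set: mR] (fun u => \sum_(i < n) v i * G i u)%R.
  by apply: measurable_sum => i; exact: measurable_funM.
pose k (p : mR * mR) : \bar R := h (x * q p.1 + \sum_(i < n) v i * G i p.2)%R.
rewrite -[LHS]/(\int[unif R]_u k (phi u, psi u)) ge0_integral_unif_pair; last 2 first.
- apply: (measurableT_comp mh); apply: measurable_funD.
    by apply: measurable_funM => //; exact: (measurableT_comp mq).
  exact: (measurableT_comp mS).
- by move=> z; exact: h0.
set r := Num.sqrt _.
transitivity (\int[unif R]_u \int[gauss R]_y h (x * q u + r * y)%R).
  apply: eq_integral => u _; rewrite /k /=.
  apply: (GE n v (fun y => h (x * q u + y)%R)) => //.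
  by apply: measurableT_comp => //; exact: measurable_funD.
have mF : measurable_fun [set: mR] (fun u : mR => \int[gauss R]_y h (x * u + r * y)%R).
  apply: (measurable_fun_fubini_tonelli_F (fun p : mR * mR => h (x * p.1 + r * p.2)%R)).
    by apply: measurableT_comp => //; apply: measurable_funD; exact: measurable_funM.
  by move=> p.
by rewrite (qE _ mF)// => u; exact: integral_ge0.
Qed.

End gaussian_sequence.

(** * Completeness of L1 *)

Section riesz_fischer.
Context d (T : measurableType d) (R : realType).
Variable mu : {measure set T -> \bar R}.
Local Open Scope ereal_scope.

(** The sum S of the absolute increments has finite integral, so it is finite almost everywhere and
    h converges there; Fatou's lemma transfers the bounds to the limit. *)
Lemma ae_cvg_of_fast_cauchy (h : nat -> T -> R) :
  (forall n, measurable_fun setT (h n)) ->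
  (forall k m, (k <= m)%N ->
     \int[mu]_x (`|h m x - h k x|)%:E <= ((2^-1) ^+ k)%:E) ->
  exists2 f : T -> R, measurable_fun setT f &
    forall k, \int[mu]_x (`|f x - h k x|)%:E <= ((2^-1) ^+ k)%:E.
Proof.
move=> mh hC.
have mhB n k : measurable_fun setT (fun x => (`|h n x - h k x|)%:E).
  by apply/measurable_EFinP; apply: measurableT_comp => //; exact: measurable_funB.
pose S x := \sum_(n <oo) (`|h n.+1 x - h n x|)%:E.
have mS : measurable_fun setT S.
  by apply: ge0_emeasurable_sum => // n x _ _; rewrite lee_fin.
have S0 x : 0 <= S x by apply: nneseries_ge0 => n _ _; rewrite lee_fin.
have Sfin : \int[mu]_x S x < +oo.
  rewrite integral_nneseries; [|exact: measurableT|by move=> n; exact: mhB|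
    by move=> n x _; rewrite lee_fin].
  have geo : (fun n => \sum_(0 <= i < n) ((2^-1 : R) ^+ i)%:E) @ \oo --> (2 : R)%:E.
    under eq_fun do rewrite sumEFin.
    apply: cvg_EFin; first by near=> n.
    rewrite [X in X @ _ --> _](_ : _ = series (geometric 1%R (2^-1)%R)).
      have h1 : (`|2^-1 : R| < 1)%R by rewrite ger0_norm; lra.
      have := @cvg_geometric_series R 1%R _ h1.
      by rewrite (_ : 1 / (1 - 2^-1) = 2)%R; [exact|field].
    by apply/funext => n; rewrite /series /=; apply: eq_bigr => i _; rewrite mul1r.
  apply: (@le_lt_trans _ _ 2%:E); last exact: ltry.
  rewrite -(cvg_lim _ geo)//; apply: lee_nneseries => n _ //.
    by move=> _; apply: integral_ge0 => x _; rewrite lee_fin.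
  exact: hC.
have Sae : {ae mu, forall x, setT x -> S x \is a fin_num}.
  apply: integrable_ae => //; apply/integrableP; split => //.
  by under eq_integral do rewrite gee0_abs//.
pose A : set T := [set x | S x \is a fin_num].
have mA : measurable A.
  by have := emeasurable_fin_num measurableT mS; rewrite setTI.
have AP x : A x <-> S x \is a fin_num by [].
have cvgA x : A x -> cvgn (h^~ x).
  move=> /AP Sx.
  have c1 : cvgn (series (fun n => `|h n.+1 x - h n x|)%R).
    apply: nondecreasing_is_cvgn.
      by apply/nondecreasing_seqP => n; rewrite /series/= big_nat_recr//= lerDl.
    exists (fine (S x)) => _ [n _ <-]; rewrite -lee_fin fineK// -sumEFin.
    by apply: nneseries_lim_ge => i _ _; rewrite lee_fin.
  have c2 : cvgn (series (telescope (h^~ x))) by apply: (@normed_cvg R R^o).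
  have -> : h^~ x = (fun n => h 0%N x + series (telescope (h^~ x)) n)%R.
    by apply/funext => n; rewrite -eq_sum_telescope.
  by apply: is_cvgD => //; exact: is_cvg_cst.
(* Cut off outside A, the sequence converges everywhere, which makes the limit measurable. *)
pose g n x : R := (h n x * \1_A x)%R.
pose f x : R := limn (g^~ x).
have gf x : g^~ x @ \oo --> f x.
  rewrite /f; have [Ax|nAx] := pselect (A x).
    have -> : g^~ x = h^~ x.
      by apply/funext => n; rewrite /g indicE mem_set// mulr1.
    exact: cvgA.
  have -> : g^~ x = cst 0%R.
    by apply/funext => n; rewrite /g indicE memNset// mulr0.
  exact: is_cvg_cst.
have mg n : measurable_fun setT (g n).
  by apply: measurable_funM => //; exact: measurable_indic.
have mf : measurable_fun setT f.
  by apply: (measurable_fun_cvg (h := g)) => // x _; exact: gf.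
have mgB n k : measurable_fun setT (fun x => (`|g n x - g k x|)%:E).
  by apply/measurable_EFinP; apply: measurableT_comp => //; exact: measurable_funB.
have mfB (u : T -> R) : measurable_fun setT u ->
    measurable_fun setT (fun x => (`|f x - u x|)%:E).
  by move=> mu'; apply/measurable_EFinP; apply: measurableT_comp => //; exact: measurable_funB.
exists f => // k.
rewrite (@ge0_ae_eq_integral _ _ _ mu setT _ (fun x => (`|f x - g k x|)%:E)) //;
  [|exact: mfB|exact: mfB|]; last first.
  apply: filterS Sae => x /(_ I) Ax _.
  by rewrite /g indicE mem_set ?mulr1.
rewrite (eq_integral (fun x => limn_einf (fun m => (`|g m x - g k x|)%:E))); last first.
  move=> x _; apply/esym.
  have cvf : (fun m => (`|g m x - g k x|)%:E) @ \oo --> (`|f x - g k x|)%:E.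
    apply: cvg_EFin; first by near=> m.
    by apply: (@cvg_norm _ R^o); apply: cvgB; [exact: gf|exact: cvg_cst].
  by have [-> _] := cvg_limn_einf_sup cvf.
apply: le_trans (fatou mu measurableT (mgB^~ k) _) _.
  by move=> n x _; rewrite lee_fin.
rewrite limn_einf_lim; apply: lime_le; first exact: is_cvg_einfs.
(* The infimum runs over the indices from n on; [maxn n k] is one of them for which [hC] applies. *)
near=> n; apply: (@le_trans _ _ (\int[mu]_x (`|g (maxn n k) x - g k x|)%:E)).
  by apply: ereal_inf_lbound; exists (maxn n k) => //=; exact: leq_maxl.
apply: le_trans (hC k (maxn n k) (leq_maxr _ _)).
apply: ge0_le_integral => //.
move=> x _; rewrite lee_fin /g -mulrBl normrM ler_piMr// indicE.
by case: (x \in A); rewrite ?normr1 ?normr0.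
Unshelve. all: by end_near. Qed.

End riesz_fischer.

Section L1_complete.
Context d (T : measurableType d) (R : realType).
Variable mu : {measure set T -> \bar R}.

Lemma mem_Lfun1 (f : T -> R) : measurable_fun setT f ->
  (\int[mu]_x `|(f x)%:E| < +oo)%E -> f \in Lfun mu 1.
Proof.
move=> mf fi; apply/andP; split; rewrite inE //=.
by rewrite /finite_norm Lnorm1.
Qed.

Definition L1_of (f : T -> R) (mf : measurable_fun setT f)
    (fi : (\int[mu]_x `|(f x)%:E| < +oo)%E) : L1 mu :=
  L1_class (Lfun_Sub (lexx 1%E) (mem_Lfun1 mf fi)).

Lemma dist_L1_class (f g : LfunType mu (lexx 1%E)) :
  (`|L1_class f - L1_class g|%:E = \int[mu]_x (`|f x - g x|)%:E)%E.
Proof.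
rewrite -scaleN1r -L1_classZ -L1_classD normr_L1_class.
apply: eq_integral => x _; congr (`|_|%:E).
by rewrite -[LHS]/(f x + (-1) * g x) mulN1r.
Qed.

Lemma L1_complete_seq (u : nat -> L1 mu) :
  (forall e, 0 < e -> exists N, forall m n, (N <= m)%N -> (N <= n)%N ->
     `|u m - u n| <= e) ->
  exists l : L1 mu, forall e, 0 < e -> exists N, forall n, (N <= n)%N ->
     `|u n - l| <= e.
Proof.
move=> uC.
have half k : 0 < (2^-1 : R) ^+ k by rewrite exprn_gt0.
have [N0 N0P] := choice (fun k => uC _ (half k)).
(* Summing the thresholds makes them monotone while keeping each above [N0 k]. *)
pose N k := (\sum_(j < k.+1) N0 j)%N.
have NP k m n : (N k <= m)%N -> (N k <= n)%N -> `|u m - u n| <= 2^-1 ^+ k.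
  move=> km kn; have N0N : (N0 k <= N k)%N by rewrite /N big_ord_recr /= leq_addl.
  by apply: N0P; exact: leq_trans N0N _.
have Nnd k m : (k <= m)%N -> (N k <= N m)%N.
  move=> km; rewrite /N -!(big_mkord xpredT N0).
  by rewrite [X in (_ <= X)%N](@big_cat_nat _ _ _ k.+1)//= leq_addr.
pose h k : T -> R := L1_repr (u (N k)).
have mh k : measurable_fun setT (h k) by [].
have hB k m : (\int[mu]_x (`|h m x - h k x|)%:E = `|u (N m) - u (N k)|%:E)%E.
  rewrite -(dist_L1_class (L1_repr (u (N m))) (L1_repr (u (N k)))).
  by rewrite !L1_reprK.
have [|f mf fh] := @ae_cvg_of_fast_cauchy _ T R mu h mh.
  by move=> k m km; rewrite hB lee_fin NP// Nnd.
have fi : (\int[mu]_x `|(f x)%:E| < +oo)%E.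
  apply: (@le_lt_trans _ _ (\int[mu]_x ((`|f x - h 0%N x|)%:E + `|(h 0%N x)%:E|)))%E.
    apply: ge0_le_integral => //.
    - by apply/measurableT_comp => //; exact/measurable_EFinP.
    - apply: emeasurable_funD; last by apply/measurableT_comp => //; exact/measurable_EFinP.
      by apply/measurable_EFinP; apply: measurableT_comp => //; exact: measurable_funB.
    - move=> x _; rewrite lee_fin -[in leLHS](subrK (h 0%N x) (f x)); exact: ler_normD.
  rewrite ge0_integralD//.
  - apply: lte_add_pinfty; first by rewrite (le_lt_trans (fh 0%N))// ltry.
    by rewrite -(normr_L1_class (L1_repr (u (N 0%N)))) ltry.
  - by apply/measurable_EFinP; apply: measurableT_comp => //; exact: measurable_funB.
  - by apply/measurableT_comp => //; exact/measurable_EFinP.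
exists (L1_of mf fi) => e e0.
have c : (fun k => (2^-1 : R) ^+ k) @ \oo --> (0 : R).
  by apply: cvg_expr; rewrite ger0_norm; lra.
have e2 : 0 < e / 2 by rewrite divr_gt0.
have [k _ hk] := cvgr_lt _ c _ e2.
have {}hk := hk k (leqnn k).
exists (N k) => n kn; rewrite -(subrK (u (N k)) (u n)) -addrA.
rewrite (le_trans (ler_normD _ _))// (splitr e) lerD//.
  by rewrite (le_trans (NP k _ _ kn _))// ltW.
rewrite distrC -lee_fin (le_trans _ (le_trans (fh k) _))//; last by rewrite lee_fin ltW.
by rewrite -[u (N k)]L1_reprK dist_L1_class.
Qed.
End L1_complete.

(** * Gaussian averages as norms of L1 *)

Section gaussian_vectors.
Variable R : realType.
Local Notation mR := (measurableTypeR R).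
Local Open Scope ereal_scope.
Local Notation mu01 := (mrestr (@lebesgue_measure R) (measurable_itv `[0%R, 1%R])).

Lemma integral_mu01 (h : mR -> \bar R) :
  \int[mu01]_x h x = \int[unif R]_x h x.
Proof.
by apply: eq_measure_integral => A mA _; apply/esym; exact: unifE.
Qed.

(** Since |x| <= 1 + x^2 / 4 <= exp(x^2 / 4), the integrand is dominated by a multiple of the
    Gaussian density of variance 2. *)
Lemma gauss_abs_fin : \int[gauss R]_x (`|x|)%:E < +oo.
Proof.
rewrite integral_gauss; last 2 first.
- by apply/measurable_EFinP; exact: normr_measurable.
- by move=> x; rewrite lee_fin.
pose s : R := Num.sqrt 2.
have s0 : s != 0%R by rewrite gt_eqF// sqrtr_gt0.
have ss : (s ^+ 2 = 2)%R by rewrite sqr_sqrtr.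
pose C : R := (normal_peak 1 / normal_peak s)%R.
have C0 : (0 <= C)%R by rewrite divr_ge0 ?normal_peak_ge0.
apply: (@le_lt_trans _ _ (\int[lebesgue_measure]_x (C%:E * (normal_pdf 0 s x)%:E))).
  apply: ge0_le_integral => //.
  - by move=> x _; rewrite mule_ge0// lee_fin// normal_pdf_ge0.
  - apply: emeasurable_funM; apply/measurable_EFinP; first exact: normr_measurable.
    exact: measurable_normal_pdf.
  - by apply: emeasurable_funM => //; apply/measurable_EFinP; exact: measurable_normal_pdf.
  - move=> x _; rewrite -!EFinM lee_fin normal_pdf01E.
    have -> : normal_pdf 0 s x = (normal_peak s * expR (- x ^+ 2 / (2 *+ 2)))%R.
      rewrite normal_pdfE// -[LHS]/(normal_peak s * normal_fun 0 s x)%R.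
      by rewrite /normal_fun subr0 ss.
    rewrite /C [leRHS]mulrA divfK ?gt_eqF ?normal_peak_gt0// mulrCA.
    rewrite ler_wpM2l ?normal_peak_ge0//.
    rewrite (_ : - x ^+ 2 / 2 = - (x ^+ 2 / 4) + - x ^+ 2 / (2 *+ 2))%R; last by field.
    rewrite expRD mulrA ler_piMl ?expR_ge0// expRN.
    rewrite ler_pdivrMr ?expR_gt0// mul1r.
    apply: le_trans (expR_ge1Dx _).
    have : (0 <= (1 - `|x| / 2) ^+ 2)%R by rewrite sqr_ge0.
    rewrite sqrrB expr1n expr_div_n real_normK ?num_real//; lra.
rewrite ge0_integralZl//; last 2 first.
- by apply/measurable_EFinP; exact: measurable_normal_pdf.
- by move=> x _; rewrite lee_fin normal_pdf_ge0.
by rewrite integral_normal_pdf mule1 ltry.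
Qed.

Lemma mixed_gaussian_vectors (P : probability mR R) (M : R) : (0 <= M)%R ->
  \int[P]_x (`|x|)%:E < +oo ->
  exists (E0 : L1_unit_interval R) (E : nat -> L1_unit_interval R),
    forall x n (v : nat -> R),
      (`|x *: E0 + \sum_(i < n) v i *: E i|%R)%:E =
      M%:E * \int[P]_xi \int[gauss R]_y
        (`|x * xi + Num.sqrt (\sum_(i < n) v i ^+ 2) * y|)%:E.
Proof.
move=> M0 Pfin.
have [Xi [G [mXi mG XG]]] := mixed_gaussian_sequence P.
have mabs : measurable_fun [set: mR] (fun x : mR => (`|x|)%:E).
  by apply/measurable_EFinP; exact: normr_measurable.
have gfin c : \int[gauss R]_y (`|c * y|)%:E < +oo.
  under eq_integral do rewrite normrM EFinM.
  rewrite ge0_integralZl//.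
  by apply: lte_mul_pinfty => //; exact: gauss_abs_fin.
have finM (F : mR -> R) : measurable_fun setT F ->
    \int[unif R]_u (`|F u|)%:E < +oo -> \int[mu01]_u `|(M * F u)%:E| < +oo.
  move=> mF Ffin; rewrite integral_mu01.
  under eq_integral do rewrite abse_EFin normrM EFinM.
  rewrite ge0_integralZl; [|exact: measurableT
    |by apply/measurable_EFinP; exact: measurableT_comp
    |by move=> x _; rewrite lee_fin|by rewrite lee_fin].
  by apply: lte_mul_pinfty => //; rewrite lee_fin normr_ge0.
(* Integrability of Xi and of each G i is the instance of [XG] with a single nonzero coefficient. *)
have finXi : \int[unif R]_u (`|Xi u|)%:E < +oo.
  have := XG 1%R 0%N (fun=> 0%R) (fun x => (`|x|)%:E) mabs (fun x => normr_ge0 x).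
  under eq_integral do rewrite big_ord0 addr0 mul1r.
  move=> ->; under eq_integral => x _.
    under eq_integral do rewrite big_ord0 sqrtr0 mul0r addr0 mul1r.
    rewrite integral_cst//= (probability_setT (gauss R)) mule1.
    over.
  exact: Pfin.
have finG i : \int[unif R]_u (`|G i u|)%:E < +oo.
  have := XG 0%R i.+1 (fun j => (j == i)%:R%R) (fun x => (`|x|)%:E) mabs (fun x => normr_ge0 x).
  have E (u : mR) : (0 * Xi u + \sum_(j < i.+1) (j == i :> nat)%:R * G j u = G i u)%R.
    rewrite mul0r add0r big_ord_recr /= eqxx mul1r big1 ?add0r// => j _.
    by rewrite ltn_eqF ?ltn_ord// mul0r.
  under eq_integral do rewrite E.
  move=> ->; under eq_integral do under eq_integral do rewrite mul0r add0r.
  rewrite integral_cst; [|exact: measurableT].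
  by rewrite [X in _ * X]probability_setT mule1; exact: gfin.
have mM (F : mR -> R) : measurable_fun setT F -> measurable_fun setT (fun u => M * F u)%R.
  by move=> mF; exact: measurable_funM.
exists (L1_of (mM _ mXi) (finM _ mXi finXi)), (fun i => L1_of (mM _ (mG i)) (finM _ (mG i) (finG i))).
move=> x n v.
(* Operations on classes are only known up to null sets; the induction builds a representative given
   by the formula at every point. *)
suff [F [<- FE]] : exists F : LfunType mu01 (lexx 1%E),
    L1_class F = (x *: L1_of (mM _ mXi) (finM _ mXi finXi) +
      \sum_(i < n) v i *: L1_of (mM _ (mG i)) (finM _ (mG i) (finG i)))%R /\
    (forall u, F u = M * (x * Xi u + \sum_(i < n) v i * G i u))%R.
  rewrite normr_L1_class integral_mu01.
  under eq_integral do rewrite FE abse_EFin normrM EFinM (ger0_norm M0).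
  have mF : measurable_fun [set: mR] (fun u => x * Xi u + \sum_(i < n) v i * G i u)%R.
    apply: measurable_funD; first exact: measurable_funM.
    by apply: measurable_sum => i; exact: measurable_funM.
  rewrite ge0_integralZl; [|exact: measurableT
    |by apply/measurable_EFinP; exact: measurableT_comp
    |by move=> u _; rewrite lee_fin|by rewrite lee_fin].
  congr (_ * _).
  exact: (XG x n v (fun x => (`|x|)%:E) mabs (fun x => normr_ge0 x)).
elim: n => [|n [F [FE FU]]].
  exists (x *: Lfun_Sub (lexx 1%E) (mem_Lfun1 (mM _ mXi) (finM _ mXi finXi)))%R.
  split; first by rewrite L1_classZ big_ord0 addr0.
  by move=> u; rewrite big_ord0 addr0 mulrCA.
exists (F + v n *: Lfun_Sub (lexx 1%E) (mem_Lfun1 (mM _ (mG n)) (finM _ (mG n) (finG n))))%R.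
split; first by rewrite L1_classD L1_classZ FE big_ord_recr /= addrA.
move=> u; rewrite big_ord_recr /= addrA [RHS]mulrDr -FU; congr (_ + _)%R.
by rewrite mulrCA.
Qed.

End gaussian_vectors.

(** * Truncated moments of the Gaussian *)

Section max_integrals.
Variable R : realType.
Local Notation mR := (measurableTypeR R).
Local Notation leb := (@lebesgue_measure R).
Local Open Scope ereal_scope.

(** The first absolute moment sqrt(2 / pi) of the standard Gaussian. *)
Definition gconst : R := (2 * normal_peak 1)%R.

Lemma gconst_gt0 : (0 < gconst)%R.
Proof. by rewrite mulr_gt0// normal_peak_gt0. Qed.

Let half_tail (a : R) : (0 <= a)%R ->
  \int[gauss R]_y (`|y| * \1_(`]a, +oo[) y)%:E =
  (normal_peak 1 * expR (- a ^+ 2 / 2))%:E.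
Proof.
move=> a0; rewrite integral_gauss; last 2 first.
- apply/measurable_EFinP; apply: measurable_funM; first exact: normr_measurable.
  exact: measurable_indic.
- by move=> x; rewrite lee_fin mulr_ge0.
pose F (y : R) : R := (- (normal_peak 1 * expR (- y ^+ 2 / 2)))%R.
pose f (y : R) : R := (y * (normal_peak 1 * expR (- y ^+ 2 / 2)))%R.
have dF (y : R) : is_derive y 1%R F (f y).
  have d1 : is_derive y 1%R (fun x : R => - 2^-1 * x ^+ 2)%R (- y)%R.
    apply: (@is_derive_eq _ _ _ _ _ _ _ _ (@is_deriveZ_fun R _ (- 2^-1)%R y _
      (is_deriveX_fun 2 (is_derive_id y 1%R)))).
    by rewrite mulr1 /=; field.
  have d2 := @is_derive1_comp R expR _ y _ _ (is_derive_expR _) d1.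
  have -> : F = (fun z => - normal_peak 1 *
      (expR \o (fun x : R => - 2^-1 * x ^+ 2)) z)%R.
    by apply/funext => z; rewrite /F /= [RHS]mulNr; congr (- (_ * expR _))%R; field.
  apply: (@is_derive_eq _ _ _ _ _ _ _ _ (is_deriveZ_fun (- normal_peak 1)%R d2)).
  rewrite /f (_ : - 2^-1 * y ^+ 2 = - y ^+ 2 / 2)%R; last by field.
  by ring.
have cf : continuous f.
  move=> y; apply: cvgM; first exact: cvg_id.
  apply: cvgM; first exact: cvg_cst.
  apply: continuous_comp; last exact: continuous_expR.
  apply: cvgM; last exact: cvg_cst.
  apply: cvgN; exact: exprn_continuous.
have Fy : F y @[y --> +oo%R] --> (0 : R)%R.
  rewrite -oppr0; apply: cvgN; rewrite -(mulr0 (normal_peak 1)); apply: cvgM.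
    exact: cvg_cst.
  have s2 : (0 < Num.sqrt 2 :> R)%R by rewrite sqrtr_gt0.
  have -> : (fun x : R => expR (- x ^+ 2 / 2)) =
      gauss_fun \o (fun x => x * (Num.sqrt 2)^-1)%R.
    apply/funext => x; rewrite /gauss_fun /= exprMn exprVn sqr_sqrtr//.
    by rewrite mulNr.
  apply: cvg_comp (@cvg_gauss_fun R).
  by apply: gt0_cvgMly; [rewrite invr_gt0|exact: cvg_id].
have f0 x : (a <= x -> 0 <= f x)%R.
  move=> ax; apply: mulr_ge0; first exact: le_trans ax.
  by apply: mulr_ge0; [exact: normal_peak_ge0|exact: expR_ge0].
transitivity (\int[leb]_(x in `]a, +oo[) (f x)%:E).
  rewrite [RHS]integral_mkcond; apply: eq_integral => /= x _.
  rewrite patchE indicE; case: ifPn => [|_]; last by rewrite mulr0 mul0e.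
  rewrite inE/= in_itv/= andbT => ax.
  by rewrite mulr1 -EFinM normal_pdf01E ger0_norm// ltW// (le_lt_trans a0 ax).
have mf : measurable_fun [set: mR] (f : mR -> R) by exact: continuous_measurable_fun.
rewrite integral_itv_obnd_cbnd//; last exact/measurable_EFinP/measurable_funTS.
rewrite (@ge0_continuous_FTC2y _ f F a 0%R).
- by rewrite /F EFinN oppeK add0e.
- exact: f0.
- exact: continuous_subspaceT.
- exact: Fy.
- by move=> x _; have [] := dF x.
- apply: cvg_at_right_filter; apply: differentiable_continuous.
  by apply/derivable1_diffP; have [] := dF a.
- by move=> x _; rewrite derive1E; have [_ ->] := dF x.
Qed.

(** Twice the integral over ]a, +oo[, where y exp(- y^2 / 2) has an explicit primitive. For a = |xi|
    / u this becomes the Laplace kernel at u^-2. *)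
Lemma gauss_tail (a : R) : (0 <= a)%R ->
  \int[gauss R]_y (`|y| * (a < `|y|)%R%:R)%:E = (gconst * expR (- a ^+ 2 / 2))%:E.
Proof.
move=> a0.
have mh : measurable_fun [set: mR] (fun y : mR => (`|y| * \1_(`]a, +oo[) y)%:E).
  apply/measurable_EFinP; apply: measurable_funM; first exact: normr_measurable.
  exact: measurable_indic.
have h0 (y : mR) : 0 <= (`|y| * \1_(`]a, +oo[) y)%:E by rewrite lee_fin mulr_ge0.
transitivity (\int[gauss R]_y ((`|y| * \1_(`]a, +oo[) y)%:E +
    (`|- y| * \1_(`]a, +oo[) (- y)%R)%:E)).
  apply: eq_integral => y _; rewrite -EFinD normrN -mulrDr; congr (_ * _)%:E.
  rewrite !indicE !mem_setE !in_itv/= !andbT.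
  have [y0|y0] := leP 0%R y.
    have -> : (a < - y)%R = false by apply/negP => ?; lra.
    by rewrite addr0 ger0_norm.
  have -> : (a < y)%R = false by apply/negP => ?; lra.
  by rewrite add0r ltr0_norm.
rewrite ge0_integralD//; last first.
  by apply: (measurableT_comp mh).
rewrite (@gauss_opp R (fun y : mR => (`|y| * \1_(`]a, +oo[) y)%:E))//.
rewrite half_tail// -EFinD /gconst; congr _%:E; ring.
Qed.

(** The density is at most its peak on an interval of length 2b. This bound gives the 1/u decay of
    the intercept. *)
Lemma gauss_ball (b : R) : (0 <= b)%R ->
  \int[gauss R]_y ((`|y| <= b)%R%:R)%:E <= (gconst * b)%:E.
Proof.
move=> b0; rewrite integral_gauss; last 2 first.
- apply/measurable_EFinP.
  rewrite (_ : (fun _ => _) = \1_(`[(- b)%R, b])); first exact: measurable_indic.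
  by apply/funext => x; rewrite indicE mem_setE in_itv/= ler_norml.
- by move=> x; rewrite lee_fin.
apply: (@le_trans _ _ (\int[leb]_(x in `[(- b)%R, b]) (normal_peak 1)%:E)).
  rewrite [leRHS]integral_mkcond; apply: ge0_le_integral => //=.
  - by move=> x _; rewrite mule_ge0// lee_fin// normal_pdf_ge0.
  - apply: emeasurable_funM; apply/measurable_EFinP; last exact: measurable_normal_pdf.
    rewrite (_ : (fun _ => _) = \1_(`[(- b)%R, b])); first exact: measurable_indic.
    by apply/funext => x; rewrite indicE mem_setE in_itv/= ler_norml.
  - by apply/(measurable_restrictT _ _).1.
  - move=> /= x _; rewrite patchE mem_setE in_itv/= ler_norml; case: ifP => _.
      by rewrite mul1e lee_fin normal_pdf_ub ?oner_neq0.
    by rewrite mul0e.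
have lb : leb `[(- b)%R, b]%classic = (b + b)%:E.
  rewrite lebesgue_measure_itv/= lte_fin; case: ifPn => [_|].
    by rewrite -EFinD opprK.
  by rewrite -leNgt => bb; congr _%:E; lra.
rewrite integral_cst//.
rewrite [X in _ * X <= _]lb -EFinM lee_fin /gconst; lra.
Qed.

End max_integrals.

(** * Mixtures of laws and Laplace transforms of squares *)

Section mixture.
Variables (R : realType).
Local Notation mR := (measurableTypeR R).
Variables (P_ : nat -> probability mR R) (w : nat -> R).
Hypotheses (w0 : forall k, 0 <= w k).
Hypothesis w1 : (fun n => \sum_(k < n) w k) @ \oo --> (1 : R).
Local Open Scope ereal_scope.

Let mix := mseries (fun k => mscale (NngNum (w0 k)) (P_ k)) 0.

Let mix_integral (h : mR -> \bar R) : measurable_fun setT h -> (forall x, 0 <= h x) ->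
  \int[mix]_x h x = \sum_(0 <= k <oo) (w k)%:E * \int[P_ k]_x h x.
Proof.
move=> mh h0; rewrite /mix ge0_integral_measure_series//.
by apply: eq_eseriesr => k _; rewrite ge0_integral_mscale.
Qed.

Let mix1 : mix setT = 1.
Proof.
rewrite /mix /mseries; apply/cvg_lim => //.
rewrite (_ : (fun _ => _) = EFin \o (fun n => \sum_(k < n) w k)%R); last first.
  apply/funext => n /=; rewrite -sumEFin big_mkord; apply: eq_bigr => k _.
  by rewrite /mscale/= [X in _ * X]probability_setT mule1.
by apply/cvg_EFin => //; exact: nearW.
Qed.

HB.instance Definition _ := Measure.on mix.
HB.instance Definition _ := @Measure_isProbability.Build _ _ R mix mix1.

Lemma mixture_prob : exists P : probability mR R,
  forall h : mR -> \bar R, measurable_fun setT h -> (forall x, 0 <= h x) ->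
    \int[P]_x h x = \sum_(0 <= k <oo) (w k)%:E * \int[P_ k]_x h x.
Proof. by exists mix => h; exact: mix_integral. Qed.

End mixture.

Section gamma_mixtures.
Variable R : realType.
Local Notation mR := (measurableTypeR R).
Local Notation leb := (@lebesgue_measure R).
Local Open Scope ereal_scope.

Let dens (k : nat) (c x : R) : R := (x ^+ (2 * k) * expR (- (c * x ^+ 2 / 2)))%R.

Let dens_ge0 k c x : (0 <= dens k c x)%R.
Proof. by apply: mulr_ge0; rewrite ?expR_ge0 // exprM exprn_ge0 ?sqr_ge0. Qed.

Let cont_dens k c : continuous (dens k c).
Proof.
move=> x; apply: cvgM; first exact: exprn_continuous.
apply: continuous_comp; last exact: continuous_expR.
apply: cvgN; apply: cvgM; last exact: cvg_cst.
by apply: cvgM; [exact: cvg_cst|exact: exprn_continuous].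
Qed.

Let mdens k c : measurable_fun [set: mR] (dens k c : mR -> R).
Proof. by have /continuous_measurable_fun := @cont_dens k c. Qed.

Let mdensE k c : measurable_fun [set: mR] (fun x : mR => (dens k c x)%:E).
Proof. by have /measurable_EFinP := @mdens k c. Qed.

Let mom k c : \bar R := \int[leb]_x (dens k c x)%:E.

Let mom_ge0 k c : 0 <= mom k c.
Proof. by apply: integral_ge0 => x _; rewrite lee_fin dens_ge0. Qed.

Let momZ k c a : (0 <= a)%R ->
  a%:E * mom k c = \int[leb]_x (a * dens k c x)%:E.
Proof.
move=> a0; rewrite /mom -(@ge0_integralZl_EFin _ mR R leb setT measurableT _ _ (mdensE k c) a a0)//.
by move=> x _; rewrite lee_fin dens_ge0.
Qed.

Let mom_scale k (c : R) : (0 < c)%R ->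
  (Num.sqrt c * c ^+ k)%:E * mom k c = mom k 1.
Proof.
move=> c0; have s0 : (0 < Num.sqrt c)%R by rewrite sqrtr_gt0.
have mE : measurable_fun [set: mR] (fun x : mR => (dens k 1 x)%:E).
  exact: mdensE.
have E0 (x : mR) : 0 <= (dens k 1 x)%:E by rewrite lee_fin dens_ge0.
rewrite [RHS]/mom -(@ge0_integral_affine R _ 0%R (fun x : mR => (dens k 1 x)%:E) s0)//.
rewrite EFinM -muleA; congr (_ * _); have ck := exprn_ge0 k (ltW c0).
rewrite -/(mom k c) momZ//; apply: eq_integral => x _; rewrite /dens addr0; congr _%:E.
have sk : (Num.sqrt c ^+ (2 * k) = c ^+ k)%R by rewrite exprM sqr_sqrtr ?ltW.
by rewrite !exprMn sk sqr_sqrtr ?ltW// mulrA mul1r.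
Qed.

Let mom_fin k : mom k 1 < +oo.
Proof.
have fin01 : mom 0 1 < +oo.
  have p0 : (normal_peak 1 != 0 :> R)%R by rewrite gt_eqF ?normal_peak_gt0.
  have : \int[gauss R]_x (cst 1 x) = 1.
    by rewrite integral_cst// mul1e; exact: probability_setT.
  rewrite integral_gauss//.
  have -> : \int[leb]_x (cst 1 x * (normal_pdf 0 1 x)%:E) =
      (normal_peak 1)%:E * mom 0 1.
    rewrite momZ ?normal_peak_ge0//.
    apply: eq_integral => x _; rewrite mul1e normal_pdf01E /dens muln0.
    by rewrite expr0 !mul1r mulNr.
  move=> E; have : (normal_peak 1)%:E * mom 0 1 < +oo :> \bar R by rewrite E ltry.
  case: (mom 0 1) (mom_ge0 0 1) => [r _ _|_|//]; first exact: ltry.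
  by rewrite gt0_muley// lte_fin normal_peak_gt0.
have fin0h : mom 0 2^-1 < +oo.
  have h0 : (0 < 2^-1 :> R)%R by rewrite invr_gt0.
  have := fin01; rewrite -(mom_scale 0 h0) expr0 mulr1.
  case: (mom 0 2^-1) (mom_ge0 0 2^-1) => [r _ _|_|//]; first exact: ltry.
  by rewrite gt0_muley// lte_fin sqrtr_gt0.
(* With x^2 = 4 (k + 1) y one has y^k <= exp(k y) and k y <= x^2 / 4, so half of the exponent
   absorbs the power and [A] is the remaining constant. *)
pose A : R := ((4 * k.+1%:R) ^+ k)%R.
have A0 : (0 <= A)%R by rewrite exprn_ge0// mulr_ge0.
apply: (@le_lt_trans _ _ (A%:E * mom 0 2^-1)); last first.
  by rewrite lte_mul_pinfty ?lee_fin.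
rewrite momZ//.
apply: ge0_le_integral => //.
- by move=> x _; rewrite lee_fin dens_ge0.
- by apply/measurable_EFinP; apply: measurable_funM => //; exact: mdens.
move=> x _; rewrite lee_fin /dens muln0 expr0 !mul1r.
pose y : R := (x ^+ 2 / (4 * k.+1%:R))%R.
have y0 : (0 <= y)%R by rewrite divr_ge0 ?sqr_ge0// mulr_ge0.
have xy : (x ^+ 2 = 4 * k.+1%:R * y)%R.
  by rewrite /y mulrC divfK// mulf_neq0 ?pnatr_eq0.
have -> : (x ^+ (2 * k) = A * y ^+ k)%R by rewrite exprM xy exprMn.
rewrite -mulrA; apply: ler_wpM2l => //.
have yk : (y ^+ k <= expR (k%:R * y))%R.
  rewrite expRM_natl lerXn2r ?nnegrE ?expR_ge0//.
  by rewrite (le_trans _ (expR_ge1Dx y))// lerDr.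
apply: (@le_trans _ _ (expR (k%:R * y) * expR (- (x ^+ 2 / 2)))%R).
  by rewrite ler_wpM2r ?expR_ge0.
rewrite -expRD ler_expR xy -natr1; lra.
Qed.

Let mom_pos k : 0 < mom k 1.
Proof.
apply: (@lt_le_trans _ _ (\int[leb]_(x in `[1%R, 2%R]) (expR (- 2))%:E)).
  have lb : leb `[1%R, 2%R]%classic = 1%:E.
    by rewrite lebesgue_measure_itv/= lte_fin ltr1n -EFinD; congr _%:E; lra.
  rewrite integral_cst//.
  by rewrite [X in _ < _ * X]lb mule1 lte_fin expR_gt0.
rewrite integral_mkcond; apply: ge0_le_integral => //.
- by move=> /= x _; rewrite patchE; case: ifP => // _; rewrite lee_fin expR_ge0.
- by apply/(measurable_restrictT _ _).1.
move=> /= x _; rewrite patchE mem_setE in_itv/=; case: ifP; last first.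
  by rewrite lee_fin dens_ge0.
move=> /andP[x1 x2]; rewrite lee_fin /dens -[leLHS]mul1r ler_pM ?expR_ge0//.
  exact: exprn_ege1.
by rewrite ler_expR; nra.
Qed.

Let momE k (c : R) : (0 < c)%R ->
  mom k c = ((fine (mom k 1)) / (Num.sqrt c * c ^+ k))%:E.
Proof.
move=> c0; have sc : (Num.sqrt c * c ^+ k != 0)%R.
  by rewrite mulf_neq0// gt_eqF ?sqrtr_gt0 ?exprn_gt0.
have m1 : mom k 1 \is a fin_num by rewrite ge0_fin_numE// mom_fin.
have := mom_scale k c0.
case: (mom k c) (mom_ge0 k c) => [r||]// _.
  by move=> <-; rewrite -EFinM/= mulrAC divff// mul1r.
rewrite gt0_muley; last by rewrite lte_fin mulr_gt0 ?sqrtr_gt0 ?exprn_gt0.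
by move=> E; rewrite -E in m1.
Qed.

(** The k-th component has density proportional to x^(2k) exp(- B x^2 / 2), and its transform at s
    is the ratio of the moments for B + s and for B. One P serves every s > - B; the negative values
    yield exponential moments. *)
Lemma gamma_mixture (B : R) (w : nat -> R) : (0 < B)%R -> (forall k, 0 <= w k)%R ->
  (fun n => \sum_(k < n) w k)%R @ \oo --> (1 : R)%R ->
  exists P : probability mR R, forall s g : R, (- B < s)%R ->
    (fun n => \sum_(k < n) w k * (Num.sqrt (B / (B + s)) * (B / (B + s)) ^+ k))%R
      @ \oo --> g ->
    \int[P]_x (expR (- (s * x ^+ 2 / 2)))%:E = g%:E.
Proof.
move=> B0 w0 w1.
have ex_P k : exists P : probability mR R, forall s : R, (- B < s)%R ->
    \int[P]_x (expR (- (s * x ^+ 2 / 2)))%:E =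
    (Num.sqrt (B / (B + s)) * (B / (B + s)) ^+ k)%:E.
  pose c := fine (mom k B).
  have m0 : (0 < fine (mom k 1))%R by rewrite fine_gt0// mom_pos mom_fin.
  have sB : (0 < Num.sqrt B)%R by rewrite sqrtr_gt0.
  have c0 : (0 < c)%R by rewrite /c momE//= divr_gt0// mulr_gt0// exprn_gt0.
  have mp : measurable_fun [set: mR] (fun x : mR => c^-1 * dens k B x : R)%R.
    by apply: measurable_funM => //; exact: mdens.
  have p0 (x : mR) : (0 <= c^-1 * dens k B x)%R.
    by rewrite mulr_ge0 ?dens_ge0// invr_ge0 ltW.
  have p1 : \int[leb]_x (c^-1 * dens k B x)%:E = 1.
    rewrite -momZ ?invr_ge0 ?ltW// -(@fineK _ (mom k B)); last by rewrite momE.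
    by rewrite -EFinM mulVf// gt_eqF.
  have [P PE] := density_prob mp p0 p1.
  exists P => s sB'; have Bs : (0 < B + s)%R by rewrite -ltrBlDl sub0r.
  have sBs : (0 < Num.sqrt (B + s))%R by rewrite sqrtr_gt0.
  rewrite PE; last 2 first.
  - have /measurable_EFinP := @mdens 0 s.
    by rewrite /dens; under eq_fun do rewrite muln0 expr0 mul1r.
  - by move=> x; rewrite lee_fin expR_ge0.
  transitivity (c^-1%:E * mom k (B + s)).
    rewrite momZ ?invr_ge0 ?ltW//; apply: eq_integral => x _.
    rewrite -EFinM /dens; congr _%:E.
    have -> : (- ((B + s) * x ^+ 2 / 2) = - (s * x ^+ 2 / 2) + - (B * x ^+ 2 / 2))%R.
      by field.
    by rewrite expRD; ring.
  rewrite momE// -EFinM /c momE//=; congr _%:E.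
  rewrite sqrtrM ?ltW// sqrtrV ?ltW// expr_div_n.
  have BX : (B ^+ k != 0)%R by rewrite expf_neq0// gt_eqF.
  have BsX : ((B + s) ^+ k != 0)%R by rewrite expf_neq0// gt_eqF.
  field; rewrite BX BsX !gt_eqF//.
have [P_ P_E] := choice ex_P.
have [P PE] := mixture_prob P_ w0 w1.
exists P => s g sB cg; rewrite PE; last 2 first.
- have /measurable_EFinP := @mdens 0 s.
  by rewrite /dens; under eq_fun do rewrite muln0 expr0 mul1r.
- by move=> x; rewrite lee_fin expR_ge0.
apply/cvg_lim => //.
rewrite (_ : (fun _ => _) = EFin \o (fun n =>
  \sum_(k < n) w k * (Num.sqrt (B / (B + s)) * (B / (B + s)) ^+ k))%R); last first.
  apply/funext => n /=; rewrite -sumEFin big_mkord; apply: eq_bigr => k _.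
  by rewrite P_E.
by apply/cvg_EFin => //; exact: nearW.
Qed.

End gamma_mixtures.

(** * Planar norms as Gaussian averages *)

Section max_representation.
Variable R : realType.
Local Notation mR := (measurableTypeR R).
Local Open Scope ereal_scope.

Variable P : probability mR R.
Hypothesis P1 : \int[P]_x (`|x|)%:E < +oo.
Hypothesis P2 : \int[P]_x (x ^+ 2)%:E < +oo.

Local Notation PP := (mR * mR)%type.
Let W (h : PP -> R) := \int[P \x gauss R]_z (h z)%:E.

Let nested (h : PP -> R) : measurable_fun setT h -> (forall z, 0 <= h z)%R ->
  W h = \int[P]_x \int[gauss R]_y (h (x, y))%:E.
Proof.
move=> mh h0; by rewrite /W fubini_tonelli1//; exact/measurable_EFinP.
Qed.

Let WD (h1 h2 : PP -> R) :
  measurable_fun setT h1 -> (forall z, 0 <= h1 z)%R ->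
  measurable_fun setT h2 -> (forall z, 0 <= h2 z)%R ->
  W (fun z => h1 z + h2 z)%R = W h1 + W h2.
Proof.
move=> mh1 h10 mh2 h20; rewrite /W; under eq_integral do rewrite EFinD.
apply: ge0_integralD => //.
- by move=> z _; rewrite lee_fin.
- exact/measurable_EFinP.
- by move=> z _; rewrite lee_fin.
- exact/measurable_EFinP.
Qed.

Let WZ (a : R) (h : PP -> R) : (0 <= a)%R ->
  measurable_fun setT h -> (forall z, 0 <= h z)%R ->
  W (fun z => a * h z)%R = a%:E * W h.
Proof.
move=> a0 mh h0; rewrite /W; under eq_integral do rewrite EFinM.
apply: ge0_integralZl_EFin => //; first by move=> z _; rewrite lee_fin.
exact/measurable_EFinP.
Qed.

Let W_le (h1 h2 : PP -> R) :
  measurable_fun setT h1 -> (forall z, 0 <= h1 z)%R ->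
  measurable_fun setT h2 -> (forall z, h1 z <= h2 z)%R -> W h1 <= W h2.
Proof.
move=> mh1 h10 mh2 h12; apply: ge0_le_integral => //.
- by move=> z _; rewrite lee_fin.
- exact/measurable_EFinP.
- exact/measurable_EFinP.
- by move=> z _; rewrite lee_fin.
Qed.

Let W_ge0 (h : PP -> R) : (forall z, 0 <= h z)%R -> 0 <= W h.
Proof. by move=> h0; apply: integral_ge0 => z _; rewrite lee_fin. Qed.

Let m1 : measurable_fun setT (fun z : PP => `|z.1| : R)%R.
Proof. by apply: measurableT_comp; [exact: normr_measurable|exact: measurable_fst]. Qed.

Let m2 : measurable_fun setT (fun z : PP => `|z.2| : R)%R.
Proof. by apply: measurableT_comp; [exact: normr_measurable|exact: measurable_snd]. Qed.

Let m2u (u : R) : measurable_fun setT (fun z : PP => u * `|z.2| : R)%R.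
Proof. exact: measurable_funM. Qed.

(** As functions of u at fixed z: [fmax] is convex, [ftail] is a subgradient of it, and [fball] is
    the intercept [fmax - u * ftail]. *)
Let fmax (u : R) (z : PP) : R := (Num.max `|z.1| (u * `|z.2|))%R.
Let ftail (u : R) (z : PP) : R := (if `|z.1| < u * `|z.2| then `|z.2| else 0)%R.
Let fball (u : R) (z : PP) : R := (if `|z.1| < u * `|z.2| then 0 else `|z.1|)%R.

Let mfmax u : measurable_fun setT (fmax u).
Proof. exact: measurable_maxr. Qed.

Let mftail u : measurable_fun setT (ftail u).
Proof. by apply: measurable_fun_ifT => //; exact: measurable_fun_ltr. Qed.

Let mfball u : measurable_fun setT (fball u).
Proof. by apply: measurable_fun_ifT => //; exact: measurable_fun_ltr. Qed.

Let fmax_ge0 u z : (0 <= fmax u z)%R.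
Proof. by rewrite le_max normr_ge0. Qed.

Let ftail_ge0 u z : (0 <= ftail u z)%R.
Proof. by rewrite /ftail; case: ifP. Qed.

Let fball_ge0 u z : (0 <= fball u z)%R.
Proof. by rewrite /fball; case: ifP. Qed.

Let W1 : W (fun z => `|z.1|)%R = \int[P]_x (`|x|)%:E.
Proof.
rewrite nested//; apply: eq_integral => x _ /=.
by rewrite integral_cst// [X in _ * X]probability_setT mule1.
Qed.

Let W2 : W (fun z => `|z.2|)%R = \int[gauss R]_y (`|y|)%:E.
Proof.
rewrite nested//=.
rewrite integral_cst; first by rewrite [X in _ * X]probability_setT mule1.
exact: measurableT.
Qed.

Let Wtail (u : R) : (0 < u)%R ->
  W (ftail u) = (gconst R)%:E * \int[P]_x (expR (- (u ^- 2 * x ^+ 2 / 2)))%:E.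
Proof.
have g0 := ltW (gconst_gt0 R).
move=> u0; rewrite nested// -ge0_integralZl_EFin//; last first.
  apply/measurable_EFinP; apply: continuous_measurable_fun => x.
  apply: continuous_comp; last exact: continuous_expR.
  apply: cvgN; apply: cvgM; last exact: cvg_cst.
  by apply: cvgM; [exact: cvg_cst|exact: exprn_continuous].
apply: eq_integral => x _.
have xu0 : (0 <= `|x| / u)%R by rewrite divr_ge0// ltW.
transitivity (\int[gauss R]_y (`|y| * (`|x| / u < `|y|)%R%:R)%:E).
  apply: eq_integral => y _; rewrite /ftail/= ltr_pdivrMr// [(`|y| * u)%R]mulrC.
  by case: ifP; rewrite ?mulr1 ?mulr0.
rewrite gauss_tail// EFinM; congr (_ * (expR _)%:E).
by rewrite expr_div_n real_normK ?num_real// mulNr; congr (- (_ / _))%R; rewrite mulrC.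
Qed.

(** For fixed xi the integral is |xi| times the probability that |y| <= |xi| / u, hence at most
    gconst xi^2 / u; this is where the second moment enters. *)
Let Wball (u : R) : (0 < u)%R ->
  W (fball u) <= (gconst R / u)%:E * \int[P]_x (x ^+ 2)%:E.
Proof.
move=> u0.
have gu : (0 <= gconst R / u)%R by rewrite divr_ge0 ?ltW// gconst_gt0.
have mx2 : measurable_fun [set: mR] (fun x : mR => (x ^+ 2)%:E).
  by apply/measurable_EFinP; exact: measurable_funX.
rewrite nested// -ge0_integralZl_EFin//; last by move=> x _; rewrite lee_fin sqr_ge0.
apply: ge0_le_integral => //.
- by move=> x _; apply: integral_ge0 => y _; rewrite lee_fin.
- apply: (@measurable_fun_fubini_tonelli_F _ _ mR mR R (gauss R)
    (fun z => (fball u z)%:E)).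
  + exact/measurable_EFinP.
  + by move=> z; rewrite lee_fin.
- by apply: emeasurable_funM.
move=> x _; have xu0 : (0 <= `|x| / u)%R by rewrite divr_ge0// ltW.
have -> : \int[gauss R]_y (fball u (x, y))%:E =
    `|x|%:E * \int[gauss R]_y ((`|y| <= `|x| / u)%R%:R)%:E.
  rewrite -ge0_integralZl_EFin//; last first.
    apply/measurable_EFinP.
    rewrite (_ : (fun _ => _) = \1_(`[(- (`|x| / u))%R, (`|x| / u)%R])).
      exact: measurable_indic.
    by apply/funext => y; rewrite indicE mem_setE in_itv/= ler_norml.
  apply: eq_integral => y _; rewrite -EFinM /fball/= ler_pdivlMr// [(u * _)%R]mulrC.
  by rewrite leNgt; case: ltP; rewrite ?mulr1 ?mulr0.
apply: le_trans (lee_wpmul2l _ (gauss_ball xu0)) _ => //.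
rewrite -!EFinM lee_fin -[(x ^+ 2)%R](real_normK (num_real x)) expr2.
by rewrite le_eqVlt; apply/orP; left; apply/eqP; ring.
Qed.

Let Wfmax_fin u : (0 <= u)%R -> W (fmax u) \is a fin_num.
Proof.
move=> u0; rewrite ge0_fin_numE ?W_ge0//.
apply: (@le_lt_trans _ _ (W (fun z => `|z.1| + u * `|z.2|)%R)).
  apply: W_le => //; first exact: measurable_funD.
  by move=> z; rewrite ge_max lerDl lerDr normr_ge0 mulr_ge0.
rewrite WD//; last by move=> z; rewrite mulr_ge0.
by rewrite WZ// W1 W2 lte_add_pinfty// lte_mul_pinfty// gauss_abs_fin.
Qed.

Let Wftail_fin u : W (ftail u) \is a fin_num.
Proof.
rewrite ge0_fin_numE ?W_ge0//; apply: (@le_lt_trans _ _ (W (fun z => `|z.2|)%R)).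
  by apply: W_le => // z; rewrite /ftail; case: ifP.
by rewrite W2 gauss_abs_fin.
Qed.

Let fmaxE u z : fmax u z = (u * ftail u z + fball u z)%R.
Proof.
rewrite /fmax /ftail /fball; case: ifP => [lt|/negbT].
  by rewrite addr0; apply/max_idPr/ltW.
by rewrite -leNgt mulr0 add0r => /max_idPl.
Qed.

Let fmax_sub u v z : (fmax u z + (v - u) * ftail u z <= fmax v z)%R.
Proof.
rewrite /fmax /ftail; case: ifP => [lt|/negbT].
  by rewrite (max_idPr (ltW lt)) -mulrDl addrC subrK le_max lexx orbT.
by rewrite -leNgt mulr0 addr0 => /max_idPl ->; rewrite le_max lexx.
Qed.

Let W_sub u v : (0 < u)%R -> (0 < v)%R ->
  (fine (W (fmax u)) + (v - u) * fine (W (ftail u)) <= fine (W (fmax v)))%R.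
Proof.
move=> /ltW u0 /ltW v0; rewrite -lee_fin.
have [uv|/ltW vu] := leP u v.
  have vu0 : (0 <= v - u)%R by rewrite subr_ge0.
  rewrite EFinD EFinM !fineK ?Wfmax_fin// -WZ// -WD//.
  - apply: W_le.
    + by apply: measurable_funD => //; exact: measurable_funM.
    + by move=> z; rewrite addr_ge0// mulr_ge0.
    + exact: mfmax.
    + by move=> z; exact: fmax_sub.
  - exact: measurable_funM.
  - by move=> z; rewrite mulr_ge0.
have uv0 : (0 <= u - v)%R by rewrite subr_ge0.
rewrite lee_fin -lerBrDr -mulNr opprB -lee_fin.
rewrite EFinD EFinM !fineK ?Wfmax_fin// -WZ// -WD//.
- apply: W_le.
  + exact: mfmax.
  + exact: fmax_ge0.
  + by apply: measurable_funD => //; exact: measurable_funM.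
  + by move=> z; have := fmax_sub u v z; rewrite -lerBrDr -mulNr opprB.
- exact: measurable_funM.
- by move=> z; rewrite mulr_ge0.
Qed.

(** By [Wtail] the average and k have the same subgradient q, and both intercepts are O(1/u), so
    uniqueness applies. *)
Let max_repr (M C : R) (q k : R -> R) : (0 <= M)%R -> subgradient q k ->
  (forall u, 0 < u -> `|k u - u * q u| <= C / u)%R ->
  (forall u, (0 < u)%R -> (q u)%:E = (M * gconst R)%:E *
     \int[P]_x (expR (- (u ^- 2 * x ^+ 2 / 2)))%:E) ->
  forall u, (0 < u)%R -> M%:E * W (fmax u) = (k u)%:E.
Proof.
move=> M0 qk kC qE u u0.
pose k2 (u : R) : R := (M * fine (W (fmax u)))%R.
have qtail v : (0 < v)%R -> q v = (M * fine (W (ftail v)))%R.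
  move=> v0; apply: EFin_inj; rewrite qE// EFinM -muleA -Wtail//.
  by rewrite EFinM fineK.
pose S := fine (\int[P]_x (x ^+ 2)%:E).
have S0 : (0 <= S)%R.
  by apply/fine_ge0/integral_ge0 => x _; rewrite lee_fin sqr_ge0.
have k2ball v : (0 < v)%R -> (`|k2 v - v * q v| <= M * (gconst R / v * S))%R.
  move=> v0; rewrite qtail// /k2 mulrCA -mulrBr normrM ger0_norm// ler_wpM2l//.
  have -> : W (fmax v) = v%:E * W (ftail v) + W (fball v).
    rewrite -(WZ (ltW v0))// -WD//.
    - by congr W; apply/funext => z; exact: fmaxE.
    - exact: measurable_funM.
    - by move=> z; rewrite mulr_ge0// ltW.
  have fS : (\int[P]_x (x ^+ 2)%:E) \is a fin_num.
    by rewrite ge0_fin_numE//; apply: integral_ge0 => x _; rewrite lee_fin sqr_ge0.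
  have fb : W (fball v) \is a fin_num.
    rewrite ge0_fin_numE ?W_ge0// (le_lt_trans (Wball v0))//.
    by rewrite -(fineK fS) -EFinM ltry.
  have fvt : v%:E * W (ftail v) \is a fin_num by rewrite fin_numM.
  rewrite fineD// fineM//= addrAC subrr add0r ger0_norm; last exact/fine_ge0/W_ge0.
  by rewrite -lee_fin fineK// EFinM /S fineK// Wball.
have k2sub : subgradient q k2.
  move=> v w v0 w0; rewrite qtail// /k2 -mulrA -mulrDr ler_wpM2l//.
  by rewrite [(_ * (w - v))%R]mulrC W_sub.
have -> : k u = k2 u.
  apply: (subgradient_unique qk k2sub) u0 => e e0.
  (* D dominates the constants of both intercepts, so both are at most e at u = (D + 1) / e; adding
     1 keeps u positive. *)
  pose D : R := (`|C| + M * (gconst R * S))%R.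
  have G0 : (0 <= M * (gconst R * S))%R.
    by apply: mulr_ge0 => //; apply: mulr_ge0 => //; exact/ltW/gconst_gt0.
  have D0 : (0 <= D)%R by rewrite addr_ge0.
  have D10 : (0 < D + 1)%R by rewrite ltr_wpDl.
  have v0 : (0 < (D + 1) / e)%R by rewrite divr_gt0.
  exists ((D + 1) / e)%R => //.
  have De c : (c <= D)%R -> (c / ((D + 1) / e) <= e)%R.
    move=> cD; rewrite invf_div mulrA ler_pdivrMr// mulrC ler_pM2l//.
    by rewrite (le_trans cD)// lerDl.
  split.
    by rewrite (le_trans (kC _ v0))// De// /D (le_trans (ler_norm C))// lerDl.
  rewrite (le_trans (k2ball _ v0))//.
  have -> : (M * (gconst R / ((D + 1) / e) * S) = M * (gconst R * S) / ((D + 1) / e))%R.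
    by ring.
  by rewrite De// /D lerDr.
by rewrite /k2 EFinM fineK// Wfmax_fin// ltW.
Qed.

Let flin (x t : R) (z : PP) : R := (`|x * z.1 + t * z.2|)%R.

Let mflin x t : measurable_fun setT (flin x t).
Proof.
apply: measurableT_comp; first exact: normr_measurable.
by apply: measurable_funD; apply: measurable_funM => //.
Qed.

Let max_half (a b : R) : (Num.max `|a| `|b| = 2^-1 * (`|a + b| + `|a - b|))%R.
Proof.
rewrite maxEle; case: (ger0P a) => a0; case: (ger0P b) => b0;
  case: (ger0P (a + b)%R) => ab0; case: (ger0P (a - b)%R) => ab1;
  case: ifP => // ab2; try (move/negbT in ab2; rewrite -ltNge in ab2); lra.
Qed.

Let sym_max (a t : R) : \int[gauss R]_y (`|a + t * y|)%:E =
  \int[gauss R]_y (Num.max `|a| (`|t| * `|y|))%:E.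
Proof.
have mh : measurable_fun [set: mR] (fun y : mR => (`|a + t * y|)%:E).
  apply/measurable_EFinP; apply: measurableT_comp; first exact: normr_measurable.
  by apply: measurable_funD => //; exact: measurable_funM.
transitivity (\int[gauss R]_y ((2^-1)%:E *
    ((`|a + t * y|)%:E + (`|a + t * - y|)%:E))); last first.
  apply: eq_integral => y _; rewrite -EFinD -EFinM mulrN; congr _%:E.
  by rewrite -normrM max_half.
have h0 (y : mR) : 0 <= (`|a + t * y|)%:E by rewrite lee_fin.
have mh' : measurable_fun [set: mR] (fun y : mR => (`|a + t * - y|)%:E).
  by apply: (measurableT_comp mh).
rewrite ge0_integralZl_EFin//; [|by move=> y _; rewrite adde_ge0
  |exact: emeasurable_funD].
rewrite ge0_integralD// (gauss_opp mh h0).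
case: (\int[gauss R]_y _) => [r||].
- by rewrite -EFinD -EFinM; congr _%:E; field.
- by rewrite addye// gt0_muley// lte_fin.
- by rewrite /= gt0_muleNy// lte_fin.
Qed.

(** Off the axes, homogeneity reduces the identity to [max_repr] at u = |t| / |x|. On the axes it
    follows because both sides are Lipschitz. *)
Lemma gaussian_average (M C C' : R) (q : R -> R) (F : R -> R -> R) :
  (0 <= M)%R -> subgradient q (F 1%R) ->
  (forall u, 0 < u -> `|F 1 u - u * q u| <= C / u)%R ->
  (forall u, (0 < u)%R -> (q u)%:E = (M * gconst R)%:E *
     \int[P]_x (expR (- (u ^- 2 * x ^+ 2 / 2)))%:E) ->
  (forall x t, x != 0 -> F x t = `|x| * F 1 (`|t| / `|x|))%R ->
  (forall x t x' t', `|F x t - F x' t'| <= C' * (`|x - x'| + `|t - t'|))%R ->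
  forall x t, M%:E * \int[P]_xi \int[gauss R]_y (`|x * xi + t * y|)%:E = (F x t)%:E.
Proof.
move=> M0 qF FC qE FZ FL x t.
have nE x' t' : \int[P]_xi \int[gauss R]_y (`|x' * xi + t' * y|)%:E = W (flin x' t').
  by rewrite nested// => z; rewrite /flin.
rewrite nE.
have generic x' t' : x' != 0%R -> t' != 0%R ->
    M%:E * W (flin x' t') = (F x' t')%:E.
  move=> x0 t0; have u0 : (0 < `|t'| / `|x'|)%R by rewrite divr_gt0 ?normr_gt0.
  rewrite FZ// EFinM -(max_repr M0 qF FC qE u0) muleCA; congr (_ * _).
  rewrite -WZ// nested//; last by move=> z; rewrite /flin.
  rewrite [RHS]nested; [|exact: measurable_funM|by move=> z; rewrite mulr_ge0].
  apply: eq_integral => xi _; rewrite [LHS](sym_max (x' * xi)%R t'); apply: eq_integral => y _.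
  rewrite /fmax/= maxr_pMr// normrM mulrA; congr (Num.max _ (_ * _))%:E.
  by rewrite mulrC divfK// normr_eq0.
pose g1 := fine (\int[P]_x (`|x|)%:E); pose g2 := fine (\int[gauss R]_y (`|y|)%:E).
have g1E : g1%:E = W (fun z => `|z.1|)%R.
  rewrite W1 fineK// ge0_fin_numE//; apply: integral_ge0 => y _.
  by rewrite lee_fin.
have g2E : g2%:E = W (fun z => `|z.2|)%R.
  rewrite W2 fineK// ge0_fin_numE ?gauss_abs_fin//; apply: integral_ge0 => y _.
  by rewrite lee_fin.
have flinD x1 t1 x2 t2 : W (flin x1 t1) <=
    W (flin x2 t2) + (`|x1 - x2| * g1 + `|t1 - t2| * g2)%:E.
  pose A (z : PP) : R := (`|x1 - x2| * `|z.1|)%R.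
  pose B (z : PP) : R := (`|t1 - t2| * `|z.2|)%R.
  have mA : measurable_fun setT A by exact: measurable_funM.
  have mB : measurable_fun setT B by exact: measurable_funM.
  have A0 z : (0 <= A z)%R by rewrite mulr_ge0.
  have B0 z : (0 <= B z)%R by rewrite mulr_ge0.
  have l0 z : (0 <= flin x2 t2 z)%R by rewrite /flin.
  have mAB : measurable_fun setT (fun z => A z + B z)%R by exact: measurable_funD.
  have AB0 z : (0 <= A z + B z)%R by rewrite addr_ge0.
  rewrite EFinD !EFinM g1E g2E -(WZ _ m1)// -(WZ _ m2)//.
  rewrite -(WD mA A0 mB B0) -(WD (@mflin x2 t2) l0 mAB AB0).
  apply: W_le => //; [by move=> z; rewrite /flin|exact: measurable_funD|].
  move=> z; rewrite /A /B; rewrite /flin -!normrM.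
  apply: le_trans (lerD (lexx _) (ler_normD _ _)).
  apply: le_trans (ler_normD _ _).
  by rewrite le_eqVlt; apply/orP; left; apply/eqP; congr (`|_|)%R; ring.
have fflin x1 t1 : W (flin x1 t1) \is a fin_num.
  rewrite ge0_fin_numE; last by apply: W_ge0 => z; rewrite /flin.
  apply: le_lt_trans (flinD x1 t1 0%R 0%R) _.
  have -> : W (flin 0 0) = 0.
    by apply: integral0_eq => z _; rewrite /flin !mul0r addr0 normr0.
  by rewrite add0e ltry.
pose m x1 t1 := (M * fine (W (flin x1 t1)))%R.
have mL x1 t1 x2 t2 :
    (m x1 t1 - m x2 t2 <= M * (`|x1 - x2| * g1 + `|t1 - t2| * g2))%R.
  rewrite /m -mulrBr ler_wpM2l// lerBlDl -lee_fin EFinD !fineK//.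
rewrite -(fineK (fflin x t)) -EFinM -/(m x t); congr _%:E.
have g10 : (0 <= g1)%R.
  by rewrite -lee_fin g1E; apply: W_ge0.
have g20 : (0 <= g2)%R.
  by rewrite -lee_fin g2E; apply: W_ge0.
pose K : R := (M * (g1 + g2) + 2 * `|C'|)%R.
have K0 : (0 <= K)%R by rewrite addr_ge0// mulr_ge0// addr_ge0.
have close e : (0 < e)%R -> (`|m x t - F x t| <= K * e)%R.
  (* Moves a vanishing coordinate off its axis, at distance e. *)
  move=> e0; pose sh (y : R) : R := if y == 0%R then e else y.
  have sh0 y : sh y != 0%R by rewrite /sh; case: ifPn => // _; rewrite gt_eqF.
  have she y : (`|y - sh y| <= e)%R.
    rewrite /sh; case: ifPn => [/eqP ->|_]; last by rewrite subrr normr0 ltW.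
    by rewrite sub0r normrN gtr0_norm.
  have E : m (sh x) (sh t) = F (sh x) (sh t).
    by apply: EFin_inj; rewrite /m EFinM fineK// generic.
  have L : (M * (`|x - sh x| * g1 + `|t - sh t| * g2) <= M * (g1 + g2) * e)%R.
    rewrite -mulrA ler_wpM2l// [leRHS]mulrC mulrDr lerD// ler_wpM2r//.
  have L2 : (C' * (`|x - sh x| + `|t - sh t|) <= 2 * `|C'| * e)%R.
    apply: (@le_trans _ _ (`|C'| * (`|x - sh x| + `|t - sh t|))%R).
      by rewrite ler_wpM2r ?addr_ge0// ler_norm.
    rewrite [(2 * _)%R]mulrC -mulrA ler_wpM2l// mulr_natl mulr2n lerD//.
  have := mL x t (sh x) (sh t); have := mL (sh x) (sh t) x t.
  rewrite ![`|sh _ - _|%R]distrC E => a1 a2.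
  have := le_trans (FL x t (sh x) (sh t)) L2.
  rewrite !ler_norml => /andP[b1 b2].
  by apply/andP; split; rewrite /K mulrDl; lra.
apply/eqP; rewrite -subr_eq0 -normr_le0 leNgt; apply/negP => d0.
have K10 : (0 < K + 1)%R by rewrite ltr_wpDl.
have := close _ (divr_gt0 d0 K10).
rewrite mulrA ler_pdivlMr// mulrDr mulr1 mulrC; lra.
Qed.

End max_representation.

Section gamma_embedding.
Variable R : realType.
Local Notation mR := (measurableTypeR R).

(** From x^2 <= (2 / d) exp(d x^2 / 2) and |x| <= 1 + x^2. *)
Let square_moments (P : probability mR R) (d g : R) : 0 < d ->
  (\int[P]_x (expR (- (- d * x ^+ 2 / 2)))%:E = g%:E)%E ->
  (\int[P]_x (`|x|)%:E < +oo)%E /\ (\int[P]_x (x ^+ 2)%:E < +oo)%E.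
Proof.
move=> d0 Pg.
have mx2 : measurable_fun [set: mR] (fun x : mR => (x ^+ 2)%:E).
  by apply/measurable_EFinP; exact: measurable_funX.
have P2 : (\int[P]_x (x ^+ 2)%:E < +oo)%E.
  have me : measurable_fun [set: mR] (fun x : mR => (expR (- (- d * x ^+ 2 / 2)))%:E).
    apply/measurable_EFinP; apply: continuous_measurable_fun => x.
    apply: continuous_comp; last exact: continuous_expR.
    apply: cvgN; apply: cvgM; last exact: cvg_cst.
    by apply: cvgM; [exact: cvg_cst|exact: exprn_continuous].
  have d2 : 0 <= 2 / d by rewrite divr_ge0// ltW.
  apply: (@le_lt_trans _ _ ((2 / d)%:E * g%:E)%E); last by rewrite -EFinM ltry.
  rewrite -Pg -ge0_integralZl_EFin//.
  apply: ge0_le_integral => //.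
  - by move=> x _; rewrite lee_fin sqr_ge0.
  - exact: emeasurable_funM.
  move=> x _; rewrite -EFinM lee_fin mulrC -ler_pdivrMr ?divr_gt0// invf_div.
  rewrite (le_trans _ (expR_ge1Dx _))// -[leLHS]add0r lerD//.
  by rewrite le_eqVlt; apply/orP; left; apply/eqP; field.
split => //.
apply: (@le_lt_trans _ _ (\int[P]_x (1 + (x ^+ 2)%:E))%E).
  apply: ge0_le_integral => //.
  - by apply/measurable_EFinP; exact: normr_measurable.
  - exact: emeasurable_funD.
  move=> x _; rewrite -EFinD lee_fin -[x ^+ 2](real_normK (num_real x)).
  by have := normr_ge0 x; nra.
rewrite ge0_integralD//; last by move=> x _; rewrite lee_fin sqr_ge0.
by rewrite integral_cst// mul1e [X in (X + _)%E]probability_setT lte_add_pinfty// ltry.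
Qed.

(** The criterion used for both planar norms. Convergence at s = - d provides the moments of the
    mixing law, and [tau] is its Laplace transform at u^-2. *)
Lemma gamma_embedding (B M C C' d g : R) (w : nat -> R) (q tau : R -> R)
    (F : R -> R -> R) :
  0 < B -> (forall k, 0 <= w k) ->
  (fun n => \sum_(k < n) w k) @ \oo --> (1 : R) ->
  0 < d < B ->
  (fun n => \sum_(k < n) w k * (Num.sqrt (B / (B - d)) * (B / (B - d)) ^+ k))
    @ \oo --> g ->
  (forall u, 0 < u -> (fun n => \sum_(k < n) w k *
      (Num.sqrt (B / (B + u ^- 2)) * (B / (B + u ^- 2)) ^+ k)) @ \oo --> tau u) ->
  0 <= M -> (forall u, 0 < u -> q u = M * gconst R * tau u) ->
  subgradient q (F 1) -> (forall u, 0 < u -> `|F 1 u - u * q u| <= C / u) ->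
  (forall x t, x != 0 -> F x t = `|x| * F 1 (`|t| / `|x|)) ->
  (forall x t x' t', `|F x t - F x' t'| <= C' * (`|x - x'| + `|t - t'|)) ->
  exists (E0 : L1_unit_interval R) (E : nat -> L1_unit_interval R),
    forall x n (v : nat -> R), `|x *: E0 + \sum_(i < n) v i *: E i| =
      F x (Num.sqrt (\sum_(i < n) v i ^+ 2)).
Proof.
move=> B0 w0 w1 /andP[d0 dB] cg ctau M0 qE qF FC FZ FL.
have [P PE] := gamma_mixture B0 w0 w1.
have [P1 P2] : (\int[P]_x (`|x|)%:E < +oo)%E /\ (\int[P]_x (x ^+ 2)%:E < +oo)%E.
  by apply: (@square_moments _ d g) => //; apply: PE => //; rewrite ltrN2.
have [E0 [E EE]] := mixed_gaussian_vectors M0 P1.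
exists E0, E => x n v; apply: EFin_inj; rewrite EE.
apply: (gaussian_average P1 P2 M0 qF FC) => // u u0.
have Bu : - B < u ^- 2.
  by rewrite (lt_trans _ (_ : 0 < u ^- 2))// ?oppr_lt0// invr_gt0 exprn_gt0.
by rewrite qE// EFinM -(PE _ _ Bu (ctau u u0)).
Qed.

End gamma_embedding.

(** * The planar norm and its dual *)

Section planar_norms.
Variable R : realType.

Definition pnorm (x t : R) : R := (3 * x ^+ 2 + 2 * t ^+ 2) / Num.sqrt (x ^+ 2 + t ^+ 2).

Let r2_gt0 (x t : R) : (x != 0) || (t != 0) -> 0 < x ^+ 2 + t ^+ 2.
Proof.
by case/orP => h; [rewrite ltr_pwDl|rewrite ltr_wpDl];
  rewrite ?exprn_even_gt0 ?sqr_ge0.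
Qed.

Let r2_ge0 (x t : R) : 0 <= x ^+ 2 + t ^+ 2.
Proof. by rewrite addr_ge0 ?sqr_ge0. Qed.

Let r2_eq0 (x t : R) : ~~ ((x != 0) || (t != 0)) -> x = 0 /\ t = 0.
Proof. by rewrite negb_or !negbK => /andP[/eqP -> /eqP ->]. Qed.

(** With r the Euclidean norm of (x, t) and k = x s + t c, the difference times r is (1 + c^2) r (r
    - k) + (2 r (r - k) - (t - c r)^2). The last bracket is nonnegative because 2 r (r - k) is the
    squared distance from (x, t) to r (s, c). *)
Lemma pnorm_ge (x t s c : R) : s ^+ 2 + c ^+ 2 = 1 ->
  x * (s * (3 + c ^+ 2)) + t * (c * (1 + c ^+ 2)) <= pnorm x t.
Proof.
move=> sc; rewrite /pnorm; have [h|/r2_eq0[-> ->]] := boolP ((x != 0) || (t != 0)); last first.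
  by rewrite !mul0r expr0n/= !mulr0 !addr0 mul0r.
have r0 := r2_gt0 h; set r := Num.sqrt _.
have rr : r ^+ 2 = x ^+ 2 + t ^+ 2 by rewrite sqr_sqrtr// ltW.
have r00 : 0 < r by rewrite sqrtr_gt0.
rewrite ler_pdivlMr//.
pose k := x * s + t * c.
have d : (t - c * r) ^+ 2 <= 2 * (r * (r - k)).
  rewrite -subr_ge0 (_ : _ - _ = (x - s * r) ^+ 2 + (r ^+ 2 - (x ^+ 2 + t ^+ 2)) +
    r ^+ 2 * (1 - (s ^+ 2 + c ^+ 2))); last by rewrite /k; ring.
  by rewrite sc rr !subrr mulr0 !addr0 sqr_ge0.
have rk : 0 <= r * (r - k) by have := sqr_ge0 (t - c * r); lra.
have c2 := sqr_ge0 c.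
rewrite -subr_ge0 (_ : _ - _ = (1 + c ^+ 2) * (r * (r - k)) +
  (2 * (r * (r - k)) - (t - c * r) ^+ 2)).
  by rewrite addr_ge0 ?subr_ge0// mulr_ge0// addr_ge0.
have -> : 3 * x ^+ 2 + 2 * t ^+ 2 = 3 * r ^+ 2 - t ^+ 2 by rewrite rr; ring.
by rewrite /k; ring.
Qed.

Lemma pnorm_attained (x t : R) : exists s c : R, s ^+ 2 + c ^+ 2 = 1 /\
  pnorm x t = x * (s * (3 + c ^+ 2)) + t * (c * (1 + c ^+ 2)).
Proof.
have [h|/r2_eq0[-> ->]] := boolP ((x != 0) || (t != 0)); last first.
  exists 1, 0; split; first by rewrite expr1n expr0n addr0.
  by rewrite /pnorm expr0n/= !mulr0 !mul0r addr0 mul0r.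
have r0 := r2_gt0 h; rewrite /pnorm; set r := Num.sqrt _.
have rr : r ^+ 2 = x ^+ 2 + t ^+ 2 by rewrite sqr_sqrtr// ltW.
have r00 : 0 < r by rewrite sqrtr_gt0.
have rn : r != 0 by rewrite gt_eqF.
exists (x / r), (t / r); split.
  by rewrite !expr_div_n -mulrDl -rr divff// expf_neq0.
apply: (mulIf (expf_neq0 3 rn)).
have -> : (3 * x ^+ 2 + 2 * t ^+ 2) / r * r ^+ 3 =
   (3 * x ^+ 2 + 2 * t ^+ 2) * r ^+ 2 by field.
have -> : (x * (x / r * (3 + (t / r) ^+ 2)) + t * (t / r * (1 + (t / r) ^+ 2))) * r ^+ 3
  = x ^+ 2 * (3 * r ^+ 2 + t ^+ 2) + t ^+ 2 * (r ^+ 2 + t ^+ 2) by field.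
by rewrite rr; ring.
Qed.

Lemma pnorm_circle (s c : R) : s ^+ 2 + c ^+ 2 = 1 -> pnorm s c = 3 - c ^+ 2.
Proof.
move=> sc; rewrite /pnorm sc sqrtr1 divr1.
by transitivity (3 * (s ^+ 2 + c ^+ 2) - c ^+ 2); [ring|rewrite sc mulr1].
Qed.

Lemma pnorm0 : pnorm 0 0 = 0.
Proof. by rewrite /pnorm expr0n/= !mulr0 addr0 mul0r. Qed.

Lemma pnormD (x t x' t' : R) : pnorm (x + x') (t + t') <= pnorm x t + pnorm x' t'.
Proof.
have [s [c [sc ->]]] := pnorm_attained (x + x') (t + t').
have := pnorm_ge x t sc; have := pnorm_ge x' t' sc; lra.
Qed.

Lemma pnormZ (a x t : R) : pnorm (a * x) (a * t) = `|a| * pnorm x t.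
Proof.
have [->|a0] := eqVneq a 0; first by rewrite !mul0r normr0 mul0r pnorm0.
rewrite /pnorm !exprMn -mulrDr sqrtrM ?sqr_ge0// sqrtr_sqr.
rewrite mulrCA [2 * _]mulrCA -mulrDr -[a ^+ 2](real_normK (num_real a)).
have [->|h] := eqVneq (Num.sqrt (x ^+ 2 + t ^+ 2)) 0.
  by rewrite mulr0 !invr0 !mulr0.
by field; rewrite h normr_eq0.
Qed.

Lemma pnorm_norm (x t : R) : pnorm `|x| `|t| = pnorm x t.
Proof. by rewrite /pnorm !real_normK ?num_real. Qed.

Let pnormE (x t : R) : let r := Num.sqrt (x ^+ 2 + t ^+ 2) in
  pnorm x t * r = 2 * r ^+ 2 + x ^+ 2.
Proof.
move=> r; rewrite sqr_sqrtr// /pnorm -/r.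
have [h|/r2_eq0[-> ->]] := boolP ((x != 0) || (t != 0)).
  by rewrite divfK ?gt_eqF ?sqrtr_gt0 ?r2_gt0//; ring.
by rewrite expr0n/= !mulr0 addr0 !mul0r mulr0 addr0.
Qed.

Lemma pnorm_lower (x t : R) : 2 * Num.sqrt (x ^+ 2 + t ^+ 2) <= pnorm x t.
Proof.
have /= := pnormE x t; set r := Num.sqrt _ => E.
have [r0|] := ltP 0 r; first by rewrite -(ler_pM2r r0) E; have := sqr_ge0 x; lra.
move=> r0; have rE : r = 0 by apply/eqP; rewrite eq_le r0 sqrtr_ge0.
by rewrite /pnorm -/r rE invr0 !mulr0.
Qed.

Lemma pnorm_upper (x t : R) : pnorm x t <= 3 * Num.sqrt (x ^+ 2 + t ^+ 2).
Proof.
have /= := pnormE x t; set r := Num.sqrt _ => E.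
have rr : r ^+ 2 = x ^+ 2 + t ^+ 2 by rewrite sqr_sqrtr.
have [r0|] := ltP 0 r.
  by rewrite -(ler_pM2r r0) E; have := sqr_ge0 t; lra.
move=> r0; have rE : r = 0 by apply/eqP; rewrite eq_le r0 sqrtr_ge0.
by rewrite /pnorm -/r rE invr0 !mulr0.
Qed.

Let norm2_le_sum (x t : R) : Num.sqrt (x ^+ 2 + t ^+ 2) <= `|x| + `|t|.
Proof.
rewrite -[leRHS]ger0_norm ?addr_ge0// -sqrtr_sqr ler_wsqrtr//.
rewrite sqrrD !real_normK ?num_real//.
by have := mulr_ge0 (normr_ge0 x) (normr_ge0 t); lra.
Qed.

Lemma pnorm_lip (x t x' t' : R) :
  `|pnorm x t - pnorm x' t'| <= 3 * (`|x - x'| + `|t - t'|).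
Proof.
have bd y z : pnorm y z <= 3 * (`|y| + `|z|).
  by rewrite (le_trans (pnorm_upper y z))// ler_wpM2l ?norm2_le_sum.
have := pnormD (x - x') (t - t') x' t'; have := pnormD (x' - x) (t' - t) x t.
rewrite !subrK; have := bd (x - x') (t - t'); have := bd (x' - x) (t' - t).
rewrite [`|x' - x|]distrC [`|t' - t|]distrC ler_norml => *.
by apply/andP; split; lra.
Qed.

End planar_norms.

Section planar_dual.
Variable R : realType.
Local Notation pnorm := (@pnorm R).

Definition pdual (p q : R) : R :=
  sup [set z.1 * p + z.2 * q | z in [set z : R * R | pnorm z.1 z.2 <= 1]].

Let le_radius (x t : R) : `|x| <= Num.sqrt (x ^+ 2 + t ^+ 2).
Proof. by rewrite -sqrtr_sqr ler_wsqrtr// lerDl sqr_ge0. Qed.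

Let pnorm_coord (x t : R) : `|x| <= pnorm x t /\ `|t| <= pnorm x t.
Proof.
have := pnorm_lower x t; have := le_radius x t; have := le_radius t x.
by rewrite [t ^+ 2 + _]addrC; have := sqrtr_ge0 (x ^+ 2 + t ^+ 2); split; lra.
Qed.

Let pdual_bound (x t p q : R) : pnorm x t <= 1 -> x * p + t * q <= `|p| + `|q|.
Proof.
have [hx ht] := pnorm_coord x t => h.
rewrite (le_trans (ler_norm _))// (le_trans (ler_normD _ _))// !normrM lerD//.
  by rewrite ler_piMl// (le_trans hx).
by rewrite ler_piMl// (le_trans ht).
Qed.

Let pdual_has_sup (p q : R) :
  has_sup [set z.1 * p + z.2 * q | z in [set z : R * R | pnorm z.1 z.2 <= 1]].
Proof.
split; first by exists (0 * p + 0 * q), (0, 0) => //=; rewrite pnorm0.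
by exists (`|p| + `|q|) => _ [[x t] /= xt <-]; exact: pdual_bound.
Qed.

Lemma pdual_ub (x t p q : R) : pnorm x t <= 1 -> x * p + t * q <= pdual p q.
Proof.
by move=> xt; apply: (sup_upper_bound (pdual_has_sup p q)); exists (x, t).
Qed.

Lemma pdual_le (p q a : R) :
  (forall x t, pnorm x t <= 1 -> x * p + t * q <= a) -> pdual p q <= a.
Proof.
move=> h; apply: ge_sup; first by case: (pdual_has_sup p q).
by move=> _ [[x t] /= xt <-]; exact: h.
Qed.

Lemma pdual_ge0 (p q : R) : 0 <= pdual p q.
Proof.
by have := @pdual_ub 0 0 p q; rewrite pnorm0 !mul0r addr0; apply; rewrite ler01.
Qed.

Lemma pdual_norm (p q : R) : pdual `|p| `|q| = pdual p q.
Proof.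
have flip (p' q' x t : R) : pnorm x t <= 1 -> x * p' + t * q' <= pdual `|p'| `|q'|.
  move=> xt; apply: (@le_trans _ _ (`|x| * `|p'| + `|t| * `|q'|)).
    by rewrite -!normrM lerD// ler_norm.
  by apply: pdual_ub; rewrite pnorm_norm.
apply/le_anti/andP; split; apply: pdual_le => x t xt; last exact: flip.
pose sg (a : R) : R := if 0 <= a then 1 else -1.
have sgn a : `|a| = sg a * a.
  by rewrite /sg; case: (ger0P a) => _; rewrite ?mul1r ?mulN1r.
have sgx a y : `|y * sg a| = `|y|.
  by rewrite normrM /sg; case: ifP => _; rewrite ?normrN normr1 mulr1.
rewrite (sgn p) (sgn q) !mulrA; apply: pdual_ub.
by rewrite -pnorm_norm !sgx pnorm_norm.
Qed.

Lemma pdualZ (a p q : R) : pdual (a * p) (a * q) = `|a| * pdual p q.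
Proof.
have sub b p' q' : pdual (b * p') (b * q') <= `|b| * pdual p' q'.
  apply: pdual_le => x t xt.
  rewrite [x * _]mulrCA [t * _]mulrCA -mulrDr.
  apply: (@le_trans _ _ (`|b| * `|x * p' + t * q'|)).
    by rewrite -normrM ler_norm.
  rewrite ler_wpM2l// ler_norml; apply/andP; split; last exact: pdual_ub.
  rewrite lerNl opprD -!mulNr; apply: pdual_ub.
  by rewrite -pnorm_norm !normrN pnorm_norm.
have [->|a0] := eqVneq a 0.
  apply/le_anti; rewrite (le_trans (sub _ _ _))//= normr0 mul0r pdual_ge0//.
apply/le_anti; rewrite sub/=.
have := sub a^-1 (a * p) (a * q); rewrite !mulKf// normfV.
by rewrite ler_pdivlMl ?normr_gt0.
Qed.

Lemma pdual_lip (p q p' q' : R) :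
  `|pdual p q - pdual p' q'| <= 1 * (`|p - p'| + `|q - q'|).
Proof.
have half a b a' b' : pdual a b <= pdual a' b' + (`|a - a'| + `|b - b'|).
  apply: pdual_le => x t xt.
  have -> : x * a + t * b = x * a' + t * b' + (x * (a - a') + t * (b - b')) by ring.
  by rewrite lerD// ?pdual_ub// pdual_bound.
have := half p q p' q'; have := half p' q' p q.
rewrite [`|p' - p|]distrC [`|q' - q|]distrC mul1r ler_norml => *.
by apply/andP; split; lra.
Qed.

(** Upper bound by [pnorm_ge]; it is attained at (s, c) / (3 - c^2), normalised by [pnorm_circle].
    That point is also a subgradient of [pdual] there, the source of q = c / (3 - c^2). *)
Lemma pdual_unit (s c : R) : s ^+ 2 + c ^+ 2 = 1 ->
  pdual (s * (3 + c ^+ 2)) (c * (1 + c ^+ 2)) = 1 /\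
  pnorm (s / (3 - c ^+ 2)) (c / (3 - c ^+ 2)) = 1.
Proof.
move=> sc; have c1 : c ^+ 2 <= 1 by rewrite -sc lerDr sqr_ge0.
have d0 : 0 < 3 - c ^+ 2 by lra.
have n1 : pnorm (s / (3 - c ^+ 2)) (c / (3 - c ^+ 2)) = 1.
  rewrite ![_ / (3 - c ^+ 2)]mulrC pnormZ pnorm_circle//.
  by rewrite ger0_norm ?invr_ge0 ?ltW// mulVf// gt_eqF.
split => //; apply/le_anti/andP; split.
  by apply: pdual_le => x t; apply: le_trans; exact: pnorm_ge.
have := @pdual_ub (s / (3 - c ^+ 2)) (c / (3 - c ^+ 2))
  (s * (3 + c ^+ 2)) (c * (1 + c ^+ 2)); rewrite n1 => /(_ (lexx _)).
apply: le_trans.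
rewrite -(ler_pM2r d0) le_eqVlt; apply/orP; left; apply/eqP.
have -> : (s / (3 - c ^+ 2) * (s * (3 + c ^+ 2)) +
  c / (3 - c ^+ 2) * (c * (1 + c ^+ 2))) * (3 - c ^+ 2) =
  (s ^+ 2 + c ^+ 2) * (3 + c ^+ 2) - 2 * c ^+ 2 by field; rewrite gt_eqF.
by rewrite sc; ring.
Qed.

End planar_dual.

(** * The planar norm of X as a Gaussian average *)

Section primal_embedding.
Variable R : realType.

Let half (k : nat) : R := if (k < 2)%N then 2^-1 else 0.

Let half_series (h : nat -> R) :
  (fun n => \sum_(k < n) half k * h k) @ \oo --> 2^-1 * (h 0%N + h 1%N).
Proof.
rewrite -(cvg_shiftn 2) (_ : (fun n => _) = fun=> 2^-1 * (h 0%N + h 1%N)).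
  exact: cvg_cst.
apply/funext => n /=; rewrite addn2 !big_ord_recl big1 => [|i _].
  by rewrite addr0 mulrDr.
by rewrite /half/= mul0r.
Qed.

Lemma pnorm_embedding :
  exists (E0 : L1_unit_interval R) (E : nat -> L1_unit_interval R),
    forall x n (v : nat -> R), `|x *: E0 + \sum_(i < n) v i *: E i| =
      pnorm x (Num.sqrt (\sum_(i < n) v i ^+ 2)).
Proof.
have g0 := gconst_gt0 R.
pose r (u : R) := Num.sqrt (1 + u ^+ 2).
have r0 u : 0 < r u by rewrite sqrtr_gt0 ltr_pwDl ?sqr_ge0.
have rr u : r u ^+ 2 = 1 + u ^+ 2 by rewrite sqr_sqrtr// addr_ge0 ?sqr_ge0.
pose s u := (r u)^-1; pose c u := u / r u.
have sc u : s u ^+ 2 + c u ^+ 2 = 1.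
  by rewrite /s /c exprVn expr_div_n rr -[X in X + _]mul1r -mulrDl divff// -rr
    expf_neq0 ?gt_eqF.
pose q u := c u * (1 + c u ^+ 2).
(* The supporting linear form at (1, u), evaluated there: the first term is the intercept and q u
   the slope. *)
have E u : pnorm 1 u = s u * (3 + c u ^+ 2) + u * q u.
  have rn : r u != 0 by rewrite gt_eqF.
  have -> : pnorm 1 u = pnorm (r u * s u) (r u * c u).
    by rewrite /s /c divff// [r u * _]mulrC divfK.
  rewrite pnormZ pnorm_circle// gtr0_norm//.
  have es : s u = r u * s u ^+ 2 by rewrite /s; field.
  have eu : u = r u * c u by rewrite /c mulrC divfK.
  transitivity (r u * s u ^+ 2 * (3 + c u ^+ 2) + r u * c u * q u).
    have -> : s u ^+ 2 = 1 - c u ^+ 2 by rewrite -(sc u) addrK.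
    by rewrite /q; ring.
  by rewrite -es -eu.
pose tau u := 2^-1 * q u.
(* Halving q makes the two weights sum to 1, which [M] compensates. The intercept s (3 + c^2) is at
   most 4/u, and 3 is the Lipschitz constant of [pnorm]. As the expansion is finite, any d in ]0, 1[
   could serve as exponential moment. *)
apply: (@gamma_embedding R 1 (2 / gconst R) 4 3 2^-1 _ half q tau).
- exact: ltr01.
- by move=> k; rewrite /half; case: ifP.
- have := @half_series (fun=> 1).
  rewrite (_ : 2^-1 * (1 + 1) = 1 :> R); last by field.
  by under [X in X @ _ --> _]eq_fun do under eq_bigr do rewrite mulr1.
- by rewrite invr_gt0 ltr0n/= invf_lt1 ?ltr1n.
- exact: (@half_series (fun k => Num.sqrt (1 / (1 - 2^-1)) * (1 / (1 - 2^-1)) ^+ k)).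
- move=> u u0; have cE : 1 / (1 + u ^- 2) = c u ^+ 2.
    rewrite /c expr_div_n rr; field.
    by rewrite !gt_eqF ?ltr_pwDl ?sqr_ge0 ?exprn_gt0// addrC ltr_pwDl ?sqr_ge0.
  have c0 : 0 <= c u by rewrite divr_ge0// ltW.
  rewrite cE sqrtr_sqr ger0_norm//.
  have := @half_series (fun k => c u * (c u ^+ 2) ^+ k).
  by rewrite expr0 expr1 -mulrDr.
- by rewrite divr_ge0// ltW.
- by move=> u u0; rewrite /tau divfK ?gt_eqF// mulVKf.
- move=> u v u0 v0; rewrite E.
  by have := pnorm_ge 1 v (sc u); rewrite mul1r -/(q u); lra.
- move=> u u0; rewrite E addrK.
  have s0 : 0 <= s u by rewrite invr_ge0 ltW.
  rewrite ger0_norm; last by rewrite mulr_ge0// addr_ge0 ?sqr_ge0.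
  have c1 : c u ^+ 2 <= 1 by rewrite -(sc u) lerDr sqr_ge0.
  have su : s u <= u^-1.
    rewrite /s lef_pV2 ?posrE// -[leLHS](gtr0_norm u0) -sqrtr_sqr.
    by rewrite ler_wsqrtr// lerDr.
  by rewrite mulrC ler_pM ?addr_ge0 ?sqr_ge0//; lra.
- move=> x t x0; have ax : `|x| != 0 by rewrite normr_eq0.
  have := pnormZ `|x| 1 (`|t| / `|x|); rewrite mulr1 normr_id => <-.
  by rewrite [`|x| * _]mulrC divfK// pnorm_norm.
- exact: pnorm_lip.
Qed.

End primal_embedding.

(** * The dual planar norm as a Gaussian average *)

Section dual_embedding.
Variable R : realType.

Let gt0E (a b : R) : 0 < a -> 0 < b -> a ^+ 2 = b ^+ 2 -> a = b.
Proof.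
by move=> a0 b0 /eqP; rewrite eqrXn2 ?ltW// => /eqP.
Qed.

(* The parameter X = c^2 / (1 + c^2) of the point of the dual sphere
   proportional to (1, u): c (1 + c^2) = u s (3 + c^2), and 64 + u^-2 = 1 / zeta X. *)
Let param (u : R) : 0 < u -> exists X : R,
  0 < X < 2^-1 /\ (1 - 2 * X) * (3 - 2 * X) ^+ 2 * u ^+ 2 = X.
Proof.
move=> u0; have u2 : 0 < u ^+ 2 by rewrite exprn_gt0.
pose p : {poly R} := 'X - (u ^+ 2)%:P * (1%:P - 2%:P * 'X) * (3%:P - 2%:P * 'X) ^+ 2.
have pE x : p.[x] = x - u ^+ 2 * (1 - 2 * x) * (3 - 2 * x) ^+ 2.
  by rewrite /p !hornerE.
have p0 : p.[0] = - (9 * u ^+ 2) by rewrite pE; ring.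
have ph : p.[2^-1] = 2^-1 by rewrite pE; field.
have h0 : 0 <= 2^-1 :> R by rewrite invr_ge0.
have [|X /andP[X0 X1]] := @poly_ivt R p 0 2^-1 h0.
  by rewrite p0 ph h0 andbT; lra.
rewrite rootE => /eqP pX; exists X; split.
  rewrite !lt_neqAle X0 X1 !andbT; apply/andP; split; apply/eqP => e.
    by move: pX; rewrite -e p0; lra.
  by move: pX; rewrite e ph; lra.
by move: pX; rewrite pE; lra.
Qed.

Let param_pos (x : R) : 0 < x -> x < 2^-1 ->
  [/\ 0 < 1 - x, 0 < 9 - 2 * x, 0 < 1 + 2 * x & 0 < 3 - 4 * x] /\
  [/\ 0 < 1 - 2 * x, 0 < 3 - 2 * x, 0 < 3 * (1 - x) - x & 0 <= x < 3 / 4].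
Proof. by move=> x0 x1; split; split; lra. Qed.

Lemma pdual_embedding :
  exists (E0 : L1_unit_interval R) (E : nat -> L1_unit_interval R),
    forall x n (v : nat -> R), `|x *: E0 + \sum_(i < n) v i *: E i| =
      pdual x (Num.sqrt (\sum_(i < n) v i ^+ 2)).
Proof.
have g0 := gconst_gt0 R.
have ex_X (u : R) : exists X : R, 0 < u ->
    0 < X < 2^-1 /\ (1 - 2 * X) * (3 - 2 * X) ^+ 2 * u ^+ 2 = X.
  by have [/param[X XP]|u0] := ltP 0 u; [exists X|exists 0].
have [X XP] := choice ex_X.
have [d [d0 dE]] := dual_expansion R.
(* Rescales from powers of zeta to powers of 64 / (64 + s); the factor 4 normalises the total
   mass. *)
pose w k := d k / 64 ^+ k / 4.
have series_w (x y : R) : 0 <= x < 3/4 -> 64 * zeta x = y ->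
    (fun n => \sum_(k < n) w k * (Num.sqrt y * y ^+ k)) @ \oo -->
    Num.sqrt y / 4 * ((1 + 2 * x) * (Num.sqrt ((9 - 2 * x) * (1 - x)) / (3 - 4 * x))).
  move=> x01 <-; have -> : (fun n => \sum_(k < n) w k *
      (Num.sqrt (64 * zeta x) * (64 * zeta x) ^+ k)) =
      fun n => Num.sqrt (64 * zeta x) / 4 * \sum_(k < n) d k * zeta x ^+ k.
    apply/funext => n; rewrite mulr_sumr; apply: eq_bigr => k _.
    by rewrite /w exprMn; field; exact: expf_neq0.
  exact: cvgM (cvg_cst _) (dE x x01).
pose c (u : R) := Num.sqrt (X u / (1 - X u)).
pose s (u : R) := Num.sqrt ((1 - 2 * X u) / (1 - X u)).
pose q (u : R) := c u / (3 - c u ^+ 2).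
have sc_facts (u : R) : 0 < u -> [/\ 0 < c u, 0 < s u, c u ^+ 2 = X u / (1 - X u),
    s u ^+ 2 + c u ^+ 2 = 1 & c u * (1 + c u ^+ 2) = u * (s u * (3 + c u ^+ 2))].
  move=> u0; have [/andP[X0 X1] XE] := XP u u0.
  have [[Y0 _ _ _] [Z0 _ _ _]] := param_pos X0 X1.
  have c2 : c u ^+ 2 = X u / (1 - X u) by rewrite sqr_sqrtr// divr_ge0// ltW.
  have s2 : s u ^+ 2 = (1 - 2 * X u) / (1 - X u) by rewrite sqr_sqrtr// divr_ge0// ltW.
  have c0 : 0 < c u by rewrite sqrtr_gt0 divr_gt0.
  have s0 : 0 < s u by rewrite sqrtr_gt0 divr_gt0.
  split => //; first by rewrite s2 c2; field; rewrite gt_eqF.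
  apply: gt0E.
  - by rewrite mulr_gt0// addr_gt0// exprn_gt0.
  - by rewrite !mulr_gt0// addr_gt0// exprn_gt0.
  rewrite !exprMn s2 c2 -{1}XE; field; rewrite gt_eqF//.
(* By the choice of X, the multiple of (1, u) by s (3 + c^2) is a point of the dual unit sphere;
   homogeneity then gives the value at (1, u), again as intercept plus slope. *)
have pdual1 (u : R) : 0 < u -> pdual 1 u = s u / (3 - c u ^+ 2) + u * q u.
  move=> u0; have [c0 s0 c2 sc cq] := sc_facts u u0.
  have [/andP[X0 X1] _] := XP u u0.
  have c1 : c u ^+ 2 <= 1 by rewrite -sc lerDr sqr_ge0.
  have D0 : 0 < 3 - c u ^+ 2 by lra.
  pose P := s u * (3 + c u ^+ 2).
  have P0 : 0 < P by rewrite mulr_gt0// addr_gt0// exprn_gt0.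
  have := pdual_unit sc; rewrite cq -/P => -[PQ1 _].
  have Pn : P != 0 by rewrite gt_eqF.
  apply: (mulfI Pn).
  rewrite -[X in X * pdual _ _](gtr0_norm P0) -pdualZ mulr1 [P * u]mulrC PQ1.
  have -> : P * (s u / (3 - c u ^+ 2) + u * q u) =
      (s u * P + c u * (u * P)) / (3 - c u ^+ 2) by rewrite /q; field; rewrite gt_eqF.
  rewrite {2}/P -cq /P.
  have -> : s u * (s u * (3 + c u ^+ 2)) + c u * (c u * (1 + c u ^+ 2)) =
      (s u ^+ 2 + c u ^+ 2) * (3 + c u ^+ 2) - 2 * c u ^+ 2 by ring.
  have -> : (s u ^+ 2 + c u ^+ 2) * (3 + c u ^+ 2) - 2 * c u ^+ 2 = 3 - c u ^+ 2.
    by rewrite sc; ring.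
  by rewrite divff// gt_eqF.
pose tau (u : R) := 2 * q u.
have z58 : zeta (5 / 8) = 40 / 2511 :> R by rewrite /zeta; field.
(* At X = 1/2, i.e. s = 0, the expansion says that the weights sum to 1; at
   X = 5/8, i.e. s < 0, it gives an exponential moment of xi^2. *)
have h58 : 0 <= (5 / 8 : R) < 3 / 4 by lra.
have h12 : 0 <= (2^-1 : R) < 3 / 4 by lra.
(* Here tau = 2 q, which [M] compensates. The value of d is such that 64 / (64 - d) = 64
   zeta(5/8). *)
apply: (@gamma_embedding R 64 (2^-1 / gconst R) 1 1 (64 - (zeta (5/8))^-1) _ w q tau).
- by [].
- by move=> k; rewrite /w !divr_ge0// exprn_ge0.
- have z12 : 64 * zeta 2^-1 = 1 :> R by rewrite /zeta; field.
  have := series_w _ _ h12 z12; rewrite sqrtr1.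
  have -> : (9 - 2 * 2^-1) * (1 - 2^-1) = 2 ^+ 2 :> R by field.
  rewrite sqrtr_sqr ger0_norm//.
  have -> : 1 / 4 * ((1 + 2 * 2^-1) * (2 / (3 - 4 / 2))) = 1 :> R by field.
  by under [X in X @ _ --> _]eq_fun do under eq_bigr do rewrite expr1n mulr1 mulr1.
- by rewrite z58; lra.
- by apply: (series_w _ _ h58); rewrite z58; field.
- move=> u u0; have [/andP[X0 X1] XE] := XP u u0.
  have [c0 s0 c2 sc cq] := sc_facts u u0.
  have [[Y0 A0 B0 C0] [Z0 D0 E0 XX]] := param_pos X0 X1.
  have u2 : u ^- 2 = (1 - 2 * X u) * (3 - 2 * X u) ^+ 2 / X u.
    by rewrite -[X in _ / X]XE; field; rewrite !gt_eqF.
  have zE : 64 * zeta (X u) = 64 / (64 + u ^- 2).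
    have AX : 0 < 64 + (1 - 2 * X u) * (3 - 2 * X u) ^+ 2 / X u.
      by rewrite addr_gt0// divr_gt0// mulr_gt0// exprn_gt0.
    have AE : 64 + (1 - 2 * X u) * (3 - 2 * X u) ^+ 2 / X u =
        (1 + 2 * X u) ^+ 2 * (9 - 2 * X u) / X u by field; rewrite gt_eqF.
    rewrite u2 AE /zeta; field; rewrite !gt_eqF//.
  rewrite -zE; have := series_w _ _ XX erefl.
  have z0 : 0 < zeta (X u) by rewrite divr_gt0// mulr_gt0// exprn_gt0.
  have -> // : Num.sqrt (64 * zeta (X u)) / 4 * ((1 + 2 * X u) *
      (Num.sqrt ((9 - 2 * X u) * (1 - X u)) / (3 - 4 * X u))) = tau u.
  have d0' : 0 < 3 - c u ^+ 2.
    by rewrite c2 (_ : _ - _ = (3 - 4 * X u) / (1 - X u)) ?divr_gt0//; field; rewrite gt_eqF.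
  apply: gt0E.
  + apply: mulr_gt0; first by rewrite divr_gt0// sqrtr_gt0 mulr_gt0.
    by apply: mulr_gt0 => //; rewrite divr_gt0// sqrtr_gt0 mulr_gt0.
  + by apply: mulr_gt0 => //; exact: divr_gt0.
  have e1 : Num.sqrt (64 * zeta (X u)) ^+ 2 = 64 * zeta (X u).
    by rewrite sqr_sqrtr// ltW// mulr_gt0.
  have e2 : Num.sqrt ((9 - 2 * X u) * (1 - X u)) ^+ 2 = (9 - 2 * X u) * (1 - X u).
    by rewrite sqr_sqrtr// ltW// mulr_gt0.
  rewrite /tau /q !exprMn e1 e2 c2 /zeta; field.
  by rewrite !gt_eqF.
- by rewrite divr_ge0 ?invr_ge0// ltW.
- by move=> u u0; rewrite /tau divfK ?gt_eqF// mulKf.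
- move=> u v u0 v0; rewrite pdual1//.
  have [c0 s0 c2 sc cq] := sc_facts u u0.
  have [_ n1] := pdual_unit sc.
  have := @pdual_ub R (s u / (3 - c u ^+ 2)) (q u) 1 v; rewrite /q n1 => /(_ (lexx _)).
  by rewrite mulr1; lra.
- move=> u u0; rewrite pdual1// addrK.
  have [c0 s0 c2 sc cq] := sc_facts u u0.
  have c1 : c u ^+ 2 <= 1 by rewrite -sc lerDr sqr_ge0.
  have D0 : 0 < 3 - c u ^+ 2 by lra.
  rewrite ger0_norm; last by rewrite divr_ge0// ltW.
  rewrite ler_pdivrMr// mul1r mulrC ler_pdivlMr//.
  have us : 0 < u * s u by rewrite mulr_gt0.
  have cc : c u <= 1 by rewrite -(@ler_pXn2r _ 2)// ?nnegrE ?expr1n// ltW.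
  nra.
- move=> x t x0; have ax : `|x| != 0 by rewrite normr_eq0.
  have := pdualZ `|x| 1 (`|t| / `|x|); rewrite mulr1 normr_id => <-.
  by rewrite [`|x| * _]mulrC divfK// pdual_norm.
- exact: pdual_lip.
Qed.

End dual_embedding.

(** * The space l2 *)

Section l2.
Variable R : realType.

Definition square_summable : {pred (nat -> R^o)} :=
  mem [set v : nat -> R^o | exists K, forall n, \sum_(i < n) v i ^+ 2 <= K].

Record l2 := L2 { l2_fun :> nat -> R^o ; _ : l2_fun \in square_summable }.

HB.instance Definition _ := [isSub for l2_fun].
HB.instance Definition _ := [Choice of l2 by <:].

Lemma square_summable_submod_closed : submod_closed square_summable.
Proof.
split=> [|a f g].
  by rewrite inE; exists 0 => n; rewrite big1// => i _; rewrite expr0n.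
rewrite !inE => -[K fK] [L gL]; exists (2 * (a ^+ 2 * K + L)) => n.
apply: (@le_trans _ _ (\sum_(i < n) 2 * (a ^+ 2 * f i ^+ 2 + g i ^+ 2))).
  apply: ler_sum => i _; pose x : R := f i; pose y : R := g i.
  rewrite -[(a *: f + g) i]/(a * x + y) -/x -/y.
  by have := sqr_ge0 (a * x - y); lra.
rewrite -mulr_sumr ler_wpM2l// big_split/= -mulr_sumr.
by apply: lerD; [apply: ler_wpM2l; [exact: sqr_ge0|exact: fK]|exact: gL].
Qed.

HB.instance Definition _ := GRing.isSubmodClosed.Build R (nat -> R^o)
  square_summable square_summable_submod_closed.

HB.instance Definition _ := [SubChoice_isSubLmodule of l2 by <:].

Implicit Types v w z : l2.

Lemma l2_bound v : exists K, forall n, \sum_(i < n) v i ^+ 2 <= K.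
Proof. by case: v => f /=; rewrite inE. Qed.

Lemma l2P v w : (forall i, v i = w i) -> v = w.
Proof. by move=> vw; apply/val_inj/funext. Qed.

Let sq_cvg v : cvgn (fun n => \sum_(i < n) v i ^+ 2 : R).
Proof.
apply: nondecreasing_is_cvgn.
  by apply/nondecreasing_seqP => n; rewrite big_ord_recr/= lerDl sqr_ge0.
by have [K vK] := l2_bound v; exists K => _ [n _ <-].
Qed.

Definition l2dot v w : R := limn (fun n => \sum_(i < n) v i * w i).

Lemma l2dot_cvg v w : (fun n => \sum_(i < n) v i * w i : R) @ \oo --> l2dot v w.
Proof.
suff : cvgn (fun n => \sum_(i < n) v i * w i : R) by [].
(* Polarization reduces convergence to that of sums of squares. *)
have -> : (fun n => \sum_(i < n) v i * w i : R) = fun n =>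
    2^-1 * (\sum_(i < n) (v + w) i ^+ 2 - \sum_(i < n) v i ^+ 2 - \sum_(i < n) w i ^+ 2).
  apply/funext => n; rewrite -!sumrB mulr_sumr; apply: eq_bigr => i _.
  by rewrite -[(v + w) i]/(v i + w i); field.
by apply: is_cvgM; [exact: is_cvg_cst|apply: is_cvgB; [apply: is_cvgB|]].
Qed.

Lemma l2dot_lim v w l : (fun n => \sum_(i < n) v i * w i : R) @ \oo --> l ->
  l2dot v w = l.
Proof. exact: cvg_lim. Qed.

Lemma l2dotC v w : l2dot v w = l2dot w v.
Proof.
apply: l2dot_lim; have := @l2dot_cvg w v.
by under eq_fun do under eq_bigr do rewrite mulrC.
Qed.

Lemma l2dotDl v w z : l2dot (v + w) z = l2dot v z + l2dot w z.
Proof.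
apply: l2dot_lim.
have -> : (fun n => \sum_(i < n) (v + w) i * z i : R) =
    (fun n => \sum_(i < n) v i * z i : R) \+ (fun n => \sum_(i < n) w i * z i : R).
  by apply/funext => n; rewrite /= -big_split/=; apply: eq_bigr => i _; rewrite -mulrDl.
by apply: cvgD; exact: l2dot_cvg.
Qed.

Lemma l2dotZl a v w : l2dot (a *: v) w = a * l2dot v w.
Proof.
apply: l2dot_lim.
have -> : (fun n => \sum_(i < n) (a *: v) i * w i : R) =
    fun n => a * \sum_(i < n) v i * w i.
  by apply/funext => n; rewrite mulr_sumr; apply: eq_bigr => i _; rewrite mulrA.
by apply: cvgM; [exact: cvg_cst|exact: l2dot_cvg].
Qed.

Lemma l2dotDr v w z : l2dot z (v + w) = l2dot z v + l2dot z w.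
Proof. by rewrite l2dotC l2dotDl !(l2dotC z). Qed.

Lemma l2dotZr a v w : l2dot w (a *: v) = a * l2dot w v.
Proof. by rewrite l2dotC l2dotZl (l2dotC w). Qed.

Lemma l2dot_sum_le v n : \sum_(i < n) v i ^+ 2 <= l2dot v v.
Proof.
have nd : nondecreasing_seq (fun n => \sum_(i < n) v i * v i : R).
  by apply/nondecreasing_seqP => m; rewrite big_ord_recr/= lerDl -expr2 sqr_ge0.
have := nondecreasing_cvgn_le nd (cvgP _ (@l2dot_cvg v v)) n.
by under [X in X <= _ -> _]eq_bigr do rewrite -expr2.
Qed.

Lemma l2dot_ge0 v : 0 <= l2dot v v.
Proof. by have := l2dot_sum_le v 0; rewrite big_ord0. Qed.

Lemma l2dot_le v K : (forall n, \sum_(i < n) v i ^+ 2 <= K) -> l2dot v v <= K.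
Proof.
move=> vK; apply: limr_le; first exact: cvgP (@l2dot_cvg v v).
by apply: nearW => n; under eq_bigr do rewrite -expr2; exact: vK.
Qed.

Definition l2norm v : R := Num.sqrt (l2dot v v).

Lemma l2norm_ge0 v : 0 <= l2norm v.
Proof. exact: sqrtr_ge0. Qed.

Lemma sqr_l2norm v : l2norm v ^+ 2 = l2dot v v.
Proof. by rewrite sqr_sqrtr ?l2dot_ge0. Qed.

Lemma l2_coord_le v i : `|v i| <= l2norm v.
Proof.
rewrite -sqrtr_sqr ler_wsqrtr// (le_trans _ (l2dot_sum_le v i.+1))//.
by rewrite big_ord_recr/= lerDr sumr_ge0// => j _; rewrite sqr_ge0.
Qed.

Lemma l2norm_eq0 v : l2norm v = 0 -> v = 0.
Proof.
move=> v0; apply: l2P => i; have := l2_coord_le v i.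
by rewrite v0 normr_le0 => /eqP.
Qed.

Lemma l2_cauchy_schwarz v w : `|l2dot v w| <= l2norm v * l2norm w.
Proof.
rewrite -sqrtrM ?l2dot_ge0// -sqrtr_sqr ler_wsqrtr//.
set A := l2dot v v; set B := l2dot w w; set C := l2dot v w.
have H a b : 0 <= a ^+ 2 * A + 2 * a * b * C + b ^+ 2 * B.
  have := l2dot_ge0 (a *: v + b *: w).
  rewrite !l2dotDl !l2dotDr !l2dotZl !l2dotZr (l2dotC w v) -/A -/B -/C; lra.
have A0 : 0 <= A by exact: l2dot_ge0.
have B0 : 0 <= B by exact: l2dot_ge0.
(* H1 and H2 add up to (A + B)(A B - C^2) >= 0; H3 covers A = B = 0. *)
have H1 := H B (- C); have H2 := H (- C) A; have H3 := H 1 (- C).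
rewrite leNgt; apply/negP => h.
have [AB|AB] := ltP 0 (A + B).
  have : (A + B) * (C ^+ 2 - A * B) <= 0 by lra.
  by rewrite pmulr_rle0// subr_le0 leNgt h.
have AE : A = 0 by lra.
have BE : B = 0 by lra.
by move: H3 h; rewrite AE BE; have := sqr_ge0 C; lra.
Qed.

Lemma l2normZ a v : l2norm (a *: v) = `|a| * l2norm v.
Proof.
rewrite /l2norm l2dotZl l2dotZr mulrA -expr2 sqrtrM ?sqr_ge0//.
by rewrite sqrtr_sqr.
Qed.

Lemma l2normD v w : l2norm (v + w) <= l2norm v + l2norm w.
Proof.
rewrite -[leRHS]ger0_norm ?addr_ge0 ?l2norm_ge0// -sqrtr_sqr ler_wsqrtr//.
rewrite sqrrD !sqr_l2norm l2dotDl !l2dotDr (l2dotC w v).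
have := le_trans (ler_norm _) (l2_cauchy_schwarz v w); lra.
Qed.

Lemma l2_mk (f : nat -> R) K : (forall n, \sum_(i < n) f i ^+ 2 <= K) ->
  exists2 v : l2, (forall i, v i = f i) & l2dot v v <= K.
Proof.
move=> fK; have fin : (f : nat -> R^o) \in square_summable by rewrite inE; exists K.
by exists (L2 fin) => //; exact: l2dot_le.
Qed.

End l2.

Section l2_complete.
Variable R : realType.
Implicit Types v w : l2 R.

Let real_complete (f : nat -> R) :
  (forall e, 0 < e -> exists N, forall m n, (N <= m)%N -> (N <= n)%N ->
     `|f m - f n| <= e) -> exists a : R, f @ \oo --> a.
Proof.
move=> fC; suff /cauchy_cvgP/cvg_ex : cauchy (f @ \oo) by [].
apply: cauchy_exP => e e0; have [N fN] := fC _ (divr_gt0 e0 (ltr0n R 2)).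
exists (f N); exists N => // n /= Nn; rewrite /ball/=.
by rewrite (le_lt_trans (fN _ _ _ _))// ltr_pdivrMr// ltr_pMr// ltr1n.
Qed.

Lemma l2_complete (u : nat -> l2 R) :
  (forall e, 0 < e -> exists N, forall m n, (N <= m)%N -> (N <= n)%N ->
     l2norm (u m - u n) <= e) ->
  exists v, forall e, 0 < e -> exists N, forall n, (N <= n)%N ->
     l2norm (u n - v) <= e.
Proof.
move=> uC.
have ex_f i : exists a : R, (fun n => u n i : R) @ \oo --> a.
  apply: real_complete => e /uC[N uN]; exists N => m n Nm Nn.
  by rewrite (le_trans _ (uN m n Nm Nn))// (le_trans _ (l2_coord_le _ i)).
have [f fE] := choice ex_f.
have sum_le e : 0 < e -> exists N, forall n, (N <= n)%N -> forall K,
    \sum_(i < K) (u n i - f i) ^+ 2 <= e ^+ 2.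
  move=> e0; have [N uN] := uC e e0; exists N => n Nn K.
  have : (fun m => \sum_(i < K) (u n i - u m i) ^+ 2 : R) @ \oo -->
      \sum_(i < K) (u n i - f i) ^+ 2.
    elim: K => [|K IH].
      by rewrite big_ord0; under eq_fun do rewrite big_ord0; exact: cvg_cst.
    rewrite big_ord_recr/=; under eq_fun do rewrite big_ord_recr/=.
    by apply: cvgD => //; apply: cvgM; (apply: cvgB; [exact: cvg_cst|exact: fE]).
  move=> /cvgr_to_le; apply; exists N => // m /= Nm.
  apply: (@le_trans _ _ (\sum_(i < K) (u n - u m) i ^+ 2)) => //.
  rewrite (le_trans (l2dot_sum_le _ _))// -sqr_l2norm lerXn2r ?nnegrE ?l2norm_ge0//.
    exact/ltW/e0.
  exact: uN.
have [N0 uN0] := sum_le 1 ltr01.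
(* Only the differences u n - f have controlled sums of squares, so the limit f is recovered in l2
   as u N0 - w. *)
have [w wE _] := @l2_mk R (fun i => u N0 i - f i) _ (uN0 N0 (leqnn _)).
exists (u N0 - w) => e e0; have [N uN] := sum_le e e0; exists N => n Nn.
rewrite -[leRHS]gtr0_norm// -sqrtr_sqr ler_wsqrtr//; apply: l2dot_le => K.
rewrite (le_trans _ (uN n Nn K))// ler_sum// => i _.
rewrite le_eqVlt; apply/orP; left; apply/eqP; congr (_ ^+ 2).
by rewrite -[LHS]/(u n i - (u N0 i - w i)) wE subKr.
Qed.

End l2_complete.

Section l2_tail.
Variable R : realType.
Implicit Types v w : l2 R.

Let tail_ex v : exists w, forall i, w i = v i.+1.
Proof.
have [|w wE _] := @l2_mk R (fun i => v i.+1) (l2dot v v); last by exists w.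
move=> n; rewrite (le_trans _ (l2dot_sum_le v n.+1))//.
by rewrite big_ord_recl lerDr sqr_ge0.
Qed.

Definition l2_tail v : l2 R := projT1 (cid (tail_ex v)).

Lemma l2_tailE v i : l2_tail v i = v i.+1.
Proof. by rewrite /l2_tail; case: cid. Qed.

Lemma l2_tail_is_linear : linear l2_tail.
Proof.
move=> a v w; apply: l2P => i.
by rewrite l2_tailE -[RHS]/(a * l2_tail v i + l2_tail w i) !l2_tailE.
Qed.

HB.instance Definition _ := GRing.isLinear.Build R (l2 R) (l2 R) *:%R l2_tail
  l2_tail_is_linear.

Lemma l2dot_tail v w : l2dot v w = v 0%N * w 0%N + l2dot (l2_tail v) (l2_tail w).
Proof.
apply: l2dot_lim; rewrite -cvg_shiftS.
have -> : [sequence \sum_(i < n.+1) v i * w i : R]_n =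
    fun n => v 0%N * w 0%N + \sum_(i < n) l2_tail v i * l2_tail w i.
  apply/funext => n /=; rewrite big_ord_recl; congr (_ + _).
  by apply: eq_bigr => i _; rewrite !l2_tailE.
by apply: cvgD; [exact: cvg_cst|exact: l2dot_cvg].
Qed.

Let fin_ex n (f : nat -> R) : exists w : l2 R, forall i, w i = if (i < n)%N then f i else 0.
Proof.
have [|w wE _] := @l2_mk R (fun i => if (i < n)%N then f i else 0)
  (\sum_(i < n) f i ^+ 2); last by exists w.
move=> m; rewrite (big_ord_widen_cond (maxn m n) xpredT (fun i : nat =>
  (if (i < n)%N then f i else 0) ^+ 2)) ?leq_maxl//.
rewrite [leRHS](big_ord_widen_cond (maxn m n) xpredT (fun i : nat => f i ^+ 2)) ?leq_maxr//.
rewrite [leRHS]big_mkcond [leLHS]big_mkcond; apply: ler_sum => i _ /=.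
by case: ifP => _; case: ifP => _; rewrite ?expr0n ?sqr_ge0.
Qed.

Definition l2_fin n (f : nat -> R) : l2 R := projT1 (cid (fin_ex n f)).

Lemma l2_finE n f i : l2_fin n f i = if (i < n)%N then f i else 0.
Proof. by rewrite /l2_fin; case: cid. Qed.

Lemma l2dot_fin n f w : l2dot (l2_fin n f) w = \sum_(i < n) f i * w i.
Proof.
apply: l2dot_lim; apply: cvg_near_cst; exists n => // m /= nm.
rewrite [RHS](big_ord_widen_cond m xpredT (fun i : nat => f i * w i))// [RHS]big_mkcond.
by apply: eq_bigr => i _; rewrite l2_finE/=; case: ifP; rewrite ?mul0r.
Qed.

Lemma l2dot_fin_fin n f : l2dot (l2_fin n f) (l2_fin n f) = \sum_(i < n) f i ^+ 2.
Proof.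
by rewrite l2dot_fin; apply: eq_bigr => i _; rewrite l2_finE ltn_ord expr2.
Qed.

Lemma l2_fin_cvg v e : 0 < e -> exists N, forall n, (N <= n)%N ->
  l2norm (v - l2_fin n v) <= e.
Proof.
move=> e0; have /cvgrPdist_le/(_ _ (exprn_gt0 2 e0))[N _ vN] := @l2dot_cvg R v v.
exists N => n /vN /=; rewrite ler_norml => /andP[_ ve].
rewrite -[leRHS]gtr0_norm// -sqrtr_sqr ler_wsqrtr//.
rewrite -scaleN1r !(l2dotDl, l2dotDr) !(l2dotZl, l2dotZr) (l2dotC v) !l2dot_fin.
under [X in _ + -1 * (-1 * X)]eq_bigr => i _ do rewrite l2_finE ltn_ord.
lra.
Qed.

End l2_tail.

(** * From Gaussian averages of finite sequences to all of l2 *)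

Section l2_embedding.
Variable R : realType.
Local Notation L := (L1_unit_interval R).

(** The maps [S n] are linear, and S m w - S n w is S m of a vector without coordinate 0 whose l2
    norm is small; the Lipschitz bound makes them Cauchy in L1. The limit J inherits linearity and,
    by continuity of N, the norm formula. *)
Lemma l2_embedding (N : R -> R -> R) (C : R) (E0 : L) (E : nat -> L) :
  (forall x n (v : nat -> R), `|x *: E0 + \sum_(i < n) v i *: E i| =
     N x (Num.sqrt (\sum_(i < n) v i ^+ 2))) ->
  N 0 0 = 0 ->
  (forall x t x' t', `|N x t - N x' t'| <= C * (`|x - x'| + `|t - t'|)) ->
  exists J : l2 R -> L, linear J /\
    forall w : l2 R, `|J w| = N (w 0%N) (l2norm (l2_tail w)).
Proof.
move=> EN N00 NL; pose S n (w : l2 R) : L := w 0%N *: E0 + \sum_(i < n) w i.+1 *: E i.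
have SN n (w : l2 R) : `|S n w| = N (w 0%N) (Num.sqrt (\sum_(i < n) l2_tail w i ^+ 2)).
  rewrite /S (EN (w 0%N) n (fun i => w i.+1)); congr (N _ (Num.sqrt _)).
  by apply: eq_bigr => i _; rewrite l2_tailE.
have Slin n : linear (S n).
  move=> a v w; rewrite /S scalerDr scaler_sumr addrACA -big_split/=.
  congr (_ + _); first by rewrite scalerA -scalerDl.
  by apply: eq_bigr => i _; rewrite scalerA -scalerDl.
have SB n (v w : l2 R) : S n (v - w) = S n v - S n w.
  by rewrite -scaleN1r addrC Slin scaleN1r addrC.
have C0 : 0 <= C.
  by have := le_trans (normr_ge0 _) (NL 1 0 0 0); rewrite subr0 subrr normr0 normr1 addr0 mulr1.
(* [S n] reads the coordinates 0 to n, hence the truncation at n.+1. *)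
have S_fin m n (w : l2 R) : (n <= m)%N -> S m (l2_fin n.+1 w) = S n w.
  move=> nm; rewrite /S l2_finE/=; congr (_ + _).
  rewrite [RHS](big_ord_widen_cond m xpredT (fun i : nat => w i.+1 *: E i))//.
  rewrite [RHS]big_mkcond; apply: eq_bigr => i _.
  by rewrite l2_finE ltnS/=; case: ifP; rewrite ?scale0r.
have S_close m n (w : l2 R) : (n <= m)%N -> `|S m w - S n w| <= C * l2norm (w - l2_fin n.+1 w).
  move=> nm; rewrite -(S_fin m n w nm) -SB SN.
  set z := w - _; have -> : z 0%N = 0.
    by rewrite -[LHS]/(w 0%N - l2_fin n.+1 w 0%N) l2_finE/= subrr.
  have := NL 0 (Num.sqrt (\sum_(i < m) l2_tail z i ^+ 2)) 0 0.
  rewrite N00 !subr0 normr0 add0r => /(le_trans (ler_norm _))/le_trans; apply.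
  rewrite ler_wpM2l// ger0_norm ?sqrtr_ge0// ler_wsqrtr// l2dot_tail.
  by rewrite (le_trans (l2dot_sum_le _ _))// lerDr -expr2 sqr_ge0.
have ex_J (w : l2 R) : exists l : L, (fun n => S n w) @ \oo --> l.
  have [|l lE] := L1_complete_seq (u := fun n => S n w).
    move=> e e0; have C10 : 0 < C + 1 by rewrite ltr_wpDl.
    have [K KE] := l2_fin_cvg w (divr_gt0 e0 C10); exists K => m n Km Kn.
    have main p q : (K <= p)%N -> (p <= q)%N -> `|S q w - S p w| <= e.
      move=> Kp pq; rewrite (le_trans (S_close q p w pq))//.
      apply: (@le_trans _ _ (C * (e / (C + 1)))).
        by rewrite ler_wpM2l// KE// (leq_trans Kp).
      rewrite mulrA ler_pdivrMr// mulrC ler_wpM2l ?ltW//; lra.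
    by case: (leqP n m) => [|/ltnW] nm; [|rewrite distrC]; exact: main.
  exists l; apply/cvgrPdist_le => e /lE[K KE]; exists K => // n /= Kn.
  by rewrite distrC KE.
have [J JE] := choice ex_J; exists J; split=> [a v w|w].
  rewrite -[LHS](cvg_lim (@norm_hausdorff _ L) (JE (a *: v + w))).
  apply: (cvg_lim (@norm_hausdorff _ L)).
  have -> : (fun n => S n (a *: v + w)) = (fun n => a *: S n v + S n w).
    by apply/funext => n; exact: Slin.
  by apply: cvgD; [apply: cvgZl_tmp; exact: JE|exact: JE].
have T_cvg : (fun n => Num.sqrt (\sum_(i < n) l2_tail w i ^+ 2) : R) @ \oo -->
    l2norm (l2_tail w).
  apply: (@continuous_cvg _ _ _ _ _ _ (@Num.sqrt R)); first exact: sqrt_continuous.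
  have := @l2dot_cvg R (l2_tail w) (l2_tail w).
  by under eq_fun do under eq_bigr do rewrite -expr2.
have nS : (fun n => `|S n w|) @ \oo --> `|J w| by apply: cvg_norm.
rewrite -[LHS](cvg_lim (@norm_hausdorff _ R^o) nS).
apply: (cvg_lim (@norm_hausdorff _ R^o)).
apply/cvgrPdist_le => e e0; have C10 : 0 < C + 1 by rewrite ltr_wpDl.
move/cvgrPdist_le : T_cvg => /(_ _ (divr_gt0 e0 C10))[K _ KE].
exists K => // n /KE /= H; rewrite SN (le_trans (NL _ _ _ _))//.
rewrite subrr normr0 add0r (le_trans (ler_wpM2l C0 H))//.
by rewrite mulrA ler_pdivrMr// mulrC ler_wpM2l ?ltW//; lra.
Qed.

End l2_embedding.

(** For each n a ball of radius 1 / (n + 1) belongs to the filter. Any two such balls meet, so their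
    centres form a Cauchy sequence, and the filter converges to its limit. *)
Lemma sequentially_complete (R : realType) (V : normedModType R) :
  (forall u : nat -> V,
    (forall e, 0 < e -> exists N, forall m n, (N <= m)%N -> (N <= n)%N ->
       `|u m - u n| <= e) ->
    exists v, forall e, 0 < e -> exists N, forall n, (N <= n)%N -> `|u n - v| <= e) ->
  forall F : set_system V, ProperFilter F -> cauchy F -> cvg F.
Proof.
move=> VC F FF /cauchyP FC.
have [u uE] := choice (fun n : nat => FC _ (@harmonic_gt0 R n)).
have meet m n : `|u m - u n| < harmonic m + harmonic n :> R.
  have [x [/= xm xn]] := filter_ex (filterI (uE m) (uE n)).
  rewrite -ball_normE/= in xm xn.
  by rewrite -(subrKA x) (le_lt_trans (ler_normD _ _))// ltrD// distrC.
have small e : 0 < e -> exists N, forall n, (N <= n)%N -> harmonic n <= e :> R.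
  move=> e0; have /cvgrPdist_le/(_ _ e0)[N _ NE] := @cvg_harmonic R.
  exists N => n /NE /=; rewrite sub0r normrN; exact: le_trans (ler_norm _).
have [|v vE] := VC u.
  move=> e e0; have e20 : 0 < e / 2 by rewrite divr_gt0.
  have [N NE] := small _ e20; exists N => m n Nm Nn.
  by rewrite (le_trans (ltW (meet m n)))// [leRHS]splitr lerD// NE.
apply/cvg_ex; exists v; apply/cvgrPdist_le => e e0.
have e20 : 0 < e / 2 by rewrite divr_gt0.
have [N NE] := small _ e20; have [M ME] := vE _ e20.
pose n := maxn N M; apply: filterS (uE n) => x; rewrite -ball_normE/= => xn.
rewrite -(subrKA (u n)) (le_trans (ler_normD _ _))// [leRHS]splitr lerD//.
  by rewrite distrC ME// leq_maxr.
by rewrite (le_trans (ltW xn))// NE// leq_maxl.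
Qed.

Section hilbert_space.
Variable R : realType.

HB.instance Definition _ := @Lmodule_isNormed.Build R (l2 R) (@l2norm R)
  (@l2normD R) (@l2normZ R) (@l2norm_eq0 R).

Let l2_cauchy_cvg (F : set_system (l2 R)) : ProperFilter F -> cauchy F -> cvg F.
Proof. exact: sequentially_complete (@l2_complete R) F. Qed.

HB.instance Definition _ := Uniform_isComplete.Build (l2 R) l2_cauchy_cvg.

Let l2dot_bilinear :
  @bilinear_for R (l2 R) (l2 R) R ( *%R ) ( *%R ) (@l2dot R).
Proof.
split=> [w|w] a u v /=; first by rewrite l2dotDl l2dotZl.
by rewrite l2dotDr l2dotZr.
Qed.

(** The same property with the trivial conjugation [idfun] made explicit, the form in which
    sesquilinear structures are declared. *)
Let l2dot_bilinear' :
  @bilinear_for R (l2 R) (l2 R) R ( *%R ) (idfun \; *%R ) (@l2dot R).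
Proof. exact: l2dot_bilinear. Qed.

HB.instance Definition _ := bilinear_isBilinear.Build R (l2 R) (l2 R) R
  *%R (idfun \; *%R) (@l2dot R) l2dot_bilinear'.

Let l2dot_herm (u v : l2 R) : l2dot u v = (-1) ^+ false * idfun (l2dot v u).
Proof. by rewrite expr0 mul1r l2dotC. Qed.

HB.instance Definition _ := isHermitianSesquilinear.Build R (l2 R) false idfun
  (@l2dot R) l2dot_herm.

Let l2dot_gt0 (u : l2 R) : u != 0 -> 0 < l2dot u u.
Proof.
move=> u0; rewrite lt_neqAle l2dot_ge0 andbT eq_sym; apply: contraNN u0 => /eqP u0.
by apply/eqP/l2norm_eq0; rewrite /l2norm u0 sqrtr0.
Qed.

HB.instance Definition _ := isDotProduct.Build R (l2 R) (@l2dot R) l2dot_gt0.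

Lemma l2_hilbert : hilbert (l2 R).
Proof. by exists (@l2dot R) => x; exact: sqr_l2norm. Qed.

End hilbert_space.

(** * The space X and its dual *)

Section linear_maps.
Variable R : realType.

Lemma linear_bundle (V W : lmodType R) (J : V -> W) : linear J ->
  exists f : {linear V -> W}, forall x, f x = J x.
Proof.
move=> lJ; pose f : {linear V -> W} := HB.pack_for {linear V -> W} J
  (GRing.isLinear.Build R V W *:%R J lJ).
by exists f.
Qed.

Lemma linear_le_continuous (V W : normedModType R) (f : {linear V -> W}) K :
  (forall x, `|f x| <= K * `|x|) -> continuous f.
Proof.
move=> fK; apply/linear_bounded_continuous/linear_boundedP; near=> k => x.
rewrite (le_trans (fK x))// ler_wpM2r//; near: k; exact: nbhs_pinfty_ge.
Unshelve. all: by end_near. Qed.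

End linear_maps.

Section space.
Variable R : realType.
Implicit Types v w : l2 R.

Definition l2pnorm v : R := pnorm (v 0%N) (l2norm (l2_tail v)).

Let l2pnorm_embedding : exists J : l2 R -> L1_unit_interval R,
  linear J /\ forall v, `|J v| = l2pnorm v.
Proof.
have [E0 [E EE]] := pnorm_embedding R.
exact: l2_embedding EE (pnorm0 R) (@pnorm_lip R).
Qed.

(** The triangle inequality is transported from L1 along the linear map J. *)
Lemma l2pnormD v w : l2pnorm (v + w) <= l2pnorm v + l2pnorm w.
Proof.
have [J [/linear_bundle[f fE] JE]] := l2pnorm_embedding.
by rewrite -!JE -!fE linearD ler_normD.
Qed.

Lemma l2pnormZ a v : l2pnorm (a *: v) = `|a| * l2pnorm v.
Proof.
have [J [/linear_bundle[f fE] JE]] := l2pnorm_embedding.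
by rewrite -!JE -!fE linearZ normrZ.
Qed.

Let l2norm_tail v : l2norm v = Num.sqrt (v 0%N ^+ 2 + l2norm (l2_tail v) ^+ 2).
Proof. by rewrite sqr_l2norm [LHS]/l2norm l2dot_tail expr2. Qed.

Lemma l2pnorm_lower v : 2 * l2norm v <= l2pnorm v.
Proof. by rewrite l2norm_tail pnorm_lower. Qed.

Lemma l2pnorm_upper v : l2pnorm v <= 3 * l2norm v.
Proof. by rewrite l2norm_tail pnorm_upper. Qed.

Lemma l2pnorm_eq0 v : l2pnorm v = 0 -> v = 0.
Proof.
move=> v0; apply: l2norm_eq0; have := l2pnorm_lower v.
by rewrite v0; have := l2norm_ge0 v; lra.
Qed.

(** A second name for the vector space, so that the two norms are attached to different types. *)
Definition l2p : Type := l2 R.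

HB.instance Definition _ := GRing.Lmodule.copy l2p (l2 R).

HB.instance Definition _ := @Lmodule_isNormed.Build R l2p l2pnorm
  l2pnormD l2pnormZ l2pnorm_eq0.

Let l2p_complete (u : nat -> l2p) :
  (forall e, 0 < e -> exists N, forall m n, (N <= m)%N -> (N <= n)%N ->
    `|u m - u n| <= e) ->
  exists v : l2p, forall e, 0 < e -> exists N, forall n, (N <= n)%N -> `|u n - v| <= e.
Proof.
move=> uC; have [|v vE] := @l2_complete R u.
  move=> e /uC[N NE]; exists N => m n Nm Nn.
  have := le_trans (l2pnorm_lower (u m - u n)) (NE m n Nm Nn).
  by have := l2norm_ge0 (u m - u n); lra.
exists v => e e0; have [|N NE] := vE (e / 3); first by rewrite divr_gt0.
exists N => n Nn; rewrite (le_trans (l2pnorm_upper (u n - v)))//.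
by rewrite mulrC -ler_pdivlMr// NE.
Qed.

Let l2p_cauchy_cvg (F : set_system l2p) : ProperFilter F -> cauchy F -> cvg F.
Proof. exact: sequentially_complete l2p_complete F. Qed.

HB.instance Definition _ := Uniform_isComplete.Build l2p l2p_cauchy_cvg.

Lemma l2p_isometric_embedding : isometric_embedding l2p (L1_unit_interval R).
Proof.
have [J [lJ JE]] := l2pnorm_embedding.
have [f fE] := @linear_bundle R l2p _ J lJ.
by exists f => x; rewrite fE JE.
Qed.

Lemma l2p_homeomorphic : linearly_homeomorphic l2p (l2 R).
Proof.
have l1 : linear (idfun : l2p -> l2 R) by [].
have l2 : linear (idfun : l2 R -> l2p) by [].
have [f fE] := linear_bundle l1; have [g gE] := linear_bundle l2.
exists f, g; split=> [x|x||].
- by rewrite gE fE.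
- by rewrite fE gE.
- apply: (@linear_le_continuous _ _ _ f 2^-1) => x; rewrite fE.
  by have := l2pnorm_lower x; rewrite -ler_pdivlMl.
- apply: (@linear_le_continuous _ _ _ g 3) => x; rewrite gE.
  exact: l2pnorm_upper.
Qed.

Lemma l2p_separable : separable l2p.
Proof.
pose q (s : seq rat) : l2p := l2_fin (size s) (fun i => ratr (nth 0 s i)).
exists (range q); first exact: sub_countable (card_image_le _ _) (countableP _).
move=> O [v Ov] oO.
have /nbhs_ballP[e /= e0 eO] : nbhs v O by apply: open_nbhs_nbhs.
(* Two errors of e / 12, multiplied by the constant 3 of [l2pnorm_upper], stay below e. *)
have e6 : 0 < e / 12 by rewrite divr_gt0.
have [N /(_ N (leqnn _)) vN] := l2_fin_cvg v e6.
(* N coordinate errors of at most d have l2 norm at most sqrt(N) d, and (N + 1) d = e / 12. *)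
pose d := e / 12 / N.+1%:R; have d0 : 0 < d by rewrite divr_gt0.
have ex_r i : exists r : rat, `|v i - ratr r| <= d.
  have /rat_in_itvoo[r] : v i - d < v i + d by lra.
  rewrite in_itv/= => /andP[r1 r2]; exists r; rewrite ler_norml.
  by apply/andP; split; lra.
have [r rE] := choice ex_r; pose s := mkseq r N.
exists (q s); split; last by exists s.
apply: eO; rewrite -ball_normE /ball_/=.
have -> : q s = l2_fin N (fun i => ratr (r i)).
  apply: l2P => i; rewrite !l2_finE size_mkseq; case: ifP => // iN.
  by rewrite nth_mkseq.
have step : l2norm (l2_fin N v - l2_fin N (fun i => ratr (r i))) <= e / 12.
  have -> : l2_fin N v - l2_fin N (fun i => ratr (r i)) =
      l2_fin N (fun i => v i - ratr (r i)).
    apply: l2P => i; rewrite l2_finE.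
    rewrite -[LHS]/(l2_fin N v i - l2_fin N (fun i => ratr (r i)) i) !l2_finE.
    by case: ifP => _; rewrite ?subrr.
  rewrite /l2norm l2dot_fin_fin -[leRHS]gtr0_norm// -sqrtr_sqr ler_wsqrtr//.
  apply: (@le_trans _ _ (\sum_(i < N) d ^+ 2)).
    apply: ler_sum => i _; rewrite -[leLHS]real_normK ?num_real//.
    by rewrite lerXn2r ?nnegrE// ltW.
  rewrite sumr_const card_ord -[leLHS]mulr_natr.
  have -> : e / 12 = d * N.+1%:R by rewrite divfK// pnatr_eq0.
  rewrite [(d * _) ^+ 2]exprMn ler_wpM2l ?sqr_ge0// -natrX ler_nat.
  by rewrite (leq_trans (leqnSn N))// -{1}[N.+1]expn1 leq_pexp2l.
apply: le_lt_trans (l2pnorm_upper _) _.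
have := l2normD (v - l2_fin N v) (l2_fin N v - l2_fin N (fun i => ratr (r i))).
rewrite subrKA => h; apply: (@le_lt_trans _ _ (3 * (e / 12 + e / 12))).
  by rewrite ler_wpM2l// (le_trans h)// lerD.
rewrite (_ : 3 * _ = e / 2); last by field.
by rewrite ltr_pdivrMr// ltr_pMr// ltr1n.
Qed.

Definition unit_vector (j : nat) : l2 R := l2_fin j.+1 (fun i => (i == j)%:R).

Lemma unit_vectorE j i : unit_vector j i = (i == j)%:R.
Proof.
rewrite l2_finE ltnS; case: ifPn => //.
by rewrite -ltnNge => ji; rewrite gtn_eqF.
Qed.

Lemma l2_sumE n (c : 'I_n -> R) (f : 'I_n -> l2 R) i :
  (\sum_(j < n) c j *: f j) i = \sum_(j < n) c j * f j i.
Proof. by elim/big_rec2: _ => [//|j x y _ <-]. Qed.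

Lemma l2p_infinite_dimensional : ~ finite_dimensional l2p.
Proof.
move=> [n [b bE]].
have [a aE] := choice (fun j : 'I_n.+1 => bE (unit_vector j)).
(* With more rows than columns, A has a nonzero c such that c A = 0, that is, a linear relation
   between n + 1 unit vectors. *)
pose A : 'M[R]_(n.+1, n) := \matrix_(j, i) a j i.
have : kermx A != 0.
  by rewrite -mxrank_eq0 mxrank_ker subn_eq0 -ltnNge ltnS rank_leq_col.
case/rowV0Pn => c /sub_kermxP cA /rV0Pn[j]; apply/negP; rewrite negbK; apply/eqP.
have : \sum_(k < n.+1) c 0 k *: (unit_vector k : l2p) = 0.
  under eq_bigr do rewrite aE scaler_sumr.
  rewrite exchange_big big1// => i _.
  under eq_bigr do rewrite scalerA.
  rewrite -scaler_suml (_ : \sum_(k < n.+1) _ = (c *m A) 0 i).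
    by rewrite cA mxE scale0r.
  by rewrite mxE; apply: eq_bigr => k _; rewrite mxE.
move=> /(congr1 (fun w : l2 R => w j)); rewrite (l2_sumE _ (fun k : 'I_n.+1 => unit_vector k)).
rewrite (bigD1 j)//= unit_vectorE eqxx mulr1 big1 ?addr0// => k kj.
by rewrite unit_vectorE val_eqE eq_sym (negbTE kj) mulr0.
Qed.

Lemma hilbert_parallelogram (H : completeNormedModType R) (x y : H) : hilbert H ->
  `|x + y| ^+ 2 + `|x - y| ^+ 2 = 2 * (`|x| ^+ 2 + `|y| ^+ 2).
Proof.
move=> [dot dE]; rewrite !dE.
have -> : dot (x + y) (x + y) = dot x x + dot x y + (dot y x + dot y y).
  by rewrite linearDl !linearDr.
have -> : dot (x - y) (x - y) = dot x x - dot x y + (- dot y x - - dot y y).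
  by rewrite linearDl !linearDr !linearNl !linearNr.
by ring.
Qed.

Lemma l2p_not_hilbert :
  ~ (exists H : completeNormedModType R, hilbert H /\ linearly_isometric l2p H).
Proof.
move=> [H [hH [f [fE _]]]].
pose e0 : l2p := unit_vector 0; pose e1 : l2p := unit_vector 1.
have tl (a b : R) : `|a *: e0 + b *: e1| = pnorm a b.
  have c0 : (a *: e0 + b *: e1 : l2 R) 0%N = a.
    by rewrite -[LHS]/(a * unit_vector 0 0%N + b * unit_vector 1 0%N) !unit_vectorE
      mulr1 mulr0 addr0.
  have ct : l2_tail (a *: e0 + b *: e1) = l2_fin 1 (fun=> b).
    apply: l2P => i; rewrite l2_tailE l2_finE.
    rewrite -[LHS]/(a * unit_vector 0 i.+1 + b * unit_vector 1 i.+1) !unit_vectorE.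
    by rewrite mulr0 add0r eqSS; case: i => [|i]/=; rewrite ?mulr1 ?mulr0.
  rewrite -[LHS]/(pnorm ((a *: e0 + b *: e1 : l2 R) 0%N)
    (l2norm (l2_tail (a *: e0 + b *: e1)))) c0 ct /l2norm l2dot_fin_fin.
  by rewrite big_ord1 sqrtr_sqr -pnorm_norm normr_id pnorm_norm.
(* The norms of e0 and e1 are 3 and 2, those of e0 + e1 and e0 - e1 are 5 / sqrt 2: the two sides
   are 25 and 26. *)
have := hilbert_parallelogram (f e0) (f e1) hH.
rewrite -linearD -linearB !fE.
have := tl 1 1; have := tl 1 (-1); have := tl 1 0; have := tl 0 1.
rewrite !scale1r !scale0r scaleN1r addr0 add0r => -> -> -> ->.
rewrite /pnorm !(expr1n, expr0n)/= sqrrN expr1n !mulr1 !mulr0 addr0 add0r addr0 add0r.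
rewrite sqrtr1 !divr1 !expr_div_n sqr_sqrtr//.
have -> : (3 + 2) ^+ 2 / (1 + 1) = 25 / 2 :> R by field.
by lra.
Qed.

End space.

(** * Functionals on X and the dual norm *)

Section dual_space.
Variable R : realType.
Implicit Types phi : dual (l2p R).

Lemma dual_norm_bound (V : normedModType R) (f : dual V) (x : V) :
  `|f x| <= dual_norm f * `|x|.
Proof.
have [->|x0] := eqVneq x 0; first by rewrite raddf0 !normr0 mulr0.
have nx : 0 < `|x| by rewrite normr_gt0.
have : `|f (`|x|^-1 *: x)| <= dual_norm f.
  by rewrite dual_norm_ub// normrZ normfV normr_id mulVf// gt_eqF.
by rewrite linearZ/= normrZ normfV normr_id ler_pdivrMl// mulrC.
Qed.

Let coefs phi (i : nat) : R := phi (unit_vector R i).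

Let dual_fin phi n (f : nat -> R) :
  phi (l2_fin n f) = \sum_(i < n) f i * coefs phi i.
Proof.
have -> : l2_fin n f = \sum_(i < n) f i *: (unit_vector R i : l2p R).
  apply: l2P => i; rewrite (l2_sumE _ (fun k : 'I_n => unit_vector R k)) l2_finE.
  under eq_bigr do rewrite unit_vectorE.
  case: ifPn => [iN|].
    rewrite (bigD1 (Ordinal iN))//= eqxx mulr1 big1 ?addr0// => k kj.
    rewrite (_ : (i == k) = false) ?mulr0//; apply: contraNF kj => /eqP ik.
    by apply/eqP/val_inj.
  rewrite -leqNgt => ni; rewrite big1// => k _.
  by rewrite gtn_eqF ?mulr0// (leq_trans (ltn_ord k)).
by rewrite linear_sum; apply: eq_bigr => i _; rewrite linearZ.
Qed.

(** Tested on its own truncated coefficients, phi takes the value S, so S is at most 3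
    [dual_norm phi] times sqrt S. *)
Let coefs_bound phi n : \sum_(i < n) coefs phi i ^+ 2 <= (dual_norm phi * 3) ^+ 2.
Proof.
set S := \sum_(i < n) _.
have S0 : 0 <= S by apply: sumr_ge0 => i _; exact: sqr_ge0.
have D0 := dual_norm_ge0 phi.
have : S <= dual_norm phi * 3 * Num.sqrt S.
  have -> : S = phi (l2_fin n (coefs phi)) by rewrite dual_fin; apply: eq_bigr.
  rewrite (le_trans (ler_norm _))// (le_trans (dual_norm_bound _ _))//.
  rewrite -mulrA ler_wpM2l// (le_trans (l2pnorm_upper _))// ler_wpM2l//.
  by rewrite dual_fin /l2norm l2dot_fin_fin ler_wsqrtr// ler_sum// => i _.
rewrite -{1}[S](sqr_sqrtr S0) expr2; have [s0|s0] := ltP 0 (Num.sqrt S).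
  rewrite ler_pM2r// -{2}[S](sqr_sqrtr S0) => h.
  by rewrite lerXn2r ?nnegrE ?sqrtr_ge0 ?mulr_ge0.
move=> _; have -> : S = 0 by apply/eqP; rewrite eq_le S0 andbT -sqrtr_eq0 eq_le s0 sqrtr_ge0.
exact: sqr_ge0.
Qed.

Let ex_riesz phi : exists a : l2 R, forall i, a i = coefs phi i.
Proof. by have [a aE _] := l2_mk (coefs_bound phi); exists a. Qed.

(** The vector representing phi for the inner product of l2, which is not the norm of X. *)
Definition riesz phi : l2 R := projT1 (cid (ex_riesz phi)).

Let rieszE phi i : riesz phi i = phi (unit_vector R i).
Proof. by rewrite /riesz; case: cid. Qed.

Lemma riesz_is_linear : linear riesz.
Proof.
move=> a f g; apply: l2P => i.
by rewrite -[RHS]/(a * riesz f i + riesz g i) !rieszE.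
Qed.

Lemma riesz_dot phi (v : l2p R) : phi v = l2dot (riesz phi) v.
Proof.
symmetry; apply: l2dot_lim; apply/cvgrPdist_le => e e0.
pose D : R := dual_norm phi * 3.
have D0 : 0 <= D by rewrite mulr_ge0 ?dual_norm_ge0.
have D10 : 0 < D + 1 by rewrite ltr_wpDl.
have [N NE] := l2_fin_cvg v (divr_gt0 e0 D10).
exists N => // n /NE /= h.
have -> : \sum_(i < n) riesz phi i * (v : l2 R) i = phi (l2_fin n (v : l2 R)).
  by rewrite dual_fin; apply: eq_bigr => i _; rewrite rieszE mulrC.
rewrite -linearB (le_trans (dual_norm_bound _ _))//.
apply: (@le_trans _ _ (dual_norm phi * (3 * l2norm (v - l2_fin n (v : l2 R))))).
  by rewrite ler_wpM2l ?dual_norm_ge0// l2pnorm_upper.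
rewrite mulrA -/D (le_trans (ler_wpM2l D0 h))//.
by rewrite mulrA ler_pdivrMr// mulrC ler_wpM2l ?ltW//; lra.
Qed.

(** (x, 0) is the midpoint of (x, t) and (x, - t), which have equal norms. *)
Let pnorm_axis (x t : R) : pnorm x 0 <= pnorm x t.
Proof.
have := pnormD x t x (- t); rewrite subrr -[pnorm x (- t)]pnorm_norm normrN pnorm_norm.
have -> : pnorm (x + x) 0 = 2 * pnorm x 0.
  by have := pnormZ 2 x 0; rewrite mulr0 mulr_natl ger0_norm// => <-; rewrite mulr2n.
by lra.
Qed.

(** Cauchy-Schwarz on the tails bounds phi by the planar pairing; conversely a planar point (x, t)
    is realised by a vector whose tail is parallel to that of [riesz phi]. *)
Lemma dual_normE phi :
  dual_norm phi = pdual (riesz phi 0%N) (l2norm (l2_tail (riesz phi))).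
Proof.
set a := riesz phi; set T := l2norm _.
apply/le_anti/andP; split.
  apply: dual_norm_le => x x1; rewrite riesz_dot -/a l2dot_tail.
  rewrite (le_trans (ler_normD _ _))//.
  apply: (@le_trans _ _ (`|(x : l2 R) 0%N| * `|a 0%N| + l2norm (l2_tail x) * `|T|)).
    rewrite normrM mulrC lerD// mulrC (ger0_norm (l2norm_ge0 _)).
    exact: l2_cauchy_schwarz.
  rewrite -(pdual_norm (a 0%N)); apply: pdual_ub.
  rewrite -(ger0_norm (l2norm_ge0 (l2_tail x))) pnorm_norm; exact: x1.
apply: pdual_le => x t xt.
(* If T = 0 then t / T = 0 and v = x *: e. *)
pose e : l2 R := unit_vector R 0.
pose v : l2 R := x *: e + (t / T) *: (a - a 0%N *: e).
have e00 : e 0%N = 1 by rewrite /e unit_vectorE.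
have v0 : v 0%N = x.
  rewrite -[LHS]/(x * e 0%N + (t / T) * (a 0%N - a 0%N * e 0%N)) e00.
  by rewrite !mulr1 subrr mulr0 addr0.
have te : l2_tail e = 0.
  by apply: l2P => i; rewrite l2_tailE /e unit_vectorE.
have tv : l2_tail v = (t / T) *: l2_tail a.
  by rewrite /v linearD linearZ /= te scaler0 add0r linearZ /= linearB /= linearZ /=
    te scaler0 subr0.
have phiv : phi (v : l2p R) = x * a 0%N + t * T.
  rewrite riesz_dot l2dot_tail v0 tv l2dotZr -sqr_l2norm -/T mulrC; congr (_ + _).
  have [->|T0] := eqVneq T 0; first by rewrite expr0n mulr0 mulr0.
  by field.
rewrite -phiv (le_trans (ler_norm _))//; apply: dual_norm_ub.
rewrite -[X in X <= _]/(pnorm (v 0%N) (l2norm (l2_tail v))) v0 tv l2normZ -/T.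
have [T0|T0] := eqVneq T 0.
  by rewrite T0 mulr0 (le_trans (pnorm_axis x t)).
rewrite normrM normfV (ger0_norm (l2norm_ge0 _)) -/T divfK//.
by rewrite -pnorm_norm normr_id pnorm_norm.
Qed.

Lemma dual_isometric_embedding :
  isometric_embedding (dual (l2p R)) (L1_unit_interval R).
Proof.
have [E0 [E EE]] := pdual_embedding R.
have p00 : pdual 0 0 = 0 :> R.
  by have := pdualZ 0 (0 : R) 0; rewrite !mul0r normr0 mul0r.
have [J [lJ JE]] := l2_embedding EE p00 (@pdual_lip R).
have lJr : linear (J \o riesz).
  by move=> b f g /=; rewrite riesz_is_linear lJ.
have [f fE] := linear_bundle lJr; exists f => phi.
by rewrite fE /= JE -dual_normE.
Qed.

End dual_space.

Theorem theorem1p2 (R : realType) :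
  exists X : completeNormedModType R,
    separable X /\
    ~ finite_dimensional X /\
    (exists H : completeNormedModType R,
        hilbert H /\ linearly_homeomorphic X H) /\
    ~ (exists H : completeNormedModType R,
        hilbert H /\ linearly_isometric X H) /\
    isometric_embedding X (L1_unit_interval R) /\
    isometric_embedding (dual X) (L1_unit_interval R).
Proof.
exists (l2p R); split; first exact: l2p_separable.
split; first exact: l2p_infinite_dimensional.
split; first by exists (l2 R); split; [exact: l2_hilbert|exact: l2p_homeomorphic].
split; first exact: l2p_not_hilbert.
split; first exact: l2p_isometric_embedding.
exact: dual_isometric_embedding.
Qed.
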